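(* Let $1\le p<2$, let $X$ be a subspace of some $L_p$ space, denoted $L_p$, and let $\aleph$ be an uncountable cardinal. The following are equivalent: (1) For all $\varepsilon>0$, $\ell_p(\aleph)$ is $(1+\varepsilon)$-isomorphic to a subspace of $X$. (2) There is a subspace of $X$ that is isomorphic to $\ell_p(\aleph)$ and is complemented in $L_p$. (3) $\ell_p(\aleph)$ embeds isomorphically into $X$. (4) $X$ does not embed isomorphically into any $L_p(\aleph')$ space with $\aleph'<\aleph$.
   Context: An $L_p$ space is a Banach space $L_p(\nu)$ with $\nu$ an arbitrary (not necessarily finite or $\sigma$-finite) measure. Subspaces are closed linear subspaces; a subspace is complemented if it is the range of a bounded linear projection. For an infinite cardinal $\aleph'$, a Banach space is called an $L_p(\aleph')$ space if it is isometric to an $\ell_p$-direct sum $(\sum_{\alpha\in\Gamma} L_p(\mu_\alpha))_p$ with $|\Gamma|\le\aleph'$ and each $\mu_\alpha$ a finite measure. For a cardinal $\aleph$, $\ell_p(\aleph)$ denotes $\ell_p(\Gamma)$ for a set $\Gamma$ of cardinality $\aleph$. Two Banach spaces $Y,Z$ are $(1+\varepsilon)$-isomorphic if there is a linear isomorphism $T$ from $Y$ onto $Z$ with $\|T\|\,\|T^{-1}\|\le 1+\varepsilon$. *)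

(* Defs.v *)
From HB Require Import structures.
From mathcomp Require Import all_boot all_order all_algebra.
From mathcomp Require Import all_classical all_reals all_analysis.
From mathcomp Require Import measurable_realfun ess_sup_inf.

Set Implicit Arguments.
Unset Strict Implicit.
Unset Printing Implicit Defensive.

Import Order.TTheory GRing.Theory Num.Theory.
Import numFieldNormedType.Exports.

Local Open Scope classical_set_scope.
Local Open Scope ring_scope.

(* [LspaceType mu p1] is the library's quotient of the p-integrable measurable
   functions by almost-everywhere equality; it comes without algebraic
   structure or norm, which are provided here. *)
Section Lspace_normed.

Let filterS5 (T : Type) (F : set_system T) (FF : Filter F)
    (P1 P2 P3 P4 P5 Q : set T) :
  (forall x, P1 x -> P2 x -> P3 x -> P4 x -> P5 x -> Q x) ->
  F P1 -> F P2 -> F P3 -> F P4 -> F P5 -> F Q.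
Proof.
move=> PQ F1 F2 F3 F4 F5; apply: filterS3 (filterI F1 F2) (filterI F3 F4) F5.
by move=> x [? ?] [? ?]; exact: PQ.
Qed.

Let filterS4 (T : Type) (F : set_system T) (FF : Filter F)
    (P1 P2 P3 P4 Q : set T) :
  (forall x, P1 x -> P2 x -> P3 x -> P4 x -> Q x) ->
  F P1 -> F P2 -> F P3 -> F P4 -> F Q.
Proof.
move=> PQ F1 F2 F3 F4; apply: filterS2 (filterI F1 F2) (filterI F3 F4).
by move=> x [? ?] [? ?]; exact: PQ.
Qed.

Context d (T : measurableType d) (R : realType).
Variable mu : {measure set T -> \bar R}.

Lemma ae_eq_Lnorm (p : \bar R) (f g : {mfun T >-> R}) :
  f = g %[ae mu] -> 'N[mu]_p[EFin \o f]%E = 'N[mu]_p[EFin \o g]%E.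
Proof.
move=> fg; rewrite unlock; case: p => [r||].
- have mpow (h : {mfun T >-> R}) :
      measurable_fun setT (fun x => `|(EFin \o h) x| `^ r)%E.
    apply/measurable_EFinP.
    apply: (measurableT_comp (measurable_powR r)).
    by apply: measurableT_comp.
  congr (_ `^ _)%E; apply: ge0_ae_eq_integral => //.
  + by move=> x _; exact: poweR_ge0.
  + by move=> x _; exact: poweR_ge0.
  + by apply: filterS fg => x /= + _ => ->.
- case: ifPn => // _; apply: eq_ess_sup.
  by apply: filterS fg => x /= ->.
- case: ifPn => // _; apply: eq_ess_inf.
  by apply: filterS fg => x /= ->.
Qed.

Variables (p : \bar R) (p1 : (1 <= p)%E).

Lemma Lspace_Lfun (f : LspaceType mu p1) : (f : T -> R) \in Lfun mu p.
Proof.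
apply/andP; split; rewrite inE; last exact: Lebesgue_finite.
by rewrite /aqEqMfun_to_fun; case: (repr _) => g [[mg]] /=; exact: mg.
Qed.

Definition Lspace_repr (f : LspaceType mu p1) : LfunType mu p1 :=
  Lfun_Sub p1 (Lspace_Lfun f).

Local Notation Q := {mfun_ mu, T >-> measurableTypeR R}.

Lemma Lfun_measurableTypeR (f : LfunType mu p1) :
  measurable_fun [set: T] (f : T -> measurableTypeR R).
Proof. exact: (@measurable_funPT _ _ _ _ f). Qed.

Definition Lfun_mfun (f : LfunType mu p1) : {mfun T >-> measurableTypeR R} :=
  HB.pack_for {mfun T >-> measurableTypeR R} (f : T -> measurableTypeR R)
    (@isMeasurableFun.Build _ _ _ _ _ (Lfun_measurableTypeR f)).

Lemma repr_pi_Lfun (f : LfunType mu p1) :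
  (repr (\pi_Q%qT (Lfun_mfun f)) : T -> R) = f %[ae mu].
Proof.
suff: ae_eq_op mu (repr (\pi_Q%qT (Lfun_mfun f))) (Lfun_mfun f) by move/asboolP.
by rewrite -eqmodE reprK.
Qed.

Lemma mfunR_repr (f : Q) : (f : T -> R) \in @mfun _ _ T R.
Proof.
by rewrite inE /aqEqMfun_to_fun; case: (repr _) => g [[mg]] /=; exact: mg.
Qed.

Lemma Lnorm_pi_Lfun (f : LfunType mu p1) :
  'N[mu]_p[EFin \o (\pi_Q%qT (Lfun_mfun f) : Q)]%E = 'N[mu]_p[EFin \o f]%E.
Proof.
exact: (@ae_eq_Lnorm p (mfun_Sub (mfunR_repr (\pi_Q%qT (Lfun_mfun f)))) f
  (repr_pi_Lfun f)).
Qed.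

Lemma pi_Lfun_finite (f : LfunType mu p1) :
  finite_norm mu p (\pi_Q%qT (Lfun_mfun f) : Q).
Proof. by rewrite /finite_norm Lnorm_pi_Lfun; exact: Lfunction_finite. Qed.

Definition Lspace_class (f : LfunType mu p1) : LspaceType mu p1 :=
  HB.pack_for (LspaceType mu p1) (\pi_Q%qT (Lfun_mfun f) : Q)
    (@isFinLebesgue.Build _ _ _ _ _ p1 _ (pi_Lfun_finite f)).

Lemma Lspace_inj (f g : LspaceType mu p1) : (f : Q) = g -> f = g.
Proof.
case: f g => [f [[hf]]] [g [[hg]]] /= fg; case: _ / fg in hg *.
by rewrite (bool_irrelevance hf hg).
Qed.

Lemma Lspace_classK (f : LfunType mu p1) :
  (Lspace_repr (Lspace_class f) : T -> R) = f %[ae mu].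
Proof. exact: repr_pi_Lfun. Qed.

Lemma Lspace_ext (f g : LspaceType mu p1) :
  (f : T -> R) = g %[ae mu] -> f = g.
Proof.
move=> fg; apply: Lspace_inj; rewrite -[LHS]reprK -[RHS]reprK.
apply/eqP; rewrite eqmodE.
exact/asboolP.
Qed.

HB.instance Definition _ := gen_eqMixin (LspaceType mu p1).
HB.instance Definition _ := gen_choiceMixin (LspaceType mu p1).

Definition Lspace_zero : LspaceType mu p1 := Lspace_class 0.
Definition Lspace_opp (f : LspaceType mu p1) := Lspace_class (- Lspace_repr f).
Definition Lspace_add (f g : LspaceType mu p1) :=
  Lspace_class (Lspace_repr f + Lspace_repr g).
Definition Lspace_scale (a : R) (f : LspaceType mu p1) :=
  Lspace_class (a *: Lspace_repr f).
Definition Lspace_norm (f : LspaceType mu p1) : R :=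
  fine 'N[mu]_p[EFin \o f]%E.

Lemma Lspace_zeroE : (Lspace_zero : T -> R) = cst 0 %[ae mu].
Proof. exact: Lspace_classK. Qed.

Lemma Lspace_oppE f : (Lspace_opp f : T -> R) = (fun x => - f x) %[ae mu].
Proof. exact: Lspace_classK. Qed.

Lemma Lspace_addE f g :
  (Lspace_add f g : T -> R) = (fun x => f x + g x) %[ae mu].
Proof. exact: Lspace_classK. Qed.

Lemma Lspace_scaleE a f :
  (Lspace_scale a f : T -> R) = (fun x => a * f x) %[ae mu].
Proof. exact: Lspace_classK. Qed.

Let addA : associative Lspace_add.
Proof.
move=> f g h; apply: Lspace_ext.
have := Lspace_addE g h; have := Lspace_addE f g.
have := Lspace_addE (Lspace_add f g) h; have := Lspace_addE f (Lspace_add g h).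
apply: filterS4 => x /= e1 e2 e3 e4 xT.
by rewrite e1// e2// e3// e4// addrA.
Qed.

Let addC : commutative Lspace_add.
Proof.
move=> f g; apply: Lspace_ext.
have := Lspace_addE g f; have := Lspace_addE f g.
by apply: filterS2 => x /= e1 e2 xT; rewrite e1// e2// addrC.
Qed.

Let add0 : left_id Lspace_zero Lspace_add.
Proof.
move=> f; apply: Lspace_ext.
have := Lspace_addE Lspace_zero f; have := Lspace_zeroE.
by apply: filterS2 => x /= e1 e2 xT; rewrite e2// e1// add0r.
Qed.

Let addN : left_inverse Lspace_zero Lspace_opp Lspace_add.
Proof.
move=> f; apply: Lspace_ext.
have := Lspace_addE (Lspace_opp f) f; have := Lspace_oppE f.
have := Lspace_zeroE.
by apply: filterS3 => x /= e1 e2 e3 xT; rewrite e3// e2// e1// addNr.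
Qed.

HB.instance Definition _ :=
  GRing.isZmodule.Build (LspaceType mu p1) addA addC add0 addN.

Let scaleA a b f :
  Lspace_scale a (Lspace_scale b f) = Lspace_scale (a * b) f.
Proof.
apply: Lspace_ext.
have := Lspace_scaleE a (Lspace_scale b f); have := Lspace_scaleE b f.
have := Lspace_scaleE (a * b) f.
by apply: filterS3 => x /= e1 e2 e3 xT; rewrite e3// e2// e1// mulrA.
Qed.

Let scale1 : left_id 1 Lspace_scale.
Proof.
move=> f; apply: Lspace_ext; have := Lspace_scaleE 1 f.
by apply: filterS => x /= e1 xT; rewrite e1// mul1r.
Qed.

Let scaleDr : right_distributive Lspace_scale +%R.
Proof.
move=> a f g; apply: Lspace_ext.
have e := Lspace_scaleE a f; have := Lspace_scaleE a g.
have := Lspace_addE (Lspace_scale a f) (Lspace_scale a g).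
have := Lspace_addE f g; have := Lspace_scaleE a (f + g).
move: e; apply: filterS5 => x /= e5 e1 e2 e3 e4 xT.
by rewrite e1// e2// e3// e4// e5// mulrDr.
Qed.

Let scaleDl f : {morph Lspace_scale^~ f : a b / a + b}.
Proof.
move=> a b; apply: Lspace_ext.
have := Lspace_addE (Lspace_scale a f) (Lspace_scale b f).
have := Lspace_scaleE a f; have := Lspace_scaleE b f.
have := Lspace_scaleE (a + b) f.
by apply: filterS4 => x /= e1 e2 e3 e4 xT; rewrite e1// e4// e2// e3// mulrDl.
Qed.

HB.instance Definition _ := GRing.Zmodule_isLmodule.Build R
  (LspaceType mu p1) scaleA scale1 scaleDr scaleDl.

Let Lspace_fineE (f : LspaceType mu p1) :
  (Lspace_norm f)%:E = 'N[mu]_p[EFin \o f]%E.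
Proof. exact: (finite_norm_fine (Lspace_repr f)). Qed.

Let norm_class (h : LfunType mu p1) :
  Lspace_norm (Lspace_class h) = fine 'N[mu]_p[EFin \o h]%E.
Proof. by congr fine; exact: Lnorm_pi_Lfun. Qed.

Let normD f g : Lspace_norm (f + g) <= Lspace_norm f + Lspace_norm g.
Proof.
rewrite -[f + g]/(Lspace_class (Lspace_repr f + Lspace_repr g)) norm_class.
exact: (ler_LnormD (Lspace_repr f) (Lspace_repr g)).
Qed.

Let normZ a f : Lspace_norm (a *: f) = `|a| * Lspace_norm f.
Proof.
rewrite -[a *: f]/(Lspace_class (a *: Lspace_repr f)) norm_class.
apply: EFin_inj; rewrite EFinM Lspace_fineE.
have -> : (fine 'N[mu]_p[EFin \o (a *: Lspace_repr f)])%:E%E =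
    'N[mu]_p[EFin \o (a \*: Lspace_repr f)]%E.
  exact: (finite_norm_fine (a *: Lspace_repr f)).
exact: (LnormZ (Lspace_repr f)).
Qed.

Let norm_eq0 f : Lspace_norm f = 0 -> f = 0.
Proof.
move=> f0; apply: Lspace_ext.
have := Lspace_zeroE; have := @fine_Lnormr_eq0 _ _ _ _ _ _ (Lspace_repr f) f0.
by apply: filterS2 => x /= e1 e2 xT; rewrite e1// e2.
Qed.

HB.instance Definition _ := Lmodule_isNormed.Build R (LspaceType mu p1)
  normD normZ norm_eq0.

Lemma Lspace_normE (f : LspaceType mu p1) :
  (`|f|%:E = 'N[mu]_p[EFin \o f])%E.
Proof. exact: Lspace_fineE. Qed.

End Lspace_normed.

(* The l_p-direct sum of a family of normed modules over an arbitrary index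
   type: unconditional sums of nonnegative terms are [esum]. *)
Definition esum_powR (R : realType) (p : R) (I : choiceType)
    (E : I -> normedModType R) (x : forall i, E i) : \bar R :=
  (\esum_(i in [set: I]) (`|x i| `^ p)%:E)%E.

Record lpsum (R : realType) (p : R) (p1 : (1 <= p%:E)%E) (I : choiceType)
    (E : I -> normedModType R) := Lpsum {
  lpsum_fun :> forall i, E i ;
  lpsum_finite : (esum_powR p lpsum_fun < +oo)%E
}.

Section lpsum_normed.
Context (R : realType) (p : R) (p1 : (1 <= p%:E)%E) (I : choiceType).
Variable E : I -> normedModType R.

Local Notation mass := (esum_powR p).
Implicit Types x y : forall i, E i.

Let p_ge1 : 1 <= p. Proof. by rewrite -lee_fin. Qed.
Let p_gt0 : 0 < p. Proof. exact: lt_le_trans p_ge1. Qed.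

Let mass_ge0 x : (0 <= mass x)%E.
Proof. by apply: esum_ge0 => i _; rewrite lee_fin powR_ge0. Qed.

Let mass_ge x i : ((`|x i| `^ p)%:E <= mass x)%E.
Proof.
apply: esum_ge; exists [set i]; first by split.
by rewrite fsbig_set1.
Qed.

Let esumZ (c : R) (a : I -> R) : 0 <= c -> (forall i, 0 <= a i) ->
  (\esum_(i in [set: I]) (c * a i)%:E =
   c%:E * \esum_(i in [set: I]) (a i)%:E)%E.
Proof.
move=> c0 a0; rewrite /esum -ereal_supZl//; last first.
  by apply/set0P; eexists; exists set0; first exact: fsets_set0.
congr ereal_sup; apply/seteqP; split => [_ [A fA <-]|_ [_ [A fA <-] <-]] /=.
- exists (\sum_(i \in A) (a i)%:E)%E; first by exists A.
  by rewrite ge0_mule_fsumr// => i; rewrite lee_fin.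
- exists A => //.
  by rewrite ge0_mule_fsumr// => i; rewrite lee_fin.
Qed.

Let massZ (c : R) x : mass (fun i => c *: x i) = ((`|c| `^ p)%:E * mass x)%E.
Proof.
rewrite -esumZ ?powR_ge0//.
by apply: eq_esum => i _; rewrite normrZ powRM.
Qed.

Let powR_conv (u v a b : R) : 0 <= u -> 0 <= v -> 0 < a -> 0 < b ->
  (u + v) `^ p <= (a + b) `^ p *
    (a / (a + b) * (u / a) `^ p + b / (a + b) * (v / b) `^ p).
Proof.
move=> u0 v0 a0 b0; have ab0 : 0 < a + b by exact: addr_gt0.
have t0 : 0 <= a / (a + b) by rewrite divr_ge0// ltW.
have t1 : a / (a + b) <= 1 by rewrite ler_pdivrMr// mul1r lerDl ltW.
have tE : 1 - a / (a + b) = b / (a + b).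
  by rewrite -[1](@divff _ (a + b)) ?gt_eqF// -mulrBl addrAC subrr add0r.
have := @convex_powR R p p_ge1 (Itv01 t0 t1) (u / a) (v / b).
rewrite !inE/= !in_itv/= !andbT !divr_ge0 ?(ltW a0) ?(ltW b0)// => /(_ isT isT).
move=> h; rewrite convRE [X in X `^ _ <= _]convRE/= /unstable.onem tE in h.
have -> : u + v = (a + b) * (a / (a + b) * (u / a) + b / (a + b) * (v / b)).
  by rewrite mulrDr; congr (_ + _);
    rewrite mulrA [(a + b) * _]mulrC divfK ?gt_eqF// mulrC divfK ?gt_eqF.
rewrite powRM//; last 2 first.
- exact: ltW.
- by rewrite addr_ge0// mulr_ge0// divr_ge0// ltW.
by rewrite ler_wpM2l ?powR_ge0.
Qed.

Let massD (a b : R) x y : 0 < a -> 0 < b ->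
  (mass x <= (a `^ p)%:E -> mass y <= (b `^ p)%:E ->
   mass (fun i => (x i + y i)%R) <= ((a + b) `^ p)%:E)%E.
Proof.
move=> a0 b0 xa yb; have ab0 : 0 < a + b by exact: addr_gt0.
have le1 : forall c (z : forall i, E i), 0 < c -> (mass z <= (c `^ p)%:E)%E ->
    (\esum_(i in [set: I]) ((`|z i| / c) `^ p)%:E <= 1)%E.
  move=> c z c0 zc.
  have -> : (\esum_(i in [set: I]) ((`|z i| / c) `^ p)%:E =
      (c^-1 `^ p)%:E * mass z)%E.
    rewrite -esumZ ?powR_ge0//.
    apply: eq_esum => i _; congr (_%:E).
    by rewrite mulrC powRM// invr_ge0 ltW.
  apply: (@le_trans _ _ ((c^-1 `^ p)%:E * (c `^ p)%:E)%E).
    by rewrite lee_wpmul2l// lee_fin powR_ge0.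
  by rewrite -EFinM -powRM ?invr_ge0 ?(ltW c0)// mulVf ?gt_eqF// powR1.
apply: (@le_trans _ _ (\esum_(i in [set: I]) ((a + b) `^ p *
    (a / (a + b) * (`|x i| / a) `^ p + b / (a + b) * (`|y i| / b) `^ p))%:E)%E).
  apply: le_esum => i _; rewrite lee_fin.
  apply: le_trans (powR_conv (normr_ge0 (x i)) (normr_ge0 (y i)) a0 b0).
  by rewrite ge0_ler_powR ?nnegrE ?(ltW p_gt0)// ?addr_ge0// ler_normD.
have ta : 0 <= a / (a + b) by rewrite divr_ge0// ltW.
have tb : 0 <= b / (a + b) by rewrite divr_ge0// ltW.
rewrite esumZ ?powR_ge0//; last first.
  by move=> i; rewrite addr_ge0// mulr_ge0// powR_ge0.
rewrite -[leRHS]mule1 lee_wpmul2l ?lee_fin ?powR_ge0//.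
under eq_esum do rewrite EFinD.
rewrite esumD; first last.
- by move=> i _; rewrite lee_fin mulr_ge0// powR_ge0.
- by move=> i _; rewrite lee_fin mulr_ge0// powR_ge0.
rewrite !esumZ//; try by move=> i; exact: powR_ge0.
apply: (@le_trans _ _ ((a / (a + b))%:E * 1 + (b / (a + b))%:E * 1)%E).
  by rewrite leeD// lee_wpmul2l ?lee_fin// le1.
by rewrite !mule1 -EFinD -mulrDl divff ?gt_eqF.
Qed.

Let mass_bound x : (mass x < +oo)%E ->
  exists2 c : R, 0 < c & (mass x <= (c `^ p)%:E)%E.
Proof.
move=> xoo; exists (1 + fine (mass x) `^ p^-1).
  by rewrite ltr_pwDl// powR_ge0.
have xfin : mass x \is a fin_num by rewrite ge0_fin_numE.
rewrite -[leLHS]fineK// lee_fin.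
have mE : fine (mass x) = (fine (mass x) `^ p^-1) `^ p.
  by rewrite -powRrM mulVf ?gt_eqF// powRr1 ?fine_ge0.
rewrite [leLHS]mE ge0_ler_powR ?nnegrE ?(ltW p_gt0) ?powR_ge0//.
  by rewrite addr_ge0// powR_ge0.
by rewrite lerDr.
Qed.

Let massD_fin x y : (mass x < +oo)%E -> (mass y < +oo)%E ->
  (mass (fun i => (x i + y i)%R) < +oo)%E.
Proof.
move=> /mass_bound[a a0 xa] /mass_bound[b b0 yb].
by apply: le_lt_trans (massD a0 b0 xa yb) _; rewrite ltry.
Qed.

Let massZ_fin c x : (mass x < +oo)%E -> (mass (fun i => c *: x i) < +oo)%E.
Proof.
by move=> xoo; rewrite massZ lte_mul_pinfty// lee_fin powR_ge0.
Qed.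

Let mass0 : (mass (fun i => 0%R : E i) < +oo)%E.
Proof.
rewrite [X in (X < _)%E](_ : _ = 0%E) ?ltry//.
by apply: esum1 => i _; rewrite normr0 powR0// gt_eqF.
Qed.

Local Notation S := (lpsum p1 E).

HB.instance Definition _ := gen_eqMixin S.
HB.instance Definition _ := gen_choiceMixin S.

Lemma lpsum_ext (x y : S) : (forall i, x i = y i) -> x = y.
Proof.
case: x y => [x hx] [y hy] /= xyE.
have xy : x = y by exact: functional_extensionality_dep.
by case: _ / xy in hy *; rewrite (bool_irrelevance hx hy).
Qed.

Definition lpsum_zero : S := Lpsum p1 mass0.
Definition lpsum_add (x y : S) : S :=
  Lpsum p1 (massD_fin (lpsum_finite x) (lpsum_finite y)).
Definition lpsum_scale (c : R) (x : S) : S :=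
  Lpsum p1 (massZ_fin c (lpsum_finite x)).
Definition lpsum_opp (x : S) : S := lpsum_scale (-1) x.
Definition lpsum_norm (x : S) : R := fine (mass x) `^ p^-1.

Let addA : associative lpsum_add.
Proof. by move=> x y z; apply: lpsum_ext => i /=; rewrite addrA. Qed.

Let addC : commutative lpsum_add.
Proof. by move=> x y; apply: lpsum_ext => i /=; rewrite addrC. Qed.

Let add0 : left_id lpsum_zero lpsum_add.
Proof. by move=> x; apply: lpsum_ext => i /=; rewrite add0r. Qed.

Let addN : left_inverse lpsum_zero lpsum_opp lpsum_add.
Proof. by move=> x; apply: lpsum_ext => i /=; rewrite scaleN1r addNr. Qed.

HB.instance Definition _ := GRing.isZmodule.Build S addA addC add0 addN.

Let scaleA a b (x : S) : lpsum_scale a (lpsum_scale b x) = lpsum_scale (a * b) x.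
Proof. by apply: lpsum_ext => i /=; rewrite scalerA. Qed.

Let scale1 : left_id 1 lpsum_scale.
Proof. by move=> x; apply: lpsum_ext => i /=; rewrite scale1r. Qed.

Let scaleDr : right_distributive lpsum_scale +%R.
Proof. by move=> a x y; apply: lpsum_ext => i /=; rewrite scalerDr. Qed.

Let scaleDl (x : S) : {morph lpsum_scale^~ x : a b / a + b}.
Proof. by move=> a b; apply: lpsum_ext => i /=; rewrite scalerDl. Qed.

HB.instance Definition _ := GRing.Zmodule_isLmodule.Build R S
  scaleA scale1 scaleDr scaleDl.

Let mass_fin (x : S) : mass x \is a fin_num.
Proof. by rewrite ge0_fin_numE//; exact: lpsum_finite. Qed.

Let norm_ge0 (x : S) : 0 <= lpsum_norm x.
Proof. exact: powR_ge0. Qed.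

Let norm_powR (x : S) : ((lpsum_norm x `^ p)%:E = mass x)%E.
Proof.
rewrite /lpsum_norm -powRrM mulVf ?gt_eqF// powRr1 ?fine_ge0//.
by rewrite fineK.
Qed.

Let norm_eq0 (x : S) : lpsum_norm x = 0 -> x = 0.
Proof.
move=> x0; apply: lpsum_ext => i /=; apply/eqP; rewrite -normr_eq0.
apply/eqP/(@powR_eq0_eq0 _ _ p)/eqP; rewrite eq_le powR_ge0 andbT.
rewrite -lee_fin; apply: le_trans (mass_ge x i) _.
by rewrite -norm_powR x0 powR0// gt_eqF.
Qed.

Let normD (x y : S) : lpsum_norm (x + y) <= lpsum_norm x + lpsum_norm y.
Proof.
have [/norm_eq0->|x0] := eqVneq (lpsum_norm x) 0.
  by rewrite add0r lerDr.
have [/norm_eq0->|y0] := eqVneq (lpsum_norm y) 0.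
  by rewrite addr0 lerDl.
have {}x0 : 0 < lpsum_norm x by rewrite lt_neqAle eq_sym x0 norm_ge0.
have {}y0 : 0 < lpsum_norm y by rewrite lt_neqAle eq_sym y0 norm_ge0.
have xle : (mass x <= (lpsum_norm x `^ p)%:E)%E by rewrite (norm_powR x).
have yle : (mass y <= (lpsum_norm y `^ p)%:E)%E by rewrite (norm_powR y).
have := massD x0 y0 xle yle.
have <- : ((lpsum_norm (x + y) `^ p)%:E = mass (fun i => (x i + y i)%R))%E.
  exact: (norm_powR (x + y)).
rewrite lee_fin.
have pV0 : 0 <= p^-1 by rewrite invr_ge0 ltW.
move=> /(ge0_ler_powR pV0).
rewrite !nnegrE !powR_ge0 => /(_ isT isT).
have pK z : 0 <= z -> (z `^ p) `^ p^-1 = z.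
  by move=> z0; rewrite -powRrM divff ?gt_eqF// powRr1.
rewrite (pK _ (norm_ge0 (x + y))) pK//.
by apply: addr_ge0; exact: norm_ge0.
Qed.

Let normZ c (x : S) : lpsum_norm (c *: x) = `|c| * lpsum_norm x.
Proof.
rewrite /lpsum_norm -[esum_powR p (c *: x)]/(mass (fun i => c *: x i)) massZ.
rewrite fineM// powRM ?powR_ge0 ?fine_ge0//.
by rewrite -powRrM divff ?gt_eqF// powRr1.
Qed.

HB.instance Definition _ := Lmodule_isNormed.Build R S normD normZ norm_eq0.

Lemma lpsum_normE (x : S) : `|x| = fine (esum_powR p x) `^ p^-1.
Proof. by []. Qed.

End lpsum_normed.

Definition ellp (R : realType) (p : R) (p1 : (1 <= p%:E)%E)
    (Gamma : choiceType) : normedModType R :=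
  lpsum p1 (fun _ : Gamma => R^o : normedModType R).

Record closed_subspace (R : realType) (V : normedModType R) := ClosedSubspace {
  closed_subspace_set :> set V ;
  closed_subspace_submod : submod_closed [pred x | x \in closed_subspace_set] ;
  closed_subspace_isclosed : closed closed_subspace_set
}.

Section closed_subspace_normed.
Context (R : realType) (V : normedModType R) (X : closed_subspace V).

Definition closed_subspace_pred : {pred V} := [pred x | x \in (X : set V)].

HB.instance Definition _ :=
  GRing.isSubmodClosed.Build R V closed_subspace_pred (closed_subspace_submod X).

Definition closed_subspace_type : Type := {x : V | x \in closed_subspace_pred}.

HB.instance Definition _ := SubType.on closed_subspace_type.
HB.instance Definition _ := [Choice of closed_subspace_type by <:].
HB.instance Definition _ := [SubChoice_isSubLmodule of closed_subspace_type by <:].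

Let norm (x : closed_subspace_type) : R := `|val x|.

Let normD x y : norm (x + y) <= norm x + norm y.
Proof. by rewrite /norm raddfD; exact: ler_normD. Qed.

Let normZ c x : norm (c *: x) = `|c| * norm x.
Proof. by rewrite /norm linearZ; exact: normrZ. Qed.

Let norm_eq0 x : norm x = 0 -> x = 0.
Proof. by move=> /normr0_eq0 x0; apply: val_inj; rewrite x0 raddf0. Qed.

HB.instance Definition _ :=
  Lmodule_isNormed.Build R closed_subspace_type normD normZ norm_eq0.

Definition closed_subspace_normedModType : normedModType R := closed_subspace_type.

End closed_subspace_normed.

Coercion closed_subspace_normedModType : closed_subspace >-> NormedModule.type.

Section isomorphisms.
Context (R : realType).
Implicit Types V Y Z : normedModType R.

(* Valued in [\bar R], so that unbounded operators have norm [+oo]. *)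
Definition opnorm Y Z (T : {linear Y -> Z}) : \bar R :=
  ereal_sup [set (`|T y|)%:E | y in [set y : Y | `|y| <= 1]].

Definition iso_pair Y Z (T : {linear Y -> Z}) (S : {linear Z -> Y}) : Prop :=
  [/\ continuous T, continuous S, cancel T S & cancel S T].

Definition isomorphic Y Z : Prop :=
  exists (T : {linear Y -> Z}) (S : {linear Z -> Y}), iso_pair T S.

Definition C_isomorphic (C : R) Y Z : Prop :=
  exists (T : {linear Y -> Z}) (S : {linear Z -> Y}),
    iso_pair T S /\ (opnorm T * opnorm S <= C%:E)%E.

Definition isometric Y Z : Prop :=
  exists T : {linear Y -> Z}, bijective T /\ forall y, `|T y| = `|y|.

Definition embeds Y Z : Prop := exists W : closed_subspace Z, isomorphic Y W.

Definition complemented V (W : closed_subspace V) : Prop :=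
  exists P : {linear V -> V},
    [/\ continuous P, forall v, P (P v) = P v & range P = W].

End isomorphisms.

Definition card_lt (K Gamma : Type) : Prop :=
  ([set: K] #<= [set: Gamma])%card /\ ~ ([set: Gamma] #<= [set: K])%card.

(* [Y] is an L_p(aleph') space, where aleph' is the cardinality of [K].
   Completeness of [Y] is not required, as it follows from the isometry. *)
Definition Lp_card_space (R : realType) (p : R) (p1 : (1 <= p%:E)%E)
    (K : choiceType) (Y : normedModType R) : Prop :=
  exists (I : choiceType) (d : I -> measure_display)
      (T : forall i, measurableType (d i))
      (mu : forall i, {finite_measure set (T i) -> \bar R}),
    ([set: I] #<= [set: K])%card /\
    isometric Y (lpsum p1 (fun i => LspaceType (mu i) p1 : normedModType R)).

(* Main.v *)
(* Write L_p(nu) isometrically inside an l_p-sum Z of spaces L_p(mu_i) with mu_i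
   finite (a maximal family of almost disjoint sets of finite measure).

   (3) => (4): a vector of a small l_p-sum is, up to a small p-th power, truncated
   at a finite height and supported by finitely many summands.  If Gamma is larger
   than the index set, infinitely many images of unit vectors share these data;
   since p < 2, suitable signs keep their sums bounded up to a small linear error,
   whereas the p-th powers of the norms of sums of n vectors should grow like n.

   (4) => (1), (2): by (4), the restriction of X to few summands of Z is never
   bounded below.  By transfinite recursion this gives unit vectors x_g in X, for
   g in Gamma, with x_g = d_g + r_g, where the d_g have disjoint supports and the
   remainders r_g are small and satisfy |f + a r_g|^p <= |f|^p + small |a|^p for f
   in the span of the previous ones.  For p = 1 the last condition is automatic; for
   p > 1, r_g has to be annihilated by functionals norming that span, and such an
   x_g comes from a counting argument based on uniform convexity.  Hence (x_g) is a
   small perturbation of the disjoint sequence (d_g), so it spans a complemented,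
   almost isometric copy of l_p(Gamma). *)

Require Import Defs.
From HB Require Import structures.
From mathcomp Require Import all_boot all_order all_algebra.
From mathcomp Require Import finmap.
From mathcomp Require Import all_classical all_reals all_analysis.
From mathcomp Require Import wochoice measurable_realfun ess_sup_inf ring lra.

Import Order.TTheory GRing.Theory Num.Theory.
Import numFieldNormedType.Exports.

Set Implicit Arguments.
Unset Strict Implicit.
Unset Printing Implicit Defensive.

Local Open Scope classical_set_scope.
Local Open Scope ring_scope.

(** * Injections between types *)

(** The family of remainders is uncountable and its members share one bound [e], so the triangle
    inequality says nothing useful about their combinations; an upper p-estimate is needed. It comes
    from type p: |f + w|^p + |f - w|^p <= 2 |f|^p + 2 |w|^p yields |f + w|^p <= |f|^p + 2 |w|^p once
    |f| <= |f - w|, and a functional that norms f and kills w ensures the latter. Testing rational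
    combinations f keeps the number of functionals within the size of the earlier stage. A vector of
    X that is small on the old supports need not be killed by these functionals; the difference of
    two well-chosen members of a large separated family is, after a small correction inside X.
    Cardinals appear only as existence or absence of injections. A well-order of [Gamma] may have
    initial segments as large as [Gamma], for which (4) gives nothing; the recursion constrains only
    the other indices, and uncountability makes these numerous enough to be indexed by [Gamma]. *)

Definition inj_into (U V : Type) : Prop := exists f : U -> V, injective f.

Lemma proj1_sig_inj (T : Type) (P : T -> Prop) : injective (@proj1_sig T P).
Proof. by move=> [x Px] [y Py] /= xy; exact: eq_exist. Qed.

Lemma inj_into_trans (U V W : Type) :
  inj_into U V -> inj_into V W -> inj_into U W.
Proof. by move=> [f fi] [g gi]; exists (g \o f); exact: inj_comp. Qed.

Lemma inj_into_card (U V : Type) :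
  inj_into U V <-> ([set: U] #<= [set: V])%card.
Proof.
split=> [[f fi]|/card_leP[f]].
  apply/card_leP; apply/injfunPex.
  exists (fun u => exist _ (f (val u)) (mem_set I)) => //.
  by move=> u v _ _ /(congr1 set_val) /fi; exact: val_inj.
exists (fun u => set_val (f (exist _ u (mem_set I)))) => u v /val_inj uv.
by have := @inj _ _ _ f _ _ (mem_set I) (mem_set I) uv => -[].
Qed.

(** Zorn's lemma for graphs of partial injections, [P] saying that two pairs agree in one component
    exactly when they agree in the other. A maximal graph that misses some [u] and some [v] could be
    enlarged by [(u, v)]. *)
Lemma inj_into_total (U V : Type) : inj_into U V \/ inj_into V U.
Proof.
pose P (G : set (U * V)) :=
  forall x y, G x -> G y -> (x.1 = y.1 <-> x.2 = y.2).
have [|G [PG Gmax]] := @Zorn_bigcup _ P.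
  move=> F FP Ftot x y [X FX Xx] [Y FY Yy].
  by have [XY|YX] := Ftot _ _ FX FY;
    [apply: (FP _ FY) => //; exact: XY | apply: (FP _ FX) => //; exact: YX].
have [dom|/existsNP[u ndom]] := pselect (forall u, exists v, G (u, v)).
  have [f fG] := choice dom; left; exists f => u u' ff.
  by apply/(PG _ _ (fG u) (fG u')).
right; have ran v : exists u, G (u, v).
  apply: contrapT => nran; apply: (Gmax (G `|` [set (u, v)])).
    split; first by move=> x Gx; left.
    by move=> /(_ (u, v)) h; apply: ndom; exists v; apply: h; right.
  move=> x y [Gx|->] [Gy|->] //; first exact: PG.
    split=> /= [x1|x2]; first by case: ndom; exists x.2; rewrite -x1 -surjective_pairing.
    by case: nran; exists x.1; rewrite -x2 -surjective_pairing.
  split=> /= [x1|x2]; first by case: ndom; exists y.2; rewrite x1 -surjective_pairing.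
  by case: nran; exists y.1; rewrite x2 -surjective_pairing.
have [f fG] := choice ran; exists f => v v' ff.
by apply/(PG _ _ (fG v) (fG v')).
Qed.

(** * Squares and finite sequences over an infinite type *)

Section infinite_square.
Variables (K : Type) (i : nat -> K) (i_inj : injective i).

Let D (G : set (K * K * K)) : set K := [set a | exists b, G (a, a, b)].

(** [P G] makes [G] the graph of an injection from the square of [D G] into [D G], where [D G] is
    read off the diagonal. *)
Let P (G : set (K * K * K)) :=
  [/\ forall x b b', G (x, b) -> G (x, b') -> b = b',
      forall x x' b, G (x, b) -> G (x', b) -> x = x',
      forall a a', D G a -> D G a' -> exists b, G (a, a', b) &
      forall a a' b, G (a, a', b) -> [/\ D G a, D G a' & D G b]].

(** The pairing of natural numbers carried along [i]: as a part of [G] it makes [D G] infinite and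
    supplies constants for tags. *)
Let G0 : set (K * K * K) := [set x | exists m n,
  x = (i m, i n, i (choice.pickle (m, n)))].

Let D0 n : D G0 (i n).
Proof. by exists (i (choice.pickle (n, n))); exists n, n. Qed.

Let PG0 : P G0.
Proof.
have D0E a : D G0 a -> exists n, a = i n.
  by move=> [b [m [n [-> _ _]]]]; exists m.
split.
- move=> x b b' [m [n [-> ->]]] [m' [n' [/i_inj -> /i_inj -> ->]]] //.
- move=> x x' b [m [n [-> ->]]] [m' [n' [-> /i_inj]]].
  by move=> /(pcan_inj choice.pickleK)[-> ->].
- move=> a a' /D0E[m ->] /D0E[n ->].
  by exists (i (choice.pickle (m, n))); exists m, n.
- by move=> a a' b [m [n [-> -> ->]]]; split; exact: D0.
Qed.

Let maximal_square : exists2 G, P G /\ G0 `<=` G &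
  forall G', G `<` G' -> ~ P G'.
Proof.
(* Inclusion of [G0] is demanded of nonempty graphs only, as the union of the empty chain is
   empty. *)
have [|G [[PG GG0] Gmax]] := @Zorn_bigcup _ (fun G => P G /\ (G !=set0 -> G0 `<=` G)).
  move=> F FP Ftot; split; last first.
    move=> [x [X FX Xx]]; apply: subset_trans (bigcup_sup FX).
    by apply: (FP _ FX).2; exists x.
  have two X Y : F X -> F Y -> exists Z, [/\ F Z, X `<=` Z & Y `<=` Z].
    by move=> FX FY; have [XY|YX] := Ftot _ _ FX FY; [exists Y|exists X]; split.
  have subD X a : F X -> D X a -> D (\bigcup_(X in F) X) a.
    by move=> FX [b Xb]; exists b, X.
  split.
  - move=> x b b' [X FX Xx] [Y FY Yy]; have [Z [FZ XZ YZ]] := two _ _ FX FY.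
    by have [[h _ _ _] _] := FP _ FZ; apply: (h x); [exact: XZ|exact: YZ].
  - move=> x x' b [X FX Xx] [Y FY Yy]; have [Z [FZ XZ YZ]] := two _ _ FX FY.
    by have [[_ h _ _] _] := FP _ FZ; apply: (h _ _ b); [exact: XZ|exact: YZ].
  - move=> a a' [b [X FX Xx]] [b' [Y FY Yy]].
    have [Z [FZ XZ YZ]] := two _ _ FX FY.
    have [[_ _ h _] _] := FP _ FZ.
    have [||c Zc] := h a a'; [by exists b; exact: XZ|by exists b'; exact: YZ|].
    by exists c, Z.
  - move=> a a' b [X FX Xx]; have [[_ _ _ h] _] := FP _ FX.
    by have [? ? ?] := h _ _ _ Xx; split; exact: (subD X).
have [[x Gx]|/nonemptyPn Ge] := pselect (G !=set0).
  exists G; first by split; [|apply: GG0; exists x].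
  move=> G' GG' PG'; apply: (Gmax _ GG'); split=> [//|_].
  by apply: subset_trans (proj1 GG'); apply: GG0; exists x.
exfalso; apply: (Gmax G0); last by split=> [|_]; [exact: PG0|exact: subset_refl].
rewrite Ge; split => // /(_ (i 0%N, i 0%N, i (choice.pickle (0%N, 0%N)))).
by apply; exists 0%N, 0%N.
Qed.

(** Take a maximal graph with base D. Either the complement of D injects into D, so that K injects
    into D and the pairing on D serves for K; or D injects into its complement, and the pairing
    extends to D together with a copy D' of D, against maximality. *)
Lemma inj_into_square : inj_into (K * K) K.
Proof.
have [G [PG GG0] Gmax] := maximal_square.
have [Gfun Ginj Gtot GD] := PG.
have Di n : D G (i n) by have [b Gb] := D0 n; exists b; exact: GG0.
have /choice[f2 f2G] : forall x : K * K, exists b, D G x.1 -> D G x.2 -> G (x, b).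
  move=> [a a']; have [[Da Da']|nD] := pselect (D G a /\ D G a').
    by have [b Gb] := Gtot _ _ Da Da'; exists b.
  by exists (i 0%N) => /= Da Da'; case: nD.
pose f a a' := f2 (a, a').
have fG a a' : D G a -> D G a' -> G (a, a', f a a') by exact: (f2G (a, a')).
have fD a a' : D G a -> D G a' -> D G (f a a').
  by move=> Da Da'; have [] := GD _ _ _ (fG _ _ Da Da').
have f_inj a a' b b' : D G a -> D G a' -> D G b -> D G b' ->
    f a a' = f b b' -> a = b /\ a' = b'.
  move=> Da Da' Db Db' fab; have := fG _ _ Da Da'; rewrite fab => G1.
  by have [-> ->] := Ginj _ _ _ G1 (fG _ _ Db Db').
have [[e e_inj]|[e e_inj]] :=
    inj_into_total {a | D G a} {a | ~ D G a}; last first.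
  (* The second components [i 0] and [i 1] record whether [a] lies in D. *)
  pose j a := match pselect (D G a) with
    | left _ => f a (i 0%N)
    | right na => f (proj1_sig (e (exist _ a na))) (i 1%N) end.
  have jD a : D G (j a).
    by rewrite /j; case: pselect => [|na]; [|case: (e _) => /=] => *; exact: fD.
  have j_inj : injective j.
    move=> a b; rewrite /j; case: pselect => [Da|na]; case: pselect => [Db|nb].
    - by move/f_inj => [].
    - by case: (e _) => /= c Dc /f_inj[] // _ /i_inj.
    - by case: (e _) => /= c Dc /f_inj[] // _ /i_inj.
    - by move=> /f_inj[]//; [exact: proj2_sig..|move=> /proj1_sig_inj/e_inj[]].
  exists (fun x => f (j x.1) (j x.2)) => -[a a'] [b b'] /= /f_inj[]// /j_inj -> /j_inj ->.
  by [].
pose D' := [set a | exists x, proj1_sig (e x) = a].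
have D'E a : D' a -> ~ D G a by move=> [x <-]; case: (e x).
(* [u] folds D' back onto D and is the identity on D; the two conditions are compatible because D
   and D' are disjoint. *)
have /choice[u uP] : forall a, exists b, (D G a -> b = a) /\
    forall c (Dc : D G c), proj1_sig (e (exist _ c Dc)) = a -> b = c.
  move=> a; have [Da|nDa] := pselect (D G a).
    by exists a; split=> // c Dc ea; case: (D'E a) => //; exists (exist _ c Dc).
  have [[[c Dc] ea]|nD'] := pselect (D' a); last first.
    by exists a; split=> // c Dc ea; case: nD'; exists (exist _ c Dc).
  exists c; split=> // c' Dc' ea'.
  by have := etrans ea (esym ea') => /proj1_sig_inj/e_inj [].
have uD a : D G a -> u a = a by move=> Da; exact: (uP a).1.
have uD' b (Db : D G b) : u (proj1_sig (e (exist _ b Db))) = b.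
  exact: ((uP _).2 b Db erefl).
have uDD a : D G a \/ D' a -> D G (u a).
  by move=> [Da|[[b Db] <-]]; [rewrite uD|rewrite uD'].
have u_inj a b : D G a \/ D' a -> D G b \/ D' b ->
    `[< D G a >] = `[< D G b >] -> u a = u b -> a = b.
  move=> [Da|D'a] [Db|D'b] + uab.
  - by move: uab; rewrite (uD _ Da) (uD _ Db).
  - by rewrite asboolT// asboolF//; exact: D'E.
  - by rewrite asboolF ?asboolT//; exact: D'E.
  - move=> _; case: D'a D'b uab => -[a' Da' <-] [[b' Db' <-]].
    rewrite !uD' => ab; case: _ / ab in Db' *.
    by rewrite (Prop_irrelevance Db' Da').
(* Folding forgets on which side each component lay; the tag restores it. *)
pose tag a a' := i (choice.pickle (`[< D G a >], `[< D G a' >])).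
pose h0 a a' := f (f (u a) (u a')) (tag a a').
have h0D a a' : D G a \/ D' a -> D G a' \/ D' a' -> D G (h0 a a').
  by move=> ha ha'; exact: (fD _ _ (fD _ _ (uDD _ ha) (uDD _ ha')) (Di _)).
have h0_inj a a' b b' : D G a \/ D' a -> D G a' \/ D' a' ->
    D G b \/ D' b -> D G b' \/ D' b' -> h0 a a' = h0 b b' -> a = b /\ a' = b'.
  move=> ha ha' hb hb' /f_inj[];
    [exact: (fD _ _ (uDD _ ha) (uDD _ ha'))|exact: Di
    |exact: (fD _ _ (uDD _ hb) (uDD _ hb'))|exact: Di|].
  move=> /f_inj[]; [exact: uDD..|].
  move=> uab uab' /i_inj/(pcan_inj choice.pickleK)[tab tab'].
  by split; exact: u_inj.
(* New pairs are coded in D and then moved into D' by [e], so that their values avoid those of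
   [G]. *)
pose h a a' b := exists Dh : D G (h0 a a'), proj1_sig (e (exist _ _ Dh)) = b.
pose G' := G `|` [set x | [/\ D G x.1.1 \/ D' x.1.1, D G x.1.2 \/ D' x.1.2,
  ~ (D G x.1.1 /\ D G x.1.2) & h x.1.1 x.1.2 x.2]].
have hD' a a' b : h a a' b -> D' b.
  by move=> [Dh <-]; exists (exist _ _ Dh).
have DG' a : D G' a <-> D G a \/ D' a.
  split=> [[b [Gb|[]//]]|Da]; first by left; exists b.
  have [Da'|nDa] := pselect (D G a).
    by have [b Gb] := Da'; exists b; left.
  have Dh := h0D _ _ Da Da.
  by exists (proj1_sig (e (exist _ _ Dh))); right; split => //= [[]|] //; exists Dh.
exfalso; apply: (Gmax G').
  split; first by move=> x; left.
  move=> G'G; have Dh := Di 0%N.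
  have D'a : D' (proj1_sig (e (exist _ _ Dh))) by exists (exist _ _ Dh).
  apply: (D'E _ D'a); have [b Gb] : D G' (proj1_sig (e (exist _ _ Dh))).
    by apply/DG'; right.
  by exists b; exact: G'G.
split.
- move=> [a a'] b b' [Gb|/= [Da Da' nD [Dh hb]]] [Gb'|/= [_ _ nD' [Dh' hb']]].
  + exact: (Gfun (a, a')).
  + by case: nD' => /=; have [] := GD _ _ _ Gb.
  + by case: nD => /=; have [] := GD _ _ _ Gb'.
  + by rewrite -hb -hb' (Prop_irrelevance Dh Dh').
- move=> [a a'] [c c'] b [Gb|/= [Da Da' nD [Dh hb]]] [Gb'|/= [Dc Dc' nD' [Dh' hb']]].
  + exact: (Ginj _ _ b).
  + have [_ _ Db] := GD _ _ _ Gb.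
    by case: (D'E b) => //; exists (exist _ _ Dh').
  + have [_ _ Db] := GD _ _ _ Gb'.
    by case: (D'E b) => //; exists (exist _ _ Dh).
  + have := etrans hb (esym hb') => /proj1_sig_inj/e_inj[].
    by move=> /h0_inj[]// -> ->.
- move=> a a' /DG' Da /DG' Da'.
  have [[Ga Ga']|nD] := pselect (D G a /\ D G a').
    by have [b Gb] := Gtot _ _ Ga Ga'; exists b; left.
  have Dh := h0D _ _ Da Da'.
  by exists (proj1_sig (e (exist _ _ Dh))); right; split => //; exists Dh.
- move=> a a' b [/GD[Da Da' Db]|/= [Da Da' _ /hD' hb]].
    by split; apply/DG'; left.
  by split; apply/DG' => //; right.
Qed.

(** Nested pairs, with [i 0] and [i 1] marking the empty and the nonempty sequence. *)
Lemma inj_into_seq : inj_into (seq K) K.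
Proof.
have [g g_inj] := inj_into_square.
pose c := foldr (fun x y => g (i 1%N, g (x, y))) (g (i 0%N, i 0%N)).
exists c; elim=> [|x s IH] [|y t] //= /g_inj[].
- by move/i_inj.
- by move/i_inj.
- by move/g_inj=> [-> /IH ->].
Qed.

End infinite_square.

Lemma infinite_inj_nat (K : Type) :
  infinite_set [set: K] -> exists i : nat -> K, injective i.
Proof. by move=> /infiniteP/inj_into_card. Qed.

Lemma inj_into_prod (K A B : Type) : infinite_set [set: K] ->
  inj_into A K -> inj_into B K -> inj_into (A * B) K.
Proof.
move=> /infinite_inj_nat[i ii] [f fi] [g gi].
apply: inj_into_trans (inj_into_square ii).
by exists (fun x => (f x.1, g x.2)) => -[a b] [a' b'] /= [/fi -> /gi ->].
Qed.

Lemma inj_into_seqW (K A : Type) : infinite_set [set: K] ->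
  inj_into A K -> inj_into (seq A) K.
Proof.
move=> /infinite_inj_nat[i ii] [f fi].
apply: inj_into_trans (inj_into_seq ii).
by exists (map f); exact: inj_map.
Qed.

Lemma inj_into_countable (K : Type) (A : countType) : infinite_set [set: K] ->
  inj_into A K.
Proof.
move=> /infinite_inj_nat[i ii]; exists (i \o choice.pickle).
by apply: inj_comp => //; exact: (pcan_inj choice.pickleK).
Qed.

Lemma surj_inj_into (A B : Type) (f : A -> B) :
  (forall b, exists a, f a = b) -> inj_into B A.
Proof.
by move=> /choice[g gK]; exists g; apply: (can_inj (g := f)) => b; exact: gK.
Qed.

(** * Scalar inequalities *)

Section powR_lemmas.
Context {R : realType}.
Implicit Types (p r s t u v x y : R).

Lemma powR_norm_continuous p : 0 < p -> continuous (fun t => `|t| `^ p : R).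
Proof.
move=> p0 t; have [->|t0] := eqVneq t 0.
  apply/cvgrPdist_lt => e e0; near=> s.
  rewrite normr0 powR0 ?gt_eqF// sub0r normrN ger0_norm ?powR_ge0//.
  have -> : e = (e `^ p^-1) `^ p.
    by rewrite -powRrM mulVf ?gt_eqF// powRr1// ltW.
  rewrite gt0_ltr_powR ?nnegrE ?powR_ge0//.
  near: s; have e'0 : 0 < e `^ p^-1 by rewrite powR_gt0.
  by apply/nbhs_ballP; exists (e `^ p^-1) => //= z; rewrite /ball/= sub0r normrN.
have at0 : 0 < `|t| by rewrite normr_gt0.
have cp : {for `|t|, continuous (fun a => a `^ p)}.
  apply: differentiable_continuous; apply/derivable1_diffP.
  by apply: derivable_powR; rewrite in_itv/= at0.
exact: (cvg_comp _ _ (@norm_continuous _ R^o t) cp).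
Unshelve. all: by end_near. Qed.

Lemma powR_sqr t p : (t ^+ 2) `^ (p / 2) = `|t| `^ p.
Proof.
rewrite -[t ^+ 2]ger0_norm ?sqr_ge0// normrX -powR_mulrn// -powRrM.
by rewrite mulrC divfK// pnatr_eq0.
Qed.

(** Convexity of x^(1/r) at the points u^r and v^r. *)
Lemma midpoint_concave_powR r u v : 0 < r -> r <= 1 -> 0 <= u -> 0 <= v ->
  u `^ r + v `^ r <= 2 * ((u + v) / 2) `^ r.
Proof.
move=> r0 r1 u0 v0; have rV1 : 1 <= r^-1 by rewrite invf_ge1.
have h0 : (0 <= 2^-1 :> R) by rewrite invr_ge0.
have h1 : (2^-1 <= 1 :> R) by rewrite invf_le1// ler1n.
have hE : 1 - 2^-1 = 2^-1 :> R by lra.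
have := @convex_powR R r^-1 rV1 (Itv01 h0 h1) (u `^ r) (v `^ r).
rewrite !inE/= !in_itv/= !andbT !powR_ge0 => /(_ isT isT).
move=> h; rewrite convRE [X in X `^ _ <= _]convRE/= /unstable.onem hE in h.
have rK z : 0 <= z -> (z `^ r) `^ r^-1 = z.
  by move=> z0; rewrite -powRrM divff ?gt_eqF// powRr1.
rewrite !rK// in h.
have h2 : 2^-1 * u + 2^-1 * v = (u + v) / 2 by lra.
rewrite h2 in h.
have /(ge0_ler_powR (ltW r0)) := h.
rewrite !nnegrE powR_ge0 => /(_ isT).
rewrite divr_ge0 ?addr_ge0// => /(_ isT).
rewrite -powRrM mulVf ?gt_eqF// powRr1; last first.
  by rewrite addr_ge0// mulr_ge0// powR_ge0.
by move=> h3; lra.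
Qed.

(** Monotonicity of t^(r - 1), cleared of denominators; adding two instances gives subadditivity of
    t^r. *)
Lemma powR_div_nonincreasing r u w : 0 < r -> r <= 1 -> 0 <= u -> u <= w ->
  u * w `^ r <= w * u `^ r.
Proof.
move=> r0 r1; rewrite [0 <= u]le_eqVlt => /predU1P[<- _|u0 uw].
  by rewrite mul0r powR0 ?gt_eqF// mulr0.
have w0 : 0 < w by exact: lt_le_trans uw.
have iw0 : 0 <= w^-1 by rewrite invr_ge0 ltW.
have e : w^-1 `^ r * w `^ r = 1.
  by rewrite -powRM ?(ltW w0)// mulVf ?powR1// gt_eqF.
have h : u / w <= u `^ r * w^-1 `^ r.
  rewrite -powRM ?(ltW u0)//; apply: ger1_powR => //.
  by rewrite divr_gt0//= ler_pdivrMr// mul1r.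
have ww0 : 0 <= w * w `^ r by rewrite mulr_ge0 ?powR_ge0// ltW.
have := ler_wpM2r ww0 h.
rewrite (_ : u / w * _ = u * w `^ r); last by field; rewrite gt_eqF.
by rewrite mulrACA e mulr1 [w * _]mulrC.
Qed.

(* [truncated_power p rho] grows like [t ^ 2] for [`|t| <= rho] and agrees with
   [`|t| `^ p] beyond; being a concave function of [t ^ 2], it has type 2. *)
Definition truncated_power p rho t := Num.min (rho `^ (p - 2) * t ^+ 2) (`|t| `^ p).

(** Since ((s + t)^2 + (s - t)^2) / 2 = s^2 + t^2, concavity bounds the left side by 2 phi(s^2 +
    t^2), and subadditivity splits this. *)
Lemma concave_sqr_type (phi : R -> R) :
  (forall u v, 0 <= u -> 0 <= v -> phi u + phi v <= 2 * phi ((u + v) / 2)) ->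
  (forall u v, 0 <= u -> 0 <= v -> phi (u + v) <= phi u + phi v) ->
  forall s t, phi ((s + t) ^+ 2) + phi ((s - t) ^+ 2)
    <= 2 * phi (s ^+ 2) + 2 * phi (t ^+ 2).
Proof.
move=> conc subadd s t.
apply: le_trans (conc _ _ (sqr_ge0 _) (sqr_ge0 _)) _.
rewrite -mulrDr ler_pM2l//.
rewrite (_ : (_ + _) / 2 = s ^+ 2 + t ^+ 2); last by field.
by apply: subadd; exact: sqr_ge0.
Qed.

Lemma powR_type p s t : 0 < p -> p <= 2 ->
  `|s + t| `^ p + `|s - t| `^ p <= 2 * `|s| `^ p + 2 * `|t| `^ p.
Proof.
move=> p0 p2; have r0 : 0 < p / 2 by rewrite divr_gt0.
have r1 : p / 2 <= 1 by rewrite ler_pdivrMr// mul1r.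
rewrite -!powR_sqr; apply: (@concave_sqr_type (fun u => u `^ (p / 2))).
  by move=> u v; exact: midpoint_concave_powR.
move=> u v; rewrite [0 <= u]le_eqVlt => /predU1P[<- v0|u0 v0].
  by rewrite add0r powR0 ?gt_eqF// add0r.
have w0 : 0 < u + v by rewrite ltr_pwDl.
rewrite -(ler_pM2l w0) mulrDr.
have h1 := @powR_div_nonincreasing _ u (u + v) r0 r1 (ltW u0).
have h2 := @powR_div_nonincreasing _ v (u + v) r0 r1 v0.
rewrite mulrDl lerD//; first by apply: h1; rewrite lerDl.
by apply: h2; rewrite lerDr ltW.
Qed.

(** The function phi(u) = min(a u, u^(p / 2)) is concave, being a minimum of two concave
    functions. *)
Lemma truncated_power_type p rho s t : 0 < p -> p <= 2 ->
  truncated_power p rho (s + t) + truncated_power p rho (s - t)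
  <= 2 * truncated_power p rho s + 2 * truncated_power p rho t.
Proof.
move=> p0 p2; have r0 : 0 < p / 2 by rewrite divr_gt0.
have r1 : p / 2 <= 1 by rewrite ler_pdivrMr// mul1r.
rewrite /truncated_power -!powR_sqr; set a := rho `^ _.
have a0 : 0 <= a by exact: powR_ge0.
apply: (@concave_sqr_type (fun u => Num.min (a * u) (u `^ (p / 2)))).
  move=> u v u0 v0 /=; have := midpoint_concave_powR r0 r1 u0 v0.
  have := ge_min (a * u) (a * u) (u `^ (p / 2)).
  have := ge_min (u `^ (p / 2)) (a * u) (u `^ (p / 2)).
  have := ge_min (a * v) (a * v) (v `^ (p / 2)).
  have := ge_min (v `^ (p / 2)) (a * v) (v `^ (p / 2)).
  rewrite !lexx !orbT/= => h1 h2 h3 h4 h5.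
  by have [_|_] := leP (a * ((u + v) / 2)) (((u + v) / 2) `^ (p / 2)); lra.
move=> u v; rewrite [0 <= u]le_eqVlt => /predU1P[<- v0|u0 v0].
  rewrite add0r lerDr le_min powR_ge0 andbT.
  by rewrite mulr0.
have w0 : 0 < u + v by rewrite ltr_pwDl.
have h1 : u * (u + v) `^ (p / 2) <= (u + v) * u `^ (p / 2).
  by apply: powR_div_nonincreasing => //; [exact: ltW|rewrite lerDl].
have h2 : v * (u + v) `^ (p / 2) <= (u + v) * v `^ (p / 2).
  by apply: powR_div_nonincreasing => //; rewrite lerDr ltW.
set W := (u + v) `^ _ in h1 h2 *; set m := Num.min (a * (u + v)) W.
have m1 : m <= a * (u + v) by rewrite ge_min lexx.
have m2 : m <= W by rewrite ge_min lexx orbT.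
(* Subadditivity: each branch of the minimum, divided by its argument, is nonincreasing, hence so is
   phi(x) / x. *)
have k x X : 0 <= x -> x * W <= (u + v) * X -> x * m <= (u + v) * Num.min (a * x) X.
  move=> x0 xX; rewrite minElt; case: ifPn => _.
    by have := ler_wpM2l x0 m1; nra.
  by apply: le_trans xX; rewrite ler_wpM2l.
rewrite -(ler_pM2l w0) mulrDr.
have := k _ _ (ltW u0) h1; have := k _ _ v0 h2.
by rewrite mulrDl; lra.
Qed.

Lemma truncated_power_ge0 p rho t : 0 <= truncated_power p rho t.
Proof. by rewrite le_min mulr_ge0 ?powR_ge0 ?sqr_ge0. Qed.

Lemma le_truncated_power p rho t : 0 < rho -> 0 < p -> p <= 2 ->
  `|t| `^ p <= rho `^ p + truncated_power p rho t.
Proof.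
move=> rho0 p0 p2; have [tr|rt] := leP `|t| rho.
  rewrite -[leLHS]addr0 lerD ?truncated_power_ge0//.
  by rewrite ge0_ler_powR ?nnegrE// ltW.
rewrite -[leLHS]add0r lerD ?powR_ge0// le_min lexx andbT.
have t0 : 0 < `|t| by exact: lt_trans rt.
rewrite -(ler_pM2l (powR_gt0 (2 - p) rho0)) mulrA -powRD; last first.
  by apply/implyP => _; rewrite gt_eqF.
rewrite (_ : 2 - p + (p - 2) = 0); last by ring.
rewrite powRr0 mul1r -real_normK ?num_real// -powR_mulrn//.
rewrite (_ : `|t| `^ 2%:R = `|t| `^ (2 - p) * `|t| `^ p); last first.
  rewrite -powRD; first by congr (_ `^ _); ring.
  by apply/implyP => _; rewrite gt_eqF.
rewrite ler_wpM2r ?powR_ge0// ge0_ler_powR ?subr_ge0// ?nnegrE; exact/ltW.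
Qed.

End powR_lemmas.

(** * Uniform convexity of the scalars, in p-th powers *)

Section uniform_convexity_scalar.
Context {R : realType}.
Implicit Types (p s t u : R).

(** The defect in Jensen's inequality for |.|^p at the midpoint of s and t. *)
Definition powR_gap p s t : R :=
  (`|s| `^ p + `|t| `^ p) / 2 - `|(s + t) / 2| `^ p.

(** The weak inequality is Young's inequality for x and 1 with conjugate exponents p and p / (p -
    1). *)
Lemma bernoulli_powR_lt p u : 1 < p -> 0 <= u -> u != 1 ->
  1 + p * (u - 1) < u `^ p.
Proof.
move=> p1 u0 u1; have p0 : 0 < p by lra.
have pV : 0 < p^-1 < 1 by rewrite invr_gt0 p0 invf_lt1.
have q0 : 0 < (1 - p^-1)^-1 by rewrite invr_gt0 subr_gt0; case/andP: pV.
have pq : p^-1 + (1 - p^-1)^-1^-1 = 1 by rewrite invrK addrC subrK.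
have ber x : 0 <= x -> 1 + p * (x - 1) <= x `^ p.
  move=> x0; have := conjugate_powR x0 (@ler01 R) p0 q0 pq.
  rewrite powR1 invrK mulr1 mul1r => h.
  have : p * x <= p * (x `^ p / p + (1 - p^-1)) by rewrite ler_pM2l.
  rewrite mulrDr mulrCA divff ?gt_eqF// mulr1 mulrBr divff ?gt_eqF//; lra.
have := ber u u0; rewrite le_eqVlt => /predU1P[E|//].
(* Equality at [u] would contradict the inequality at [Num.sqrt u]: squaring is
   strict off [1]. *)
have su0 := sqrtr_ge0 u; have suE := sqr_sqrtr u0.
have h2 := ber _ su0.
have uE : u `^ p = (Num.sqrt u `^ p) ^+ 2.
  by rewrite -{1}suE expr2 powRM// -expr2.
have s1 : Num.sqrt u != 1.
  by apply: contra u1 => /eqP s1; rewrite -suE s1 expr1n.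
have d0 : 0 < (Num.sqrt u - 1) ^+ 2 by rewrite exprn_even_gt0//= subr_eq0.
set s := Num.sqrt u in su0 suE h2 uE s1 d0; set S := s `^ p in h2 uE.
have S0 : 0 <= S by exact: powR_ge0.
rewrite uE -suE in E.
(* Squaring needs a nonnegative tangent value at s. If it is negative, then s < 1 and the value at
   s^2 is negative too, against equality with a square. *)
have [k0|k0] := leP 0 (1 + p * (s - 1)); last first.
  have : 1 + p * (s ^+ 2 - 1) < 0.
    have s1' : s < 1 by nra.
    nra.
  by have := sqr_ge0 S; rewrite -E; lra.
have : (1 + p * (s - 1)) ^+ 2 <= S ^+ 2 by rewrite ler_sqr ?nnegrE.
rewrite -E => h3.
have : 0 < (p ^+ 2 - p) * (s - 1) ^+ 2 by rewrite mulr_gt0// subr_gt0; nra.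
nra.
Qed.


(** After division by m = (1 + t) / 2 the points 1 / m and t / m average to 1, so the linear terms
    of Bernoulli's inequality cancel. For t < 0 it does not apply to t / m, but then m^p <= m <
    1/2. *)
Lemma powR_gap_gt0 p t : 1 < p -> -1 <= t -> t < 1 -> 0 < powR_gap p 1 t.
Proof.
move=> p1 t1 t2; have p0 : 0 < p by lra.
rewrite /powR_gap normr1 powR1 subr_gt0.
have m0 : 0 <= (1 + t) / 2 by lra.
rewrite [ `|(1 + t) / 2|]ger0_norm//; set m := (1 + t) / 2 in m0 *.
have [t0|t0] := ltP t 0.
  have [->|mn0] := eqVneq m 0.
    by rewrite powR0 ?gt_eqF// divr_gt0// ltr_pwDl// powR_ge0.
  have : m `^ p <= m.
    apply: ge1r_powR; last exact: ltW.
    by rewrite lt_neqAle eq_sym mn0 m0/= /m; lra.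
  have := powR_ge0 `|t| p; rewrite /m; lra.
have m1 : 0 < m by rewrite /m; lra.
have mp0 : 0 < m `^ p by exact: powR_gt0.
have e1 : m `^ p * (1 / m) `^ p = 1.
  by rewrite div1r -powRM ?invr_ge0// divff ?gt_eqF// powR1.
have e2 : m `^ p * (t / m) `^ p = `|t| `^ p.
  rewrite -powRM//; first by rewrite mulrCA divff ?gt_eqF// mulr1 ger0_norm.
  exact: divr_ge0 t0 m0.
have b1 : 1 + p * (1 / m - 1) < (1 / m) `^ p.
  apply: bernoulli_powR_lt => //; first exact: divr_ge0 ler01 m0.
  by rewrite div1r invr_eq1 /m lt_eqF//; lra.
have b2 : 1 + p * (t / m - 1) < (t / m) `^ p.
  apply: bernoulli_powR_lt => //; first exact: divr_ge0 t0 m0.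
  apply/eqP => tm; have : t = m by rewrite -[LHS](divfK (lt0r_neq0 m1)) tm mul1r.
  by rewrite /m; lra.
have e3 : 1 / m + t / m = 2 by rewrite /m; field; rewrite gt_eqF//; lra.
have h : 2 < (1 / m) `^ p + (t / m) `^ p by nra.
have : m `^ p * 2 < m `^ p * ((1 / m) `^ p + (t / m) `^ p) by rewrite ltr_pM2l.
rewrite [X in _ < X]mulrDr e1 e2; lra.
Qed.

Lemma powR_gap_ge0 p t : 1 < p -> -1 <= t -> t <= 1 -> 0 <= powR_gap p 1 t.
Proof.
move=> p1 t1; rewrite le_eqVlt => /predU1P[->|]; last first.
  by move=> t2; exact/ltW/powR_gap_gt0.
by rewrite /powR_gap (_ : (1 + 1) / 2 = 1)// ?normr1 ?powR1 //; lra.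
Qed.

Lemma powR_gap_continuous p : 1 < p -> continuous (powR_gap p 1).
Proof.
move=> p1; have p0 : 0 < p by lra.
have c := powR_norm_continuous p0.
move=> t; apply: cvgB.
  by apply: cvgM; [apply: cvgD; [exact: cvg_cst|exact: c]|exact: cvg_cst].
have c' : {for t, continuous (fun t : R => (1 + t) / 2)}.
  by apply: cvgM; [apply: cvgD; [exact: cvg_cst|exact: cvg_id]|exact: cvg_cst].
exact: (cvg_comp _ _ c' (c _)).
Qed.

(** By homogeneity s = 1 and |t| <= 1. Near t = 1 the term with [tau] alone suffices; on the
    remaining compact interval the gap has a positive minimum, while |1 - t|^p is at most 2^p. *)
Lemma powR_uniform_convexity p tau : 1 < p -> 0 < tau ->
  exists2 c : R, 0 <= c & forall s t,
    `|s - t| `^ p <= tau * (`|s| `^ p + `|t| `^ p) + c * powR_gap p s t.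
Proof.
move=> p1 tau0; have p0 : 0 < p by lra.
pose sg := tau `^ p^-1.
have sg0 : 0 < sg by exact: powR_gt0.
have sgE : sg `^ p = tau by rewrite -powRrM mulVf ?gt_eqF// powRr1// ltW.
have [c c0 hc] : exists2 c : R, 0 <= c & forall t, -1 <= t -> t <= 1 ->
    `|1 - t| `^ p <= tau * (1 + `|t| `^ p) + c * powR_gap p 1 t.
  have easy c t : 0 <= c -> -1 <= t -> t <= 1 -> 1 - t <= sg ->
      `|1 - t| `^ p <= tau * (1 + `|t| `^ p) + c * powR_gap p 1 t.
    move=> c0 t1 t2 ts; apply: (@le_trans _ _ tau).
      rewrite -sgE; apply: ge0_ler_powR; rewrite ?nnegrE ?(ltW p0) ?(ltW sg0)//.
      by rewrite ger0_norm; lra.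
    apply: (@le_trans _ _ (tau * (1 + `|t| `^ p))).
      by rewrite ler_peMr ?(ltW tau0)// lerDl powR_ge0.
    by rewrite lerDl mulr_ge0// powR_gap_ge0.
  have [sg2|sg2] := leP 2 sg.
    by exists 0 => // t t1 t2; apply: easy => //; lra.
  have ab : -1 <= 1 - sg by lra.
  have [|t0 t0ab t0min] := @EVT_min R (powR_gap p 1) _ _ ab.
    by apply: continuous_subspaceT; exact: powR_gap_continuous.
  move: t0ab; rewrite in_itv/= => /andP[t01 t02].
  have m0 : 0 < powR_gap p 1 t0 by apply: powR_gap_gt0 => //; lra.
  exists (2 `^ p / powR_gap p 1 t0); first by rewrite divr_ge0 ?powR_ge0 ?(ltW m0).
  move=> t t1 t2; have [ts|ts] := leP (1 - t) sg.
    by apply: easy => //; rewrite divr_ge0 ?powR_ge0 ?(ltW m0).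
  apply: (@le_trans _ _ (2 `^ p)).
    apply: ge0_ler_powR; rewrite ?nnegrE ?(ltW p0)//.
    by rewrite ger0_norm; lra.
  rewrite -[leLHS]add0r lerD// ?mulr_ge0 ?addr_ge0 ?powR_ge0 ?(ltW tau0)//.
  rewrite -mulrA ler_peMr ?powR_ge0// mulrC ler_pdivlMr// mul1r.
  by apply: t0min; rewrite in_itv/=; lra.
exists c => // s t.
have key x y : `|y| <= `|x| -> 
    `|x - y| `^ p <= tau * (`|x| `^ p + `|y| `^ p) + c * powR_gap p x y.
  move=> yx; have [x0|x0] := eqVneq x 0.
    move: yx; rewrite x0 normr0 normr_le0 => /eqP ->.
    rewrite /powR_gap subrr addr0 mul0r normr0 powR0 ?gt_eqF//.
    by rewrite addr0 mul0r subrr !mulr0 addr0.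
  have ax : 0 < `|x| by rewrite normr_gt0.
  have yE : y = x * (y / x) by rewrite mulrCA divff// mulr1.
  have : `|y / x| <= 1 by rewrite normrM normfV ler_pdivrMr// mul1r.
  rewrite ler_norml; set q := y / x in yE * => /andP[q1 q2]; have h := hc _ q1 q2.
  rewrite yE; clearbody q.
  rewrite (_ : x - x * q = x * (1 - q)); last by ring.
  rewrite /powR_gap (_ : (x + x * q) / 2 = x * ((1 + q) / 2)); last by ring.
  rewrite !(normrM x) !(powRM _ (normr_ge0 x) (normr_ge0 _)); have := ler_wpM2l (powR_ge0 `|x| p) h.
  by rewrite /powR_gap normr1 powR1; lra.
have [ts|st] := leP `|t| `|s|; first exact: key.
have := key _ _ (ltW st); rewrite distrC /powR_gap [t + s]addrC.
by rewrite ![ `|t| `^ p + `|s| `^ p]addrC.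
Qed.

End uniform_convexity_scalar.

(** * The spaces L_p(mu) *)

Section norm_inequalities.
Context {R : realType}.
Implicit Types (p : R) (V : normedModType R).

(** Type p with constant 1, for two vectors; for p = 2 it is one half of the parallelogram law. *)
Definition has_type p V : Prop := forall x y : V,
  `|x + y| `^ p + `|x - y| `^ p <= 2 * `|x| `^ p + 2 * `|y| `^ p.

(** Uniform convexity written linearly in p-th powers of norms, so that it integrates from scalars
    to L_p. *)
Definition unif_convex p V : Prop := forall tau, 0 < tau ->
  exists2 c : R, 0 <= c & forall x y : V,
    `|x - y| `^ p <= tau * (`|x| `^ p + `|y| `^ p) +
      c * ((`|x| `^ p + `|y| `^ p) / 2 - `|2^-1 *: (x + y)| `^ p).

Definition seq_lim V (u : nat -> V) (l : V) : Prop :=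
  forall e : R, 0 < e -> exists N, forall n, (N <= n)%N -> `|u n - l| <= e.

Definition seq_cauchy V (u : nat -> V) : Prop :=
  forall e : R, 0 < e -> exists N, forall m n, (N <= m)%N -> (N <= n)%N ->
    `|u m - u n| <= e.

Definition seq_complete V : Prop :=
  forall u : nat -> V, seq_cauchy u -> exists l, seq_lim u l.

End norm_inequalities.

Section integral_lemmas.
Context d (T : measurableType d) (R : realType).
Variable mu : {measure set T -> \bar R}.
Local Open Scope ereal_scope.

(** Nonnegative coefficients on both sides avoid subtraction in the extended reals. *)
Lemma ge0_integral_comb_le (A B C D : T -> R) (a b c e : R) :
  measurable_fun setT A -> measurable_fun setT B ->
  measurable_fun setT C -> measurable_fun setT D ->
  (forall x, 0 <= A x)%R -> (forall x, 0 <= B x)%R ->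
  (forall x, 0 <= C x)%R -> (forall x, 0 <= D x)%R ->
  (0 <= a)%R -> (0 <= b)%R -> (0 <= c)%R -> (0 <= e)%R ->
  (forall x, a * A x + b * B x <= c * C x + e * D x)%R ->
  a%:E * \int[mu]_x (A x)%:E + b%:E * \int[mu]_x (B x)%:E <=
  c%:E * \int[mu]_x (C x)%:E + e%:E * \int[mu]_x (D x)%:E.
Proof.
move=> mA mB mC mD A0 B0 C0 D0 a0 b0 c0 e0 h.
have comb u v (U V : T -> R) : measurable_fun setT U -> measurable_fun setT V ->
    (forall x, 0 <= U x)%R -> (forall x, 0 <= V x)%R -> (0 <= u)%R -> (0 <= v)%R ->
    u%:E * \int[mu]_x (U x)%:E + v%:E * \int[mu]_x (V x)%:E =
    \int[mu]_x (u * U x + v * V x)%:E.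
  move=> mU mV U0 V0 u0 v0.
  have mUE : measurable_fun setT (fun x => (U x)%:E) by exact/measurable_EFinP.
  have mVE : measurable_fun setT (fun x => (V x)%:E) by exact/measurable_EFinP.
  rewrite -!ge0_integralZl_EFin//; try by move=> x _; rewrite lee_fin.
  rewrite -ge0_integralD//.
  - by move=> x _; rewrite mule_ge0 ?lee_fin.
  - exact: measurable_funeM.
  - by move=> x _; rewrite mule_ge0 ?lee_fin.
  - exact: measurable_funeM.
rewrite !comb//; apply: ge0_le_integral => //.
- by move=> x _; rewrite lee_fin addr_ge0// mulr_ge0.
- apply/measurable_EFinP; apply: measurable_funD; exact: measurable_funM.
- apply/measurable_EFinP; apply: measurable_funD; exact: measurable_funM.
- by move=> x _; rewrite lee_fin.
Qed.

Lemma integral_mfrestr (A : set T) (mA : measurable A) (Aoo : mu A < +oo)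
    (f : T -> R) : measurable_fun setT f -> (forall x, 0 <= f x)%R ->
  \int[mfrestr mA Aoo]_x (f x)%:E = \int[mu]_(x in A) (f x)%:E.
Proof.
move=> mf f0.
have mfE D : measurable_fun D (EFin \o f).
  by apply/measurable_EFinP; exact: measurable_funTS.
rewrite -(setUv A) ge0_integral_setU//; last 3 first.
- exact: measurableC.
- by move=> x _; rewrite lee_fin.
- exact/disj_setPCl.
rewrite [X in _ + X](_ : _ = 0) ?adde0; last first.
  apply: null_set_integral => //; first exact: measurableC.
    by rewrite /= /mfrestr /mrestr setICl measure0.
apply: eq_measure_integral => B mB BA.
by rewrite /= /mfrestr /mrestr setIidl.
Qed.

End integral_lemmas.

Section Lspace_lemmas.
Context (R : realType) (p : R) (p1 : (1 <= p%:E)%E).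
Context d (T : measurableType d) (mu : {measure set T -> \bar R}).
Local Notation L := (LspaceType mu p1).
Implicit Types f g h : L.

Let p_ge1 : 1 <= p. Proof. by rewrite -lee_fin. Qed.
Let p_gt0 : 0 < p. Proof. exact: lt_le_trans p_ge1. Qed.

Lemma Lspace_measurable f : measurable_fun setT (f : T -> R).
Proof. exact: (@measurable_funPT _ _ _ _ (Lspace_repr f)). Qed.

Lemma measurable_powR_norm (k : T -> R) : measurable_fun setT k ->
  measurable_fun setT (fun x => `|k x| `^ p).
Proof.
move=> mk; apply: (measurableT_comp (measurable_realfun.measurable_powR p)).
exact: measurableT_comp.
Qed.

Lemma Lspace_powR_ae h (k : T -> R) : measurable_fun setT k ->
  (h : T -> R) = k %[ae mu] -> ((`|h| `^ p)%:E = \int[mu]_x (`|k x| `^ p)%:E)%E.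
Proof.
move=> mk hk; have pN0 : p != 0 by rewrite gt_eqF.
transitivity (\int[mu]_x (`|(EFin \o h) x| `^ p))%E.
  apply: etrans (powR_Lnorm mu (EFin \o h) pN0).
  by rewrite -(Lspace_normE h) poweR_EFin.
apply: ge0_ae_eq_integral => //.
- by apply/measurable_EFinP; apply: measurable_powR_norm; exact: Lspace_measurable.
- by apply/measurable_EFinP; exact: measurable_powR_norm.
- by move=> x _; exact: poweR_ge0.
- by move: hk; apply: filterS => x /= + _ => ->.
Qed.

Lemma Lspace_powR h : ((`|h| `^ p)%:E = \int[mu]_x (`|h x| `^ p)%:E)%E.
Proof. by apply: Lspace_powR_ae; [exact: Lspace_measurable|exact: nearW]. Qed.

Lemma Lspace_comb_ae a b f g :
  ((a *: f + b *: g : L) : T -> R) = (fun x => a * f x + b * g x) %[ae mu].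
Proof.
have := Lspace_addE (a *: f) (b *: g).
have := Lspace_scaleE a f; have := Lspace_scaleE b g.
by apply: filterS3 => x /= e1 e2 e3 xT; rewrite e3// e1// e2.
Qed.

Lemma measurable_comb a b f g : measurable_fun setT (fun x => a * f x + b * g x).
Proof.
by apply: measurable_funD; apply: measurable_funM => //; exact: Lspace_measurable.
Qed.

Lemma Lspace_powR_comb a b f g :
  ((`|a *: f + b *: g| `^ p)%:E = \int[mu]_x (`|a * f x + b * g x| `^ p)%:E)%E.
Proof.
by apply: Lspace_powR_ae; [exact: measurable_comb|exact: Lspace_comb_ae].
Qed.

Lemma Lspace_of (k : T -> R) : measurable_fun setT k ->
  (\int[mu]_x (`|k x| `^ p)%:E < +oo)%E ->
  exists h : L, (h : T -> R) = k %[ae mu].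
Proof.
move=> mk koo; have Lk : k \in Lfun mu p%:E.
  apply/andP; split; rewrite inE//= /finite_norm unlock.
  by apply: poweR_lty.
by exists (Lspace_class (Lfun_Sub p1 Lk)); exact: Lspace_classK.
Qed.

Let addE f g : f + g = 1 *: f + 1 *: g. Proof. by rewrite !scale1r. Qed.
Let subE f g : f - g = 1 *: f + (-1) *: g.
Proof. by rewrite scale1r scaleN1r. Qed.

Lemma Lspace_type : p <= 2 -> has_type p (L : normedModType R).
Proof.
move=> p2 f g.
have mf := Lspace_measurable f; have mg := Lspace_measurable g.
suff : (1%:E * (`|f + g| `^ p)%:E + 1%:E * (`|f - g| `^ p)%:E <=
    2%:E * (`|f| `^ p)%:E + 2%:E * (`|g| `^ p)%:E)%E.
  by rewrite -!EFinM -!EFinD lee_fin !mul1r.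
have E1 := Lspace_powR_comb 1 1 f g; rewrite -addE in E1.
have E2 := Lspace_powR_comb 1 (-1) f g; rewrite -subE in E2.
rewrite E1 E2 (Lspace_powR f) (Lspace_powR g).
apply: ge0_integral_comb_le => //; try (by move=> x; exact: powR_ge0);
  try (apply: measurable_powR_norm => //; exact: measurable_comb).
move=> x; rewrite !mul1r mulN1r.
exact: powR_type.
Qed.

Lemma Lspace_unif_convex : 1 < p -> unif_convex p (L : normedModType R).
Proof.
move=> p1' tau tau0; have [c c0 hc] := powR_uniform_convexity p1' tau0.
exists c => // f g; have mf := Lspace_measurable f; have mg := Lspace_measurable g.
(* The midpoint term moves to the left, so that only nonnegative integrands occur. *)
have h : `|f - g| `^ p + c * `|2^-1 *: (f + g)| `^ p <=
    (tau + c / 2) * `|f| `^ p + (tau + c / 2) * `|g| `^ p.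
  suff : (1%:E * (`|f - g| `^ p)%:E + c%:E * (`|2^-1 *: (f + g)| `^ p)%:E <=
    (tau + c / 2)%:E * (`|f| `^ p)%:E + (tau + c / 2)%:E * (`|g| `^ p)%:E)%E.
    by rewrite -!EFinM -!EFinD lee_fin !mul1r.
  have E1 := Lspace_powR_comb 2^-1 2^-1 f g; rewrite -scalerDr in E1.
  have E2 := Lspace_powR_comb 1 (-1) f g; rewrite -subE in E2.
  rewrite E1 E2 (Lspace_powR f) (Lspace_powR g).
  have tc0 : 0 <= tau + c / 2 by rewrite addr_ge0 ?(ltW tau0)// divr_ge0.
  apply: ge0_integral_comb_le => //; try (by move=> x; exact: powR_ge0);
    try (apply: measurable_powR_norm => //; exact: measurable_comb).
  move=> x; rewrite !mul1r mulN1r; have := hc (f x) (g x).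
  rewrite /powR_gap -mulrDr [2^-1 * _]mulrC; lra.
move: h; set A := `|f - g| `^ p; set B := `|2^-1 *: _| `^ p.
by set F := `|f| `^ p; set G := `|g| `^ p; lra.
Qed.

Definition truncated_mass (rho : R) f : R :=
  fine (\int[mu]_x (truncated_power p rho (f x))%:E).

Lemma measurable_truncated_power rho (k : T -> R) : measurable_fun setT k ->
  measurable_fun setT (fun x => truncated_power p rho (k x)).
Proof.
move=> mk; apply: measurable_realfun.measurable_minr.
  by apply: measurable_funM => //; exact: measurable_funX.
exact: measurable_powR_norm.
Qed.

Lemma truncated_mass_fin rho f :
  (\int[mu]_x (truncated_power p rho (f x))%:E \is a fin_num)%E.
Proof.
rewrite ge0_fin_numE; last first.
  by apply: integral_ge0 => x _; rewrite lee_fin truncated_power_ge0.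
have mf := Lspace_measurable f.
apply: (@le_lt_trans _ _ (`|f| `^ p)%:E); last by rewrite ltry.
rewrite (Lspace_powR f); apply: ge0_le_integral => //.
- by move=> x _; rewrite lee_fin truncated_power_ge0.
- by apply/measurable_EFinP; exact: measurable_truncated_power.
- by apply/measurable_EFinP; exact: measurable_powR_norm.
- by move=> x _; rewrite lee_fin ge_min lexx orbT.
Qed.

Lemma truncated_massE rho f :
  ((truncated_mass rho f)%:E = \int[mu]_x (truncated_power p rho (f x))%:E)%E.
Proof. exact: fineK (truncated_mass_fin rho f). Qed.

Lemma truncated_mass_ge0 rho f : 0 <= truncated_mass rho f.
Proof.
by apply: fine_ge0; apply: integral_ge0 => x _; rewrite lee_fin truncated_power_ge0.
Qed.

#[local] Opaque truncated_mass.

Lemma truncated_mass_ae rho h (k : T -> R) : measurable_fun setT k ->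
  (h : T -> R) = k %[ae mu] ->
  ((truncated_mass rho h)%:E = \int[mu]_x (truncated_power p rho (k x))%:E)%E.
Proof.
move=> mk hk; rewrite (truncated_massE rho h).
apply: ge0_ae_eq_integral => //.
- by apply/measurable_EFinP/measurable_truncated_power/Lspace_measurable.
- by apply/measurable_EFinP/measurable_truncated_power.
- by move=> x _; rewrite lee_fin truncated_power_ge0.
- by move=> x _; rewrite lee_fin truncated_power_ge0.
- by move: hk; apply: filterS => x /= + _ => ->.
Qed.

Let EFin_type_le (A B C D : R) (IA IB IC ID : \bar R) :
  A%:E = IA -> B%:E = IB -> C%:E = IC -> D%:E = ID ->
  (1%:E * IA + 1%:E * IB <= 2%:E * IC + 2%:E * ID)%E ->
  A + B <= 2 * C + 2 * D.
Proof. by move=> <- <- <- <-; rewrite -!EFinM -!EFinD lee_fin !mul1r. Qed.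

Lemma truncated_mass_type rho f g : p <= 2 ->
  truncated_mass rho (f + g) + truncated_mass rho (f - g) <=
  2 * truncated_mass rho f + 2 * truncated_mass rho g.
Proof.
move=> p2; have mf := Lspace_measurable f; have mg := Lspace_measurable g.
have tE a b := truncated_mass_ae rho (measurable_comb a b f g) (Lspace_comb_ae a b f g).
have E1 := tE 1 1; rewrite -addE in E1.
have E2 := tE 1 (-1); rewrite -subE in E2.
apply: (EFin_type_le E1 E2 (truncated_massE rho f) (truncated_massE rho g)).
apply: ge0_integral_comb_le => //; try (by move=> x; exact: truncated_power_ge0);
  try (apply: measurable_truncated_power => //; exact: measurable_comb).
move=> x; rewrite !mul1r mulN1r.
exact: truncated_power_type.
Qed.

Lemma le_truncated_mass rho f : 0 < rho -> p <= 2 ->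
  ((`|f| `^ p)%:E <= (rho `^ p)%:E * mu setT + (truncated_mass rho f)%:E)%E.
Proof.
move=> rho0 p2; have mf := Lspace_measurable f.
rewrite (Lspace_powR f) (truncated_massE rho f).
rewrite -(integral_cst mu measurableT) -ge0_integralD//.
- apply: ge0_le_integral => //.
  + by apply/measurable_EFinP; exact: measurable_powR_norm.
  + apply/measurable_EFinP; apply: measurable_funD => //.
    exact: measurable_truncated_power.
  + by move=> x _; rewrite /= lee_fin le_truncated_power.
- by move=> x _; rewrite /= lee_fin powR_ge0.
- by move=> x _; rewrite /= lee_fin truncated_power_ge0.
- by apply/measurable_EFinP; exact: measurable_truncated_power.
Qed.

(** Dominated convergence with majorant |f|^p: as p < 2, the factor rho^(p - 2) tends to 0 when rho
    grows, at each point against the fixed f(x)^2. *)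
Lemma truncated_mass_cvg0 f e : p < 2 -> 0 < e ->
  exists N : nat, forall n, (N <= n)%N -> truncated_mass n.+1%:R f <= e.
Proof.
move=> p2 e0; have mf := Lspace_measurable f.
have [|||||_ _] := @dominated_convergence _ T R mu setT measurableT
  (fun n x => (truncated_power p n.+1%:R (f x))%:E) (cst 0%E)
  (fun x => (`|f x| `^ p)%:E).
- by move=> n; apply/measurable_EFinP; exact: measurable_truncated_power.
- exact: measurable_cst.
- apply: nearW => x _; apply/fine_cvgP; split; first exact: nearW.
  have q0 : 0 < 2 - p by lra.
  apply/cvgrPdist_le => /= eps eps0.
  have [k kP] : exists k : nat, f x ^+ 2 / eps <= k%:R `^ (2 - p).
    pose K := `|Num.ceil ((f x ^+ 2 / eps) `^ (2 - p)^-1)|%N.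
    exists K; have K0 : 0 <= f x ^+ 2 / eps by rewrite divr_ge0 ?sqr_ge0// ltW.
    have {1}<- : ((f x ^+ 2 / eps) `^ (2 - p)^-1) `^ (2 - p) = f x ^+ 2 / eps.
      by rewrite -powRrM mulVf ?gt_eqF// powRr1.
    rewrite ge0_ler_powR ?nnegrE ?powR_ge0 ?(ltW q0)//.
    rewrite /K natr_absz ger0_norm ?ceil_ge//.
    by rewrite -(ler_int R) (le_trans _ (ceil_ge _))// powR_ge0.
  near=> n; rewrite /= sub0r normrN ger0_norm ?truncated_power_ge0//.
  rewrite /truncated_power ge_min; apply/orP; left.
  rewrite (_ : p - 2 = - (2 - p)); last by ring.
  rewrite powRN mulrC ler_pdivrMr ?powR_gt0// mulrC -ler_pdivrMr//.
  apply: le_trans kP _; rewrite ge0_ler_powR ?nnegrE ?(ltW q0)// ler_nat.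
  by rewrite ltnW// ltnS; near: n; exists k.
- apply/integrableP; split; first by apply/measurable_EFinP; exact: measurable_powR_norm.
  under eq_integral do rewrite gee0_abs ?lee_fin ?powR_ge0//.
  by rewrite -(Lspace_powR f) ltry.
- apply: nearW => x n _; rewrite gee0_abs ?lee_fin ?truncated_power_ge0//.
  by rewrite ge_min lexx orbT.
rewrite integral0 => /fine_cvgP[_ /cvgrPdist_le /(_ _ e0)[N _ NP]].
exists N => n Nn; have := NP n Nn.
by rewrite /= sub0r normrN ger0_norm// truncated_mass_ge0.
Unshelve. all: by end_near. Qed.

End Lspace_lemmas.

(** * Completeness of L_p *)

Section Lspace_complete.
Context (R : realType) (p : R) (p1 : (1 <= p%:E)%E).
Context d (T : measurableType d) (mu : {measure set T -> \bar R}).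
Local Notation L := (LspaceType mu p1).

Let p_ge1 : 1 <= p. Proof. by rewrite -lee_fin. Qed.
Let p_gt0 : 0 < p. Proof. exact: lt_le_trans p_ge1. Qed.

Lemma limn_einf_le (u : (\bar R)^nat) (b : \bar R) :
  (forall n, (u n <= b)%E) -> (limn_einf u <= b)%E.
Proof.
move=> ub; rewrite limn_einf_lim; apply: lime_le; first exact: is_cvg_einfs.
apply: nearW => n; apply: le_trans (ub n).
by apply: ereal_inf_lbound; exists n => /=.
Qed.

Let fast_cvg (a : nat -> R) (C : R) :
  (forall k, `|a k.+1 - a k| <= C * (2^-1) ^+ k) -> cvgn (a : R^o^nat).
Proof.
move=> aC; have half : `|2^-1 : R| < 1 by rewrite ger0_norm// invf_lt1// ltr1n.
have cs : cvgn (series (telescope a) : R^o^nat).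
  apply: normed_cvg; apply: series_le_cvg (is_cvg_geometric_series (a := C) half) => n.
  - exact: normr_ge0.
  - by apply: le_trans (aC n); exact: normr_ge0.
  - exact: aC.
have -> : a = (cst (a 0%N) + series (telescope a)).
  by apply/funext => n; rewrite [LHS]eq_sum_telescope.
by apply: is_cvgD => //; exact: is_cvg_cst.
Qed.

(** Riesz and Fischer: along a subsequence with steps at most 4^(-k), the differences times 2^k
    still have summable p-th powers, so the subsequence converges geometrically almost everywhere;
    Fatou's lemma turns this into convergence in norm. *)
Lemma Lspace_complete : seq_complete (L : normedModType R).
Proof.
move=> u uC; pose q : R := 4^-1.
have q0 k : 0 < q ^+ k by rewrite exprn_gt0// invr_gt0.
have /choice[N NP] : forall k, exists N, forall m n, (N <= m)%N -> (N <= n)%N ->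
    `|u m - u n| <= q ^+ k by move=> k; exact: uC (q0 k).
(* A sum of indices instead of a recursive choice: [M k] is at least each of [N 0], ..., [N k]. *)
pose M k := (\sum_(i < k.+1) N i)%N.
have NM k j : (k <= j)%N -> (N k <= M j)%N.
  move=> kj; have kj' : (k < j.+1)%N by [].
  by rewrite /M (bigD1 (Ordinal kj'))//= leq_addr.
pose v k := u (M k).
have vP k j : (k <= j)%N -> `|v j - v k| <= q ^+ k.
  by move=> kj; apply: NP; exact: NM.
have mv k : measurable_fun setT (v k : T -> R) by exact: Lspace_measurable.
pose D k x := `|2 ^+ k * v k.+1 x + (- 2 ^+ k) * v k x| `^ p.
have mD k : measurable_fun setT (D k).
  by apply: measurable_powR_norm; exact: measurable_comb.
have ID k : (\int[mu]_x (D k x)%:E <= ((2^-1) ^+ k)%:E)%E.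
  rewrite -(Lspace_powR_comb _ _ (v k.+1) (v k)) lee_fin.
  have -> : 2 ^+ k *: v k.+1 + - 2 ^+ k *: v k = 2 ^+ k *: (v k.+1 - v k).
    by rewrite scalerBr scaleNr.
  rewrite normrZ ger0_norm ?exprn_ge0//.
  have h : 2 ^+ k * `|v k.+1 - v k| <= (2^-1) ^+ k.
    have -> : (2^-1) ^+ k = 2 ^+ k * q ^+ k :> R.
      by rewrite -exprMn; congr (_ ^+ k); rewrite /q; lra.
    by rewrite ler_pM2l ?exprn_gt0// vP.
  apply: (@le_trans _ _ (((2^-1) ^+ k) `^ p)).
    by rewrite ge0_ler_powR ?nnegrE ?(ltW p_gt0) ?mulr_ge0 ?exprn_ge0 ?invr_ge0.
  apply: ge1r_powR => //; rewrite exprn_gt0 ?invr_gt0//=.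
  by apply: exprn_ile1; rewrite ?invr_ge0// invf_le1// ler1n.
have S_ae : {ae mu, forall x, setT x -> (\sum_(0 <= k <oo) (D k x)%:E)%E \is a fin_num}.
  apply: integrable_ae => //; apply/integrableP; split.
    apply: ge0_emeasurable_sum => [k x _ _|k _]; first by rewrite lee_fin powR_ge0.
    exact/measurable_EFinP.
  under eq_integral.
    by move=> x _; rewrite gee0_abs; [over|apply: nneseries_ge0 => *; rewrite lee_fin powR_ge0].
  rewrite integral_nneseries//; last 2 first.
  - by move=> k; exact/measurable_EFinP.
  - by move=> k x _; rewrite lee_fin powR_ge0.
  apply: (@le_lt_trans _ _ (\sum_(0 <= k <oo) ((2^-1 : R) ^+ k)%:E)%E).
    apply: lee_nneseries => [k _ _|k _]; last exact: ID.
    by apply: integral_ge0 => x _; rewrite lee_fin powR_ge0.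
  have half : `|2^-1 : R| < 1 by rewrite ger0_norm// invf_lt1// ltr1n.
  have := is_cvg_geometric_series (a := 1) half.
  move=> cg; rewrite (_ : (\sum_(0 <= k <oo) _)%E = (limn (series (geometric 1 (2^-1 : R))))%:E).
    by rewrite ltry.
  rewrite -EFin_lim//; congr (limn _); apply/funext => n /=.
  by rewrite /series /= sumEFin; congr _%:E; apply: eq_bigr => i _; rewrite mul1r.
have v_cvg : {ae mu, forall x, setT x -> exists l : R,
    (fun k => v k x : R) @ \oo --> l}.
  apply: filterS S_ae => x /= /(_ I) Sfin _.
  pose s := fine (\sum_(0 <= k <oo) (D k x)%:E)%E.
  have Ds k : D k x <= s.
    rewrite -lee_fin fineK//.
    have D0 n : (0 <= (D n x)%:E)%E by rewrite lee_fin powR_ge0.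
    rewrite nneseries_esumT//.
    by apply: esum_ge; exists [set k]; [split|rewrite fsbig_set1].
  have s0 : 0 <= s by apply: le_trans (Ds 0%N); exact: powR_ge0.
  have /cvg_ex[l xl] : cvgn ((fun k => v k x : R) : R^o^nat).
    apply: (@fast_cvg _ (s `^ p^-1)) => k.
    have E : D k x = (2 ^+ k * `|v k.+1 x - v k x|) `^ p.
      rewrite /D; congr (_ `^ _).
      rewrite mulNr -mulrBr normrM ger0_norm// exprn_ge0//.
    have : 2 ^+ k * `|v k.+1 x - v k x| <= s `^ p^-1.
      have pV0 : 0 <= p^-1 by rewrite invr_ge0 ltW.
      have z0 : 0 <= 2 ^+ k * `|v k.+1 x - v k x| by rewrite mulr_ge0 ?exprn_ge0.
      have -> : 2 ^+ k * `|v k.+1 x - v k x| = (D k x) `^ p^-1.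
        by rewrite E -powRrM divff ?gt_eqF// powRr1.
      by rewrite ge0_ler_powR ?nnegrE ?powR_ge0.
    by rewrite exprVn ler_pdivlMr ?exprn_gt0// mulrC.
  by exists l.
(* The upper limit is measurable everywhere and agrees with the limit where that exists. *)
pose g x : R := fine (limn_esup (fun k => (v k x)%:E)).
have mg : measurable_fun setT g.
  apply: (@measurableT_comp _ _ _ _ _ _ fine) => //.
  apply: measurable_realfun.measurable_fun_limn_esup => k.
  exact/measurable_EFinP.
have v_g : {ae mu, forall x, setT x -> (fun k => v k x : R) @ \oo --> g x}.
  apply: filterS v_cvg => x /= /(_ I) [l xl] _.
  rewrite /g; have : (fun k => (v k x)%:E) @ \oo --> l%:E by exact: cvg_EFin (nearW _ _) xl.
  by move=> /cvg_limn_einf_sup[_ ->].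
have vg k : (\int[mu]_x (`|1 * g x + (-1) * v k x| `^ p)%:E <= ((q ^+ k) `^ p)%:E)%E.
  pose F j x := ((`|1 * v (k + j)%N x + (-1) * v k x| `^ p)%:E)%E.
  have mF j : measurable_fun setT (F j).
    apply/measurable_EFinP; apply: measurable_powR_norm; exact: measurable_comb.
  have F0 j x : (0 <= F j x)%E by rewrite lee_fin powR_ge0.
  apply: (@le_trans _ _ (\int[mu]_x (limn_einf (F ^~ x)))%E).
    rewrite le_eqVlt; apply/orP; left; apply/eqP.
    apply: ge0_ae_eq_integral => //.
    - apply/measurable_EFinP; apply: measurable_powR_norm.
      by apply: measurable_funD; apply: measurable_funM.
    - apply: measurableT_comp => //.
      apply: measurable_realfun.measurable_fun_limn_esup => j.
      exact: measurableT_comp.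
    - move=> x _; rewrite limn_einf_lim; apply: lime_ge; first exact: is_cvg_einfs.
      by apply: nearW => n; apply: le_ereal_inf_tmp => _ [j _ <-].
    apply: filterS v_g => x /= /(_ I) vx _.
    apply/esym; apply: (cvg_limn_einf_sup _).1.
    apply: cvg_EFin; first exact: nearW.
    have c1 : (fun j => 1 * v (k + j)%N x + (-1) * v k x) @ \oo --> 1 * g x + (-1) * v k x.
      apply: cvgD; last exact: cvg_cst.
      apply: cvgM; first exact: cvg_cst.
      rewrite (_ : (fun j => v (k + j)%N x) = (fun j => v (j + k)%N x)).
        by have := vx; rewrite -(cvg_shiftn k).
      by apply/funext => j; rewrite addnC.
    exact: (cvg_comp _ _ c1 (@powR_norm_continuous R p p_gt0 _)).
  apply: le_trans (@fatou _ _ _ mu setT measurableT F mF (fun j x _ => F0 j x)) _.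
  apply: limn_einf_le => j.
  have := Lspace_powR_comb 1 (-1) (v (k + j)%N) (v k).
  rewrite -/(F j) => <-; rewrite lee_fin scale1r scaleN1r.
  rewrite ge0_ler_powR ?nnegrE ?(ltW p_gt0) ?(ltW (q0 k))//.
  by apply: vP; rewrite leq_addr.
(* By [vg], [g] minus the first term has finite norm, while [g] itself is not yet known to be in
   L_p; the limit is therefore taken as [h + v 0]. *)
have [h hg] : exists h : L, (h : T -> R) = (fun x => 1 * g x + (-1) * v 0%N x) %[ae mu].
  apply: Lspace_of; last by apply: le_lt_trans (vg 0%N) _; rewrite ltry.
  by apply: measurable_funD; apply: measurable_funM.
have hE k : `|v k - (h + v 0%N)| <= q ^+ k.
  rewrite distrC.
  have : `|h + v 0%N - v k| `^ p <= (q ^+ k) `^ p.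
    rewrite -lee_fin; apply: le_trans (vg k); rewrite le_eqVlt; apply/orP; left; apply/eqP.
    apply: Lspace_powR_ae; first by apply: measurable_funD; apply: measurable_funM.
    have : (h + v 0%N - v k : T -> R) = (fun x => h x + v 0%N x - v k x) %[ae mu].
      have := Lspace_addE (h + v 0%N) (- v k).
      have := Lspace_addE h (v 0%N).
      have := Lspace_oppE (v k).
      by apply: filterS3 => x /= e1 e2 e3 xT; rewrite e3// e2// e1.
    move: hg; apply: filterS2 => x /= e1 e2 xT.
    by rewrite e2// e1//; ring.
  have pV0 : 0 <= p^-1 by rewrite invr_ge0 ltW.
  move=> /(ge0_ler_powR pV0); rewrite !nnegrE !powR_ge0 => /(_ isT isT).
  by rewrite -!powRrM divff ?gt_eqF// !powRr1// ltW.
exists (h + v 0%N) => e e0.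
have [k ke] : exists k, q ^+ k <= e / 2.
  have e20 : 0 < e / 2 by rewrite divr_gt0.
  have q1 : `|q| < 1 by rewrite ger0_norm ?invr_ge0// invf_lt1// ltr1n.
  have /cvgrPdist_le/(_ _ e20)[k _ kP] := cvg_expr q1.
  by exists k; have := kP k (leqnn _); rewrite /= sub0r normrN ger0_norm// ltW.
exists (N k) => n Nn.
have h1 : `|u n - v k| <= q ^+ k by apply: NP => //; exact: NM.
rewrite -(subrKA (v k)) (le_trans (ler_normD _ _))//.
rewrite [leRHS](splitr e) lerD//; first exact: le_trans ke.
exact: le_trans (hE k) ke.
Qed.

End Lspace_complete.

(** * Sums in the sense of l_p *)

Lemma powRK (R : realType) (p x : R) : 0 < p -> 0 <= x -> (x `^ p) `^ p^-1 = x.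
Proof. by move=> p0 x0; rewrite -powRrM divff ?gt_eqF// powRr1. Qed.

Lemma powR_le_cancel (R : realType) (p x y : R) : 0 < p -> 0 <= x -> 0 <= y ->
  x `^ p <= y `^ p -> x <= y.
Proof.
move=> p0 x0 y0; have pV0 : 0 <= p^-1 by rewrite invr_ge0 ltW.
move=> /(ge0_ler_powR pV0); rewrite !nnegrE !powR_ge0 => /(_ isT isT).
by rewrite !powRK.
Qed.

Lemma ge_addl (R : numDomainType) (a b c : R) : a = b + c -> 0 <= c -> b <= a.
Proof. by move=> ->; rewrite lerDl. Qed.

Lemma tail_le (R : realFieldType) (a b c t e : R) :
  a = b + c -> a - e <= t -> t <= b -> c <= e.
Proof. by move=> *; lra. Qed.

Section seq_lim_lemmas.
Context {R : realType}.
Implicit Types V : normedModType R.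

Lemma seq_limP V (u : nat -> V) l : seq_lim u l <-> (u @ \oo --> l).
Proof.
split=> [ul|/cvgrPdist_le ul].
  apply/cvgrPdist_le => e e0; have [N NP] := ul _ e0.
  by exists N => // n /NP; rewrite distrC.
by move=> e e0; have [N _ NP] := ul _ e0; exists N => n /NP; rewrite distrC.
Qed.

Lemma real_seq_complete : seq_complete (R^o : normedModType R).
Proof.
move=> u uC; have : cvgn (u : (R^o)^nat).
  apply: cauchy_cvg; apply/cauchy_exP => e e0.
  have e20 : 0 < e / 2 by rewrite divr_gt0.
  have [N NP] := uC _ e20; exists (u N), N => // n Nn /=.
  rewrite -ball_normE /=; apply: le_lt_trans (NP _ _ (leqnn N) Nn) _.
  by rewrite ltr_pdivrMr// ltr_pMr// ltr1n.
by move=> /cvg_ex[l ul]; exists l; exact/seq_limP.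
Qed.

End seq_lim_lemmas.

Section esum_seq.
Context {R : realType} {I : choiceType}.
Implicit Types a b : I -> R.

Lemma esum_leP a (C : R) : (forall i, 0 <= a i) ->
  ((\esum_(i in [set: I]) (a i)%:E <= C%:E)%E <->
   forall s : seq I, uniq s -> \sum_(i <- s) a i <= C).
Proof.
move=> a0; split=> [aC s us|aC].
  rewrite -lee_fin -sumEFin; apply: le_trans aC; apply: esum_ge.
  exists [set` s]; first by split => //; exact: finite_seq.
  by rewrite -fsbig_seq.
apply: ge_ereal_sup => _ [F [finF _] <-].
by rewrite fsbig_finite//= sumEFin lee_fin; apply: aC.
Qed.

Lemma esum_approx a (e : R) : (forall i, 0 <= a i) -> 0 < e ->
  (\esum_(i in [set: I]) (a i)%:E < +oo)%E ->
  exists2 s : seq I, uniq s &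
    fine (\esum_(i in [set: I]) (a i)%:E)%E - e <= \sum_(i <- s) a i.
Proof.
move=> a0 e0 aoo.
have afin : (\esum_(i in [set: I]) (a i)%:E \is a fin_num)%E.
  by rewrite ge0_fin_numE//; apply: esum_ge0 => i _; rewrite lee_fin.
have [x [F [finF _] <-] xe] := ub_ereal_sup_adherent e0 afin.
exists (fset_set F); first exact: fset_uniq.
rewrite -lee_fin EFinB fineK// -sumEFin -fsbig_finite//.
exact: ltW.
Qed.

End esum_seq.

Section lpsum_lemmas.
Context (R : realType) (p : R) (p1 : (1 <= p%:E)%E) (I : choiceType).
Variable E : I -> normedModType R.
Local Notation Z := (lpsum p1 E).
Implicit Types (x y z : Z) (S : set I).

Let p_ge1 : 1 <= p. Proof. by rewrite -lee_fin. Qed.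
Let p_gt0 : 0 < p. Proof. exact: lt_le_trans p_ge1. Qed.

Lemma lpsum_powR x :
  ((`|x| `^ p)%:E = \esum_(i in [set: I]) (`|x i| `^ p)%:E)%E.
Proof.
rewrite lpsum_normE -powRrM mulVf ?gt_eqF// powRr1; last first.
  by apply: fine_ge0; apply: esum_ge0 => i _; rewrite lee_fin powR_ge0.
rewrite fineK// ge0_fin_numE; first exact: lpsum_finite.
by apply: esum_ge0 => i _; rewrite lee_fin powR_ge0.
Qed.

Lemma lpsum_powR_leP x (C : R) :
  (`|x| `^ p <= C <->
   forall s : seq I, uniq s -> \sum_(i <- s) `|x i| `^ p <= C).
Proof.
rewrite -lee_fin lpsum_powR; apply: esum_leP => i; exact: powR_ge0.
Qed.

Lemma lpsum_powR_sum x (s : seq I) : uniq s ->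
  \sum_(i <- s) `|x i| `^ p <= `|x| `^ p.
Proof. by have /lpsum_powR_leP := lexx (`|x| `^ p); exact. Qed.

Lemma lpsum_of (f : forall i, E i) (C : R) :
  (forall s : seq I, uniq s -> \sum_(i <- s) `|f i| `^ p <= C) ->
  exists2 x : Z, (forall i, x i = f i) & `|x| `^ p <= C.
Proof.
move=> fC; have fin : (esum_powR p f < +oo)%E.
  apply: (@le_lt_trans _ _ C%:E); last by rewrite ltry.
  by apply/esum_leP => // i; exact: powR_ge0.
by exists (Lpsum p1 fin) => //; apply/lpsum_powR_leP.
Qed.

Lemma lpsumD x y i : (x + y) i = x i + y i. Proof. by []. Qed.
Lemma lpsumZ c x i : (c *: x) i = c *: x i. Proof. by []. Qed.
Lemma lpsumN x i : (- x) i = - x i.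
Proof. by rewrite -[- x]/(lpsum_opp x) /= scaleN1r. Qed.
Lemma lpsumB x y i : (x - y) i = x i - y i.
Proof. by rewrite lpsumD lpsumN. Qed.

Lemma lpsum_sum (J : Type) (s : seq J) (x : J -> Z) i :
  (\sum_(j <- s) x j) i = \sum_(j <- s) x j i.
Proof.
by elim: s => [|j s IH]; rewrite ?big_nil// !big_cons lpsumD IH.
Qed.

Lemma ler_norm_coord x i : `|x i| <= `|x|.
Proof.
have := lpsum_powR_sum x (s := [:: i]) isT; rewrite big_seq1.
exact: powR_le_cancel.
Qed.

Lemma lpsum_type : (forall i, has_type p (E i)) ->
  has_type p (Z : normedModType R).
Proof.
move=> Et x y.
have D a b (A B : I -> R) : (forall i, 0 <= A i) -> (forall i, 0 <= B i) ->
    (a%:E = \esum_(i in [set: I]) (A i)%:E)%E ->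
    (b%:E = \esum_(i in [set: I]) (B i)%:E)%E ->
    ((a + b)%:E = \esum_(i in [set: I]) (A i + B i)%:E)%E.
  move=> A0 B0 aE bE; rewrite EFinD aE bE -esumD//.
    by move=> i _; rewrite lee_fin.
  by move=> i _; rewrite lee_fin.
have N0 z i : 0 <= `|z i| `^ p by exact: powR_ge0.
have E1 := D _ _ _ _ (N0 (x + y)) (N0 (x - y)) (lpsum_powR _) (lpsum_powR _).
have E2 := D _ _ _ _ (N0 x) (N0 x) (lpsum_powR _) (lpsum_powR _).
have E3 := D _ _ _ _ (N0 y) (N0 y) (lpsum_powR _) (lpsum_powR _).
have A0 z i : 0 <= `|z i| `^ p + `|z i| `^ p by rewrite addr_ge0.
have E4 := D _ _ _ _ (A0 x) (A0 y) E2 E3.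
have le_eq2 (a b : R) (a' b' : \bar R) :
    (a%:E = a' -> b%:E = b' -> a' <= b' -> (a <= b)%R)%E.
  by move=> <- <-; rewrite lee_fin.
have le2 (a b c e : R) : a + b <= (c + c) + (e + e) -> a + b <= 2 * c + 2 * e.
  by lra.
apply: (le2 _ _ _ _ (le_eq2 _ _ _ _ E1 E4 _)).
apply: le_esum => i _; rewrite lee_fin.
rewrite [X in _ + `|X| `^ p]lpsumB.
have le2' (a b c e : R) : a + b <= 2 * c + 2 * e -> a + b <= (c + c) + (e + e).
  by lra.
exact: (le2' _ _ _ _ (Et i (x i) (y i))).
Qed.

Lemma lproj_subproof S x : exists2 y : Z,
  (forall i, y i = if `[< S i >] then x i else 0) & `|y| `^ p <= `|x| `^ p.
Proof.
apply: lpsum_of => s us; apply: le_trans (lpsum_powR_sum x us).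
apply: ler_sum => i _; case: ifP => // _.
by rewrite normr0 powR0 ?gt_eqF// powR_ge0.
Qed.

End lpsum_lemmas.

(** Taken by choice from an existence statement and locked, so that only the coordinate formula
    [lprojE] is ever used. *)
HB.lock Definition lproj (R : realType) (p : R) (p1 : (1 <= p%:E)%E)
    (I : choiceType) (E : I -> normedModType R) (S : set I) (x : lpsum p1 E) :
    lpsum p1 E :=
  projT1 (cid2 (lproj_subproof S x)).

Arguments lproj {R p p1 I E} S x.

Section lproj_lemmas.
Context (R : realType) (p : R) (p1 : (1 <= p%:E)%E) (I : choiceType).
Variable E : I -> normedModType R.
Local Notation Z := (lpsum p1 E).
Implicit Types (x y z : Z) (S : set I).

Let p_ge1 : 1 <= p. Proof. by rewrite -lee_fin. Qed.
Let p_gt0 : 0 < p. Proof. exact: lt_le_trans p_ge1. Qed.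

Lemma lprojE S x i : lproj S x i = if `[< S i >] then x i else 0.
Proof. by rewrite lproj.unlock; case: cid2. Qed.

Lemma lproj_in S x i : S i -> lproj S x i = x i.
Proof. by move=> Si; rewrite lprojE asboolT. Qed.

Lemma lproj_out S x i : ~ S i -> lproj S x i = 0.
Proof. by move=> Si; rewrite lprojE asboolF. Qed.

Fact lproj_is_linear S : linear (lproj S : Z -> Z).
Proof.
move=> c x y; apply: lpsum_ext => i.
have e1 := lprojE S (c *: x + y) i.
have e2 := lpsumD (c *: lproj S x) (lproj S y) i.
have e3 := lpsumZ c (lproj S x) i.
have e4 := lprojE S x i; have e5 := lprojE S y i.
have e6 : (c *: x + y) i = c *: x i + y i by [].
rewrite e6 in e1; rewrite e1 e2 e3 e4 e5.
by case: ifP => [//|_]; rewrite scaler0 addr0.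
Qed.

HB.instance Definition _ S :=
  GRing.isLinear.Build R Z Z *:%R (lproj S : Z -> Z) (lproj_is_linear S).

Definition disjoint_coord x y := forall i, x i = 0 \/ y i = 0.

Lemma lpsum_powRD x y : disjoint_coord x y ->
  `|x + y| `^ p = `|x| `^ p + `|y| `^ p.
Proof.
move=> xy; have N0 z i : [set: I] i -> (0 <= (`|z i| `^ p)%:E)%E.
  by move=> _; rewrite lee_fin powR_ge0.
have E0 : (\esum_(i in [set: I]) (`|(x + y) i| `^ p)%:E =
    \esum_(i in [set: I]) ((`|x i| `^ p)%:E + (`|y i| `^ p)%:E))%E.
  apply: eq_esum => i _; rewrite -EFinD; congr (_%:E).
  rewrite -[(x + y) i]/(x i + y i).
  by case: (xy i) => ->; rewrite normr0 powR0 ?gt_eqF// ?add0r ?addr0.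
rewrite (esumD (N0 x) (N0 y)) -(lpsum_powR x) -(lpsum_powR y) -EFinD in E0.
by apply: EFin_inj; apply: etrans E0; exact: lpsum_powR.
Qed.

Lemma lpsum_powR_proj S x :
  `|x| `^ p = `|lproj S x| `^ p + `|x - lproj S x| `^ p.
Proof.
have dj : disjoint_coord (lproj S x) (x - lproj S x).
  move=> i; have e1 := lprojE S x i; have e2 := lpsumB x (lproj S x) i.
  rewrite e2 e1; case: ifP => _; last by left.
  by right; rewrite subrr.
have := lpsum_powRD dj.
by have -> : lproj S x + (x - lproj S x) = x by rewrite addrC subrK.
Qed.

Lemma ler_powR_norm (V W : normedModType R) (x : V) (y : W) :
  `|x| `^ p <= `|y| `^ p -> `|x| <= `|y|.
Proof. exact: powR_le_cancel. Qed.

Lemma ler_norm_lproj S x : `|lproj S x| <= `|x|.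
Proof.
have h : `|lproj S x| `^ p <= `|x| `^ p.
  by apply: (ge_addl (lpsum_powR_proj S x)); exact: powR_ge0.
exact: ler_powR_norm h.
Qed.

Lemma ler_norm_subproj S x : `|x - lproj S x| <= `|x|.
Proof.
have h : `|x - lproj S x| `^ p <= `|x| `^ p.
  apply: (ge_addl (etrans (lpsum_powR_proj S x) (addrC _ _))); exact: powR_ge0.
exact: ler_powR_norm h.
Qed.

Lemma lproj_comp S S' x : S' `<=` S -> lproj S' (lproj S x) = lproj S' x.
Proof.
move=> SS; apply: lpsum_ext => i; have [Si|Si] := pselect (S' i).
  by rewrite !lproj_in//; exact: SS.
by rewrite !lproj_out.
Qed.

Lemma lpsum_approx x (e : R) : 0 < e ->
  exists2 s : seq I, uniq s & `|x - lproj [set` s] x| `^ p <= e.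
Proof.
move=> e0; have [||s us hs] := @esum_approx R I (fun i => `|x i| `^ p) e _ e0.
- by move=> i; exact: powR_ge0.
- exact: lpsum_finite.
exists s => //; move: hs; rewrite -(lpsum_powR x) /= => hs.
have hp : \sum_(i <- s) `|x i| `^ p <= `|lproj [set` s] x| `^ p.
  apply: le_trans (lpsum_powR_sum (lproj [set` s] x) us).
  by rewrite big_seq [leRHS]big_seq; apply: ler_sum => i si; rewrite lproj_in.
exact: tail_le (lpsum_powR_proj [set` s] x) hs hp.
Qed.

Definition lsupp x : set I := [set i | x i != 0].

(** Every nonzero coordinate is seen by some finitely supported approximation of error 1 / (n +
    1). *)
Lemma lsupp_countable x : countable (lsupp x).
Proof.
have /choice[s sP] : forall n : nat, exists s : seq I,
    `|x - lproj [set` s] x| `^ p <= n.+1%:R^-1.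
  move=> n; have [|s _ sP] := @lpsum_approx x n.+1%:R^-1; first by rewrite invr_gt0.
  by exists s.
apply: (@sub_countable _ _ _ (\bigcup_n [set` s n])); last first.
  by apply: bigcup_countable => // n _; apply: finite_set_countable; exact: finite_seq.
apply: subset_card_le => i; rewrite /lsupp/= => xi0; apply: contrapT => ni.
have xi : 0 < `|x i| `^ p by apply: powR_gt0; rewrite normr_gt0.
have [n hn] : exists n : nat, n.+1%:R^-1 < `|x i| `^ p.
  exists (Num.trunc (`|x i| `^ p)^-1); rewrite invf_plt ?posrE//.
  exact: truncnS_gt.
have := lpsum_powR_sum (x - lproj [set` s n] x) (s := [:: i]) isT.
have e1 := lpsumB x (lproj [set` s n] x) i.
have e2 : lproj [set` s n] x i = 0 by apply: lproj_out => si; apply: ni; exists n.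
rewrite big_seq1 e1 e2 subr0 => h1.
by have := le_lt_trans (le_trans h1 (sP n)) hn; rewrite ltxx.
Qed.

Lemma lproj_lsupp S x : lsupp x `<=` S -> lproj S x = x.
Proof.
move=> xS; apply: lpsum_ext => i; have [Si|Si] := pselect (S i).
  by rewrite lproj_in.
rewrite lproj_out//; apply/esym/eqP; apply: contrapT => /negP xi.
exact/Si/xS.
Qed.

Lemma lpsum_powR_sum_disjoint (J : eqType) (s : seq J) (x : J -> Z) :
  uniq s -> {in s &, forall j k, j != k -> disjoint_coord (x j) (x k)} ->
  `|\sum_(j <- s) x j| `^ p = \sum_(j <- s) `|x j| `^ p.
Proof.
elim: s => [|j s IH]; first by rewrite !big_nil normr0 powR0// gt_eqF.
rewrite !big_cons /= => /andP[js us] dx.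
have IH' := IH us (fun k l ks ls => dx k l (@mem_behead _ (j :: s) _ ks) (@mem_behead _ (j :: s) _ ls)).
rewrite -IH'; apply: lpsum_powRD => i.
have [xi0|xi0] := eqVneq (x j i) 0; [by left|right].
have e1 := lpsum_sum s x i; rewrite e1 big_seq big1// => k ks.
have jk : j != k by apply: contraNneq js => ->.
have ks' : k \in j :: s by rewrite inE ks orbT.
have [xj0|//] := dx j k (mem_head j s) ks' jk i.
by rewrite xj0 eqxx in xi0.
Qed.

End lproj_lemmas.

Lemma mk_linear (R : pzRingType) (U V : lmodType R) (f : U -> V) :
  linear f -> exists T : {linear U -> V}, forall x, T x = f x.
Proof.
move=> fl; pose g : {linear U -> V} :=
  HB.pack f (GRing.isLinear.Build R U V *:%R f fl).
by exists g.
Qed.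

Lemma powR_eq_cancel (R : realType) (p x y : R) : 0 < p -> 0 <= x -> 0 <= y ->
  x `^ p = y `^ p -> x = y.
Proof. by move=> p0 x0 y0 e; rewrite -(powRK p0 x0) e powRK. Qed.

Lemma cvg_real_le (R : realType) (f : nat -> R) (l C : R) (N : nat) :
  f @ \oo --> l -> (forall n, (N <= n)%N -> f n <= C) -> l <= C.
Proof.
move=> fl fC; rewrite -(cvg_lim (@Rhausdorff R) fl).
apply: limr_le; first by apply/cvg_ex; exists l.
by near=> n; apply: fC; near: n; exists N.
Unshelve. all: by end_near. Qed.

Lemma sum_pred1_le (R : numDomainType) (I : eqType) (c : R) (g : I) (s : seq I) :
  0 <= c -> uniq s -> \sum_(i <- s | i == g) c <= c.
Proof.
move=> c0 us; rewrite big_const_seq.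
have -> : count (fun i => i == g) s = (g \in s).
  by rewrite -(count_uniq_mem g us); apply: eq_count.
by case: (g \in s); rewrite /= ?addr0.
Qed.

(** * Completeness of l_p-sums and restriction to fewer summands *)

Section lpsum_complete.
Context (R : realType) (p : R) (p1 : (1 <= p%:E)%E) (I : choiceType).
Variable E : I -> normedModType R.
Local Notation Z := (lpsum p1 E).

Let p_ge1 : 1 <= p. Proof. by rewrite -lee_fin. Qed.
Let p_gt0 : 0 < p. Proof. exact: lt_le_trans p_ge1. Qed.

Let coord_cvg (V : normedModType R) (v : nat -> V) (w l : V) : seq_lim v l ->
  (fun m => `|w - v m| `^ p) @ \oo --> `|w - l| `^ p.
Proof.
move=> /seq_limP vl.
have c1 : (fun m => `|w - v m|) @ \oo --> `|w - l|.
  by apply: cvg_norm; apply: cvgB => //; exact: cvg_cst.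
have c2 := cvg_comp _ _ c1 (@powR_norm_continuous R p p_gt0 `|w - l|).
rewrite normr_id in c2; apply: cvg_trans c2.
by apply: near_eq_cvg; apply: nearW => m /=; rewrite normr_id.
Qed.

(** Finite sums over coordinates pass to the limit, which bounds the distance of [u n] from the
    coordinatewise limit [l]. *)
Lemma lpsum_complete : (forall i, seq_complete (E i)) ->
  seq_complete (Z : normedModType R).
Proof.
move=> Ec u uC.
have coordB m n i : `|u m i - u n i| <= `|u m - u n|.
  by have := ler_norm_coord (u m - u n) i; rewrite (lpsumB (u m) (u n) i).
have ex_l : forall i, exists l : E i, seq_lim (fun n => u n i) l.
  move=> i; apply: Ec => e e0; have [N NP] := uC _ e0.
  by exists N => m n Nm Nn; apply: le_trans (coordB m n i) (NP _ _ Nm Nn).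
have {ex_l}[l lP] : {l : forall i, E i & forall i, seq_lim (fun n => u n i) (l i)}.
  by exists (fun i => projT1 (cid (ex_l i))) => i; exact: (projT2 (cid (ex_l i))).
have key e N n : 0 < e -> (forall m n, (N <= m)%N -> (N <= n)%N -> `|u m - u n| <= e) ->
    (N <= n)%N -> forall s : seq I, uniq s -> \sum_(i <- s) `|u n i - l i| `^ p <= e `^ p.
  move=> e0 NP Nn s us.
  have c : (fun m => \sum_(i <- s) `|u n i - u m i| `^ p) @ \oo -->
      \sum_(i <- s) `|u n i - l i| `^ p.
    elim: s {us} => [|i s IH].
      by rewrite big_nil; under eq_fun do rewrite big_nil; exact: cvg_cst.
    rewrite big_cons; under eq_fun do rewrite big_cons.
    by apply: cvgD => //; exact: coord_cvg.
  apply: (cvg_real_le c (N := N)) => m Nm.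
  have h1 := lpsum_powR_sum (u n - u m) us.
  have h2 : `|u n - u m| `^ p <= e `^ p.
    by rewrite ge0_ler_powR ?nnegrE ?(ltW p_gt0) ?(ltW e0)//; exact: NP.
  apply: le_trans h2; apply: le_trans h1.
  by apply: ler_sum => i _; rewrite (lpsumB (u n) (u m) i).
(* [l] belongs to the sum because it differs from [u N0] by the element [y0]. *)
have [N0 N0P] := uC _ ltr01.
have [y0 y0E _] := lpsum_of p1 (key _ _ _ ltr01 N0P (leqnn N0)).
have lE i : (u N0 - y0) i = l i.
  by rewrite (lpsumB (u N0) y0 i) y0E opprB addrC subrK.
exists (u N0 - y0) => e e0; have [N NP] := uC _ e0; exists N => n Nn.
have [y yE ye] := lpsum_of p1 (key _ _ _ e0 NP Nn).
have -> : u n - (u N0 - y0) = y.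
  apply: lpsum_ext => i; rewrite (yE i) -(lE i).
  exact: lpsumB (u n) (u N0 - y0) i.
exact: (powR_le_cancel p_gt0 (normr_ge0 y) (ltW e0) ye).
Qed.

(** Turns the projection onto [S] into an operator into the sum over [S] alone, which is the kind of
    space that (4) speaks of. *)
Lemma lpsum_restrict (S : set I) :
  exists T : {linear Z -> lpsum p1 (fun j : S => E (val j))},
    forall x, `|T x| = `|lproj S x|.
Proof.
have ex (x : Z) : exists2 y : lpsum p1 (fun j : S => E (val j)),
    (forall j, y j = x (val j)) & `|y| `^ p <= `|x| `^ p.
  apply: lpsum_of => s us; rewrite -(big_map val xpredT (fun i => `|x i| `^ p)).
  by apply: lpsum_powR_sum; rewrite map_inj_uniq//; exact: val_inj.
pose f (x : Z) := projT1 (cid2 (ex x)).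
have fE (x : Z) j : f x j = x (val j) by rewrite /f; case: cid2.
clearbody f.
have [|T TE] := @mk_linear R Z (lpsum p1 (fun j : S => E (val j))) f.
  move=> c x y; apply: lpsum_ext => j.
  have e1 := fE (c *: x + y) j; rewrite e1.
  have e2 := fE x j; have e3 := fE y j.
  rewrite -[RHS]/(c *: (f x j) + f y j) e2 e3.
  by [].
exists T => x; rewrite TE.
suff e : `|f x| `^ p = `|lproj S x| `^ p.
  exact: (powR_eq_cancel p_gt0 (normr_ge0 _) (normr_ge0 _) e).
apply: EFin_inj; apply: (etrans (lpsum_powR (f x))).
apply: (etrans _ (esym (lpsum_powR (lproj S x)))).
have e1 : (\esum_(i in S) (`|x i| `^ p)%:E =
    \esum_(j in [set: S]) (`|x (val j)| `^ p)%:E)%E.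
  rewrite -(@esum_image R _ _ [set: S] val (fun i => (`|x i| `^ p)%:E)).
    congr (esum _ _); apply/seteqP; split=> [i Si|_ [j _ <-]]; last exact: set_valP.
    by exists (exist _ i (mem_set Si)).
  by move=> a b _ _; exact: val_inj.
transitivity (\esum_(i in S) (`|x i| `^ p)%:E)%E.
  by rewrite e1; apply: eq_esum => j _; rewrite fE.
rewrite esum_mkcond; apply: eq_esum => i _; rewrite lprojE.
rewrite [i \in S](_ : _ = `[< S i >]); last by apply/idP/asboolP; rewrite inE.
by case: ifP => // _; rewrite normr0 powR0// gt_eqF.
Qed.

End lpsum_complete.

(** * Unit vectors of l_p(Gamma) *)

Section ellp_basis.
Context (R : realType) (p : R) (p1 : (1 <= p%:E)%E) (I : choiceType).
Local Notation l := (ellp p1 I).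

Let p_ge1 : 1 <= p. Proof. by rewrite -lee_fin. Qed.
Let p_gt0 : 0 < p. Proof. exact: lt_le_trans p_ge1. Qed.

Lemma ellp_complete : seq_complete l.
Proof. by apply: lpsum_complete => i; exact: real_seq_complete. Qed.

Lemma ellp_basis_subproof (g : I) :
  exists2 x : lpsum p1 (fun _ : I => R^o : normedModType R),
    (forall i, x i = (i == g)%:R) & `|x| `^ p <= 1.
Proof.
apply: lpsum_of => s us.
apply: (@le_trans _ _ (\sum_(i <- s | i == g) 1)).
  rewrite [leRHS]big_mkcond; apply: ler_sum => i _ /=.
  by case: ifP => _ /=; rewrite ?normr1 ?powR1// normr0 powR0// gt_eqF.
exact: sum_pred1_le.
Qed.

End ellp_basis.

HB.lock Definition ellp_basis (R : realType) (p : R) (p1 : (1 <= p%:E)%E)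
    (I : choiceType) (g : I) : lpsum p1 (fun _ : I => R^o : normedModType R) :=
  projT1 (cid2 (@ellp_basis_subproof R p p1 I g)).
Arguments ellp_basis {R p} p1 {I} g.

Section ellp_basis_lemmas.
Context (R : realType) (p : R) (p1 : (1 <= p%:E)%E) (I : choiceType).
Local Notation l := (lpsum p1 (fun _ : I => R^o : normedModType R)).

Let p_ge1 : 1 <= p. Proof. by rewrite -lee_fin. Qed.
Let p_gt0 : 0 < p. Proof. exact: lt_le_trans p_ge1. Qed.

Lemma ellp_basisE (g i : I) : ellp_basis p1 g i = (i == g)%:R.
Proof. by rewrite ellp_basis.unlock; case: cid2. Qed.

Lemma ellp_basisZ (c : R) (g i : I) :
  (c *: ellp_basis p1 g : l) i = c * (i == g)%:R.
Proof. by rewrite -ellp_basisE. Qed.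

Lemma ellp_comb_coord (c : I -> R) (s : seq I) (i : I) : uniq s ->
  (\sum_(g <- s) c g *: ellp_basis p1 g : l) i = if i \in s then c i else 0.
Proof.
move=> us; have e := lpsum_sum s (fun g => c g *: ellp_basis p1 g) i.
rewrite e {e}; transitivity (\sum_(g <- s) c g * (i == g)%:R).
  by apply: eq_bigr => g _; rewrite -ellp_basisE.
case: ifPn => [si|si].
  rewrite (big_rem i si)/= eqxx mulr1 big_seq big1 ?addr0// => g.
  by rewrite mem_rem_uniq// inE => /andP[gi _]; rewrite eq_sym (negPf gi) mulr0.
rewrite big_seq big1// => g gs; rewrite (_ : i == g = false) ?mulr0//.
by apply: contraNF si => /eqP ->.
Qed.

Lemma ellp_comb_proj (a : l) (s : seq I) : uniq s ->
  \sum_(g <- s) (a g : R) *: ellp_basis p1 g = lproj [set` s] a.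
Proof.
move=> us; apply: lpsum_ext => i; rewrite lprojE.
apply: (etrans (@ellp_comb_coord (fun g => a g) s i us)).
by rewrite [ `[< _ >]](_ : _ = (i \in s))//; apply/asboolP/idP.
Qed.

Lemma ellp_comb_norm (c : I -> R) (s : seq I) : uniq s ->
  `|\sum_(g <- s) c g *: ellp_basis p1 g : l| `^ p = \sum_(g <- s) `|c g| `^ p.
Proof.
move=> us; rewrite lpsum_powR_sum_disjoint//.
  apply: eq_bigr => g _; apply/eqP; rewrite eq_le; apply/andP; split.
    apply/lpsum_powR_leP => t ut.
    apply: (@le_trans _ _ (\sum_(i <- t | i == g) `|c g| `^ p)).
      rewrite [leRHS]big_mkcond; apply: ler_sum => i _.
      rewrite (ellp_basisZ (c g) g i).
      by case: ifP => _ /=; rewrite ?mulr1// mulr0 normr0 powR0// gt_eqF.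
    by apply: sum_pred1_le => //; exact: powR_ge0.
  have := lpsum_powR_sum (c g *: ellp_basis p1 g : l) (s := [:: g]) isT.
  rewrite big_seq1 (ellp_basisZ (c g) g g).
  by rewrite eqxx mulr1.
move=> g h _ _ gh i; have [ig|ig] := eqVneq i g; [right|left].
  rewrite (ellp_basisZ (c h) h i) ig.
  by rewrite (negPf gh) mulr0.
rewrite (ellp_basisZ (c g) g i).
by rewrite (negPf ig) mulr0.
Qed.

End ellp_basis_lemmas.

(** * Linear functionals and operators *)

Section hahn_banach.
Context {R : realType} {V : lmodType R}.
Implicit Types q : V -> R.

Definition sublinear q :=
  (forall x y, q (x + y) <= q x + q y) /\
  (forall c x, 0 < c -> q (c *: x) <= c * q x).

Lemma sublinearZ q c x : sublinear q -> 0 < c -> q (c *: x) = c * q x.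
Proof.
move=> [_ qZ] c0; apply/eqP; rewrite eq_le qZ//=.
have := qZ c^-1 (c *: x); rewrite invr_gt0 scalerA mulVf ?gt_eqF// scale1r.
by move=> /(_ c0); rewrite ler_pdivlMl.
Qed.

Lemma sublinear_ge q x : sublinear q -> - q (- x) <= q x.
Proof.
move=> qs; have q00 : q (0 + 0) <= q 0 + q 0 by exact: qs.1.
have := qs.1 x (- x); rewrite subrr; rewrite addr0 in q00; lra.
Qed.

(** Directedness up to inequality suffices for infima. Three uses: lower bounds of chains of
    sublinear functionals, improvement of a minimal one, and norming a vector. *)
Lemma sublinear_inf (T : Type) (D : set T) (g : T -> V -> R) (b : V -> R) :
  D !=set0 -> (forall t x, D t -> b x <= g t x) ->
  (forall t1 t2 x y, D t1 -> D t2 -> exists2 t, D t & g t (x + y) <= g t1 x + g t2 y) ->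
  (forall t c x, D t -> 0 < c -> exists2 t', D t' & g t' (c *: x) <= c * g t x) ->
  exists q, [/\ sublinear q, forall t x, D t -> q x <= g t x
    & forall x y, (forall t, D t -> y <= g t x) -> y <= q x].
Proof.
move=> [t0 Dt0] gb gD gZ; pose q x := inf [set g t x | t in D].
have qle t x : D t -> q x <= g t x.
  move=> Dt; apply: ge_inf; last by exists t.
  by exists (b x) => _ [s Ds <-]; exact: gb.
have leq x y : (forall t, D t -> y <= g t x) -> y <= q x.
  by move=> yg; apply: lb_le_inf; [by exists (g t0 x), t0|move=> _ [t Dt <-]; exact: yg].
clearbody q; exists q; split=> //; split=> [x y|c x c0].
  have h1 t1 t2 : D t1 -> D t2 -> q (x + y) <= g t1 x + g t2 y.
    move=> Dt1 Dt2; have [t Dt] := gD t1 t2 x y Dt1 Dt2.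
    by apply: le_trans; exact: qle.
  have h2 t2 : D t2 -> q (x + y) - g t2 y <= q x.
    by move=> Dt2; apply: leq => t1 Dt1; have := h1 _ _ Dt1 Dt2; lra.
  have : q (x + y) - q x <= q y.
    by apply: leq => t2 Dt2; have := h2 _ Dt2; lra.
  by lra.
rewrite -ler_pdivrMl//; apply: leq => t Dt; rewrite ler_pdivrMl//.
have [t' Dt' h] := gZ t c x Dt c0; apply: le_trans h; exact: qle.
Qed.

(** Hahn-Banach without extension: a minimal sublinear functional below [p0], found by Zorn's lemma,
    is linear. *)
Lemma sublinear_linear_minorant (p0 : V -> R) : sublinear p0 ->
  exists l : V -> R, (forall c x y, l (c *: x + y) = c * l x + l y) /\
    forall x, l x <= p0 x.
Proof.
move=> p0s; pose Q := {q : V -> R | sublinear q /\ forall x, q x <= p0 x}.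
pose Rel (q q' : Q) := `[< forall x, sval q' x <= sval q x >].
have [||||[q [qs qp]] qmin] := @Zorn Q Rel.
- by move=> q; apply/asboolP.
- by move=> q r s /asboolP qr /asboolP rs; apply/asboolP => x; exact: le_trans (rs x) (qr x).
- move=> q r /asboolP qr /asboolP rq; apply: proj1_sig_inj; apply/funext => x.
  by apply/eqP; rewrite eq_le qr rq.
- move=> A Atot; have [[q0 Aq0]|/nonemptyPn ->] := pselect (A !=set0); last first.
    by exists (exist _ p0 (conj p0s (fun x => lexx (p0 x)))).
  have [||||m [ms mle mge]] := @sublinear_inf Q A (fun w : Q => sval w) (fun x => - p0 (- x)).
  + by exists q0.
  + move=> [q [qs qp]] x _ /=; apply: le_trans (sublinear_ge x qs).
    by rewrite lerN2.
  + move=> q r x y Aq Ar; have [/asboolP qr|/asboolP rq] := Atot _ _ Aq Ar.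
      exists r => //; case: (svalP r) => rs _; apply: le_trans (rs.1 x y) _.
      by rewrite lerD2r.
    exists q => //; case: (svalP q) => qs _; apply: le_trans (qs.1 x y) _.
    by rewrite lerD2l.
  + move=> q c x Aq c0; exists q => //; case: (svalP q) => qs _; exact: qs.2.
  have mp x : m x <= p0 x.
    by apply: le_trans (mle _ x Aq0) _; case: (svalP q0).
  by exists (exist _ m (conj ms mp)) => s As; apply/asboolP => x; exact: mle.
have qD x y : q (x + y) = q x + q y.
  apply/eqP; rewrite eq_le qs.1/=.
  (* With y fixed, the infimum over t >= 0 of q(x + t y) - t q(y) is sublinear and below q, so it
     equals q by minimality; t = 1 gives q(x) + q(y) <= q(x + y). *)
  have [||||m [ms mle _]] := @sublinear_inf R [set t : R | 0 <= t]
    (fun t x => q (x + t *: y) - t * q y) (fun x => - q (- x)).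
  + by exists 0 => /=.
  + move=> t z /=; rewrite le_eqVlt => /predU1P[<-|t0].
      by rewrite scale0r mul0r subr0 addr0; exact: sublinear_ge.
    rewrite -(sublinearZ y qs t0).
    have := qs.1 (- z) (z + t *: y); rewrite addKr; lra.
  + move=> t1 t2 z w /= t10 t20; exists (t1 + t2); first exact: addr_ge0.
    have := qs.1 (z + t1 *: y) (w + t2 *: y).
    by rewrite addrACA -scalerDl; lra.
  + move=> t c z /= t0 c0; exists (c * t); first by rewrite mulr_ge0// ltW.
    have := qs.2 c (z + t *: y) c0; rewrite scalerDr scalerA; lra.
  have mq z : m z <= q z.
    by have := mle 0 z (lexx 0); rewrite scale0r mul0r subr0 addr0.
  have mp z : m z <= p0 z by exact: le_trans (mq z) (qp z).
  have /(congr1 sval) /= mE : exist _ m (conj ms mp) = exist _ q (conj qs qp) :> Q.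
    by apply: qmin; apply/asboolP.
  have := mle 1 x ler01; rewrite mE scale1r mul1r; lra.
have q0 : q 0 = 0 by have := qD 0 0; rewrite addr0; lra.
have qN x : q (- x) = - q x by have := qD x (- x); rewrite subrr q0; lra.
exists q; split=> // c x y; rewrite qD; congr (_ + _).
have [c0|c0|->] := ltrgtP c 0.
- rewrite -[c]opprK scaleNr qN sublinearZ ?oppr_gt0//; lra.
- exact: sublinearZ.
- by rewrite scale0r mul0r.
Qed.

End hahn_banach.

(** The infimum over t >= 0 of |x + t f| - t |f| is sublinear, at most |x|, and at most -|f| at x =
    -f; any linear functional below it norms f. *)
Lemma norming_functional (R : realType) (V : normedModType R) (f : V) :
  exists l : V -> R, [/\ forall c x y, l (c *: x + y) = c * l x + l y,
    forall x, `|l x| <= `|x| & l f = `|f|].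
Proof.
have [||||m [ms mle _]] := @sublinear_inf R V R [set t : R | 0 <= t]
    (fun t x => `|x + t *: f| - t * `|f|) (fun x => - `|x|).
- by exists 0 => /=.
- move=> t x /= t0; have := ler_normB (x + t *: f) x.
  by rewrite addrAC subrr add0r normrZ ger0_norm//; lra.
- move=> t1 t2 z w /= t10 t20; exists (t1 + t2); first exact: addr_ge0.
  have := ler_normD (z + t1 *: f) (w + t2 *: f).
  by rewrite addrACA -scalerDl; lra.
- move=> t c z /= t0 c0; exists (c * t); first by rewrite mulr_ge0// ltW.
  have := normrZ c (z + t *: f); rewrite ger0_norm ?(ltW c0)// scalerDr scalerA => ->; lra.
have [l [ll lm]] := sublinear_linear_minorant ms.
have l0 : l 0 = 0 by have := ll 1 0 0; rewrite scale1r addr0; lra.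
have lN x : l (- x) = - l x.
  by have := ll (-1) x 0; rewrite scaleN1r addr0 l0; lra.
have lle x : l x <= `|x|.
  by apply: le_trans (lm x) _; have := mle 0 x (lexx 0); rewrite scale0r mul0r subr0 addr0.
exists l; split=> // [x|].
  by rewrite ler_norml lle andbT lerNl -lN -(normrN x); exact: lle.
apply/eqP; rewrite eq_le lle/=.
have := lm (- f); rewrite lN.
by have := mle 1 (- f) ler01; rewrite scale1r addNr normr0; lra.
Qed.

Lemma archi_divS_le (R : archiRealFieldType) (x e : R) : 0 < e ->
  exists N : nat, x * N.+1%:R^-1 <= e.
Proof.
move=> e0; exists (Num.trunc (x / e)).
rewrite ler_pdivrMr// [e * _]mulrC -ler_pdivrMr//.
exact/ltW/truncnS_gt.
Qed.

Lemma subr_pivot (V : zmodType) (a x y : V) : x - y = (a - y) - (a - x).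
Proof. by rewrite opprB [RHS]addrC subrKA. Qed.

(** * Extension by density, closed ranges and Neumann series *)

Section density_extension.
Context {R : realType} {A V : normedModType R}.

(** [G v b] reads: the value at [b] is [v]. A relation suffices, since linearity and boundedness
    make it single-valued. *)
Lemma density_extension (G : V -> A -> Prop) (C : R) : 0 <= C ->
  seq_complete V ->
  (forall t v b v' b', G v b -> G v' b' -> G (t *: v + v') (t *: b + b')) ->
  (forall v b, G v b -> `|v| <= C * `|b|) ->
  (forall a e, 0 < e -> exists v b, G v b /\ `|a - b| <= e) ->
  exists U : {linear A -> V}, (forall a, `|U a| <= C * `|a|) /\
    forall v b, G v b -> U b = v.
Proof.
move=> C0 Vc GD GC Gdense.
have GB v b v' b' : G v b -> G v' b' -> `|v - v'| <= C * `|b - b'|.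
  move=> Gvb Gvb'; have := GC _ _ (GD (-1) _ _ _ _ Gvb' Gvb).
  by rewrite !scaleN1r ![- _ + _]addrC.
have G00 : G 0 0.
  have [v [b [Gvb _]]] := Gdense 0 1 ltr01.
  by have := GD (-1) _ _ _ _ Gvb Gvb; rewrite !scaleN1r !addNr.
have limP a : exists l, forall v b, G v b -> `|l - v| <= C * `|a - b|.
  have /choice[vb vbP] : forall n : nat, exists vb : V * A,
      G vb.1 vb.2 /\ `|a - vb.2| <= n.+1%:R^-1.
    by move=> n; have [|v [b vb]] := Gdense a n.+1%:R^-1; [rewrite invr_gt0|exists (v, b)].
  have [|l lP] := Vc (fun n => (vb n).1).
    move=> e e0; have [N NP] := archi_divS_le (2 * C) e0.
    exists N => m n Nm Nn; apply: le_trans (GB _ _ _ _ (vbP m).1 (vbP n).1) _.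
    apply: le_trans NP; rewrite [2 * C]mulrC -mulrA ler_wpM2l//.
    have inv k : (N <= k)%N -> k.+1%:R^-1 <= N.+1%:R^-1 :> R.
      by move=> Nk; rewrite lef_pV2 ?posrE// ler_nat ltnS.
    rewrite (subr_pivot a).
    apply: le_trans (ler_normB _ _) _.
    have h1 := le_trans (vbP n).2 (inv n Nn); have h2 := le_trans (vbP m).2 (inv m Nm).
    by rewrite mulr_natl mulr2n lerD.
  exists l => v b Gvb; apply/ler_addgt0Pl => e e0.
  have e20 : 0 < e / 2 by rewrite divr_gt0.
  have [N NP] := lP _ e20.
  have [M MP] := archi_divS_le C e20.
  pose n := maxn N M.
  have h1 := NP n (leq_maxl N M).
  have h2 := GB _ _ _ _ (vbP n).1 Gvb.
  have h3 : `|(vb n).2 - b| <= `|a - (vb n).2| + `|a - b|.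
    by rewrite (subr_pivot a) [leRHS]addrC; exact: ler_normB.
  have h4 : n.+1%:R^-1 <= M.+1%:R^-1 :> R.
    by rewrite lef_pV2 ?posrE// ler_nat ltnS leq_maxr.
  have h5 := le_trans (ler_wpM2l C0 (le_trans (vbP n).2 h4)) MP.
  have h6 := le_trans h2 (ler_wpM2l C0 h3).
  have h7 : `|l - v| <= `|(vb n).1 - l| + `|(vb n).1 - v|.
    by rewrite -(subrKA (vb n).1) [ `|(vb n).1 - l|]distrC; exact: ler_normD.
  move: h1 h5 h6 h7; rewrite mulrDr.
  by clear; move: (`|(vb n).1 - l|) (C * `|a - (vb n).2|) (`|(vb n).1 - v|) (`|l - v|) => *; lra.
have [U UP] := choice limP.
have UG v b : G v b -> U b = v.
  move=> Gvb; have := UP b _ _ Gvb; rewrite subrr normr0 mulr0 normr_le0 subr_eq0.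
  by move/eqP.
have UC a : `|U a| <= C * `|a|.
  by have := UP a _ _ G00; rewrite !subr0.
have UL : linear U.
  move=> t a a'; apply/eqP; rewrite -subr_eq0 -normr_le0; apply/ler_addgt0Pl => e e0.
  rewrite addr0.
  (* The errors below add up to C (2 |t| + 2) e / K = (K - 1) e / K; the extra 1 keeps K
     positive. *)
  pose K := C * (`|t| + 1 + `|t| + 1) + 1.
  have K0 : 0 < K by rewrite ltr_wpDl// mulr_ge0// !addr_ge0.
  have eK : 0 < e / K by rewrite divr_gt0.
  have [v [b [Gvb ab]]] := Gdense a _ eK.
  have [v' [b' [Gvb' ab']]] := Gdense a' _ eK.
  have h1 := UP (t *: a + a') _ _ (GD t _ _ _ _ Gvb Gvb').
  have h2 := ler_wpM2l (normr_ge0 t) (UP a _ _ Gvb).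
  have h3 := UP a' _ _ Gvb'.
  have h4 : `|t *: a + a' - (t *: b + b')| <= `|t| * (e / K) + e / K.
    rewrite opprD addrACA -scalerBr; apply: le_trans (ler_normD _ _) _.
    by rewrite normrZ lerD// ler_wpM2l.
  have h5 : `|U (t *: a + a') - (t *: U a + U a')| <=
      `|U (t *: a + a') - (t *: v + v')| + (`|t| * `|U a - v| + `|U a' - v'|).
    rewrite -(subrKA (t *: v + v')); apply: le_trans (ler_normD _ _) _.
    rewrite lerD2l distrC opprD addrACA -scalerBr; apply: le_trans (ler_normD _ _) _.
    by rewrite normrZ.
  have h6 := le_trans h1 (ler_wpM2l C0 h4).
  have h7 := le_trans h2 (ler_wpM2l (normr_ge0 t) (ler_wpM2l C0 ab)).
  have h8 := le_trans h3 (ler_wpM2l C0 ab').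
  apply: (le_trans h5); apply: le_trans (lerD h6 (lerD h7 h8)) _.
  have -> : C * (`|t| * (e / K) + e / K) + (`|t| * (C * (e / K)) + C * (e / K)) =
      (K - 1) * (e / K) by rewrite /K; ring.
  apply: (@le_trans _ _ (K * (e / K))).
    by rewrite ler_wpM2r ?(ltW eK)// gerBl.
  by rewrite mulrCA divff ?mulr1// gt_eqF.
have [U' U'E] := mk_linear UL.
by exists U'; split=> [a|v b Gvb]; rewrite U'E; [exact: UC|exact: UG].
Qed.

End density_extension.

Section bounded_operators.
Context {R : realType}.
Implicit Types V W : normedModType R.
Local Notation csub := closed_subspace_normedModType.

Lemma seq_closedP V (A : set V) :
  closed A <-> forall u l, (forall n, A (u n)) -> seq_lim u l -> A l.
Proof.
split=> [cA u l Au ul|sA].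
  by apply: (closed_cvg A cA (u_ := u) (F := \oo)); [exact: nearW|exact/seq_limP].
move=> x clx; have /choice[u uP] : forall n : nat, exists y, A y /\ `|y - x| <= n.+1%:R^-1.
  move=> n; have [|y [Ay xy]] := clx (ball x n.+1%:R^-1).
    by apply: nbhsx_ballx; rewrite invr_gt0.
  exists y; split=> //; move: xy; rewrite -ball_normE /= distrC; exact: ltW.
apply: (sA u) => [n|e e0]; first exact: (uP n).1.
have [N NP] := archi_divS_le 1 e0; exists N => n Nn.
apply: le_trans (uP n).2 (le_trans _ NP); rewrite mul1r.
by rewrite lef_pV2 ?posrE// ler_nat ltnS.
Qed.

Lemma bounded_linear_cont V W (T : {linear V -> W}) C :
  (forall x, `|T x| <= C * `|x|) -> continuous T.
Proof.
move=> TC; apply: bounded_linear_continuous; apply/linear_boundedP.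
near=> r => x; apply: le_trans (TC x) _; rewrite ler_wpM2r//.
Unshelve. all: by end_near. Qed.

Lemma continuous_linear_bound V W (T : {linear V -> W}) : continuous T ->
  exists2 C, 0 < C & forall x, `|T x| <= C * `|x|.
Proof.
by move=> /linear_bounded_continuous/linear_boundedP/pinfty_ex_gt0[C C0 TC]; exists C.
Qed.

Lemma opnorm_le V W (T : {linear V -> W}) C : 0 <= C ->
  (forall x, `|T x| <= C * `|x|) -> (opnorm T <= C%:E)%E.
Proof.
move=> C0 TC; apply: ge_ereal_sup => _ [x /= x1 <-]; rewrite lee_fin.
by apply: le_trans (TC x) _; rewrite -[leRHS]mulr1 ler_wpM2l.
Qed.

Lemma opnorm_ge0 V W (T : {linear V -> W}) : (0 <= opnorm T)%E.
Proof.
by apply: ereal_sup_ubound; exists 0; rewrite /= ?normr0// linear0 normr0.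
Qed.

Lemma seq_cauchy_of_bounds V W (u : nat -> V) (w : nat -> W) (c : R) : 0 < c ->
  (forall m n, c * `|u m - u n| <= `|w m - w n|) -> seq_cauchy w -> seq_cauchy u.
Proof.
move=> c0 h wC e e0; have [N NP] := wC _ (mulr_gt0 c0 e0).
by exists N => m n Nm Nn; rewrite -(ler_pM2l c0); exact: le_trans (h m n) (NP _ _ Nm Nn).
Qed.

Lemma seq_lim_cauchy V (u : nat -> V) l : seq_lim u l -> seq_cauchy u.
Proof.
move=> ul e e0; have e20 : 0 < e / 2 by rewrite divr_gt0.
have [N NP] := ul _ e20; exists N => m n Nm Nn.
rewrite -(subrKA l) [leRHS]splitr; apply: le_trans (ler_normD _ _) _.
by rewrite lerD ?NP// distrC NP.
Qed.

Lemma seq_lim_unique V (u : nat -> V) l l' : seq_lim u l -> seq_lim u l' -> l = l'.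
Proof.
move=> ul ul'; apply/eqP; rewrite -subr_eq0 -normr_le0; apply/ler_addgt0Pl => e e0.
have e20 : 0 < e / 2 by rewrite divr_gt0.
have [N NP] := ul _ e20; have [M MP] := ul' _ e20; pose n := maxn N M.
rewrite addr0 -(subrKA (u n)) [leRHS]splitr; apply: le_trans (ler_normD _ _) _.
by rewrite lerD//; [rewrite distrC NP// leq_maxl|rewrite MP// leq_maxr].
Qed.

Lemma seq_lim_linear V W (T : {linear V -> W}) C (u : nat -> V) l : 0 <= C ->
  (forall x, `|T x| <= C * `|x|) -> seq_lim u l -> seq_lim (fun n => T (u n)) (T l).
Proof.
move=> C0 TC ul e e0; have C1 : 0 < C + 1 by rewrite ltr_wpDl.
have [N NP] := ul _ (divr_gt0 e0 C1); exists N => n Nn.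
rewrite -linearB; apply: le_trans (TC _) _.
apply: (@le_trans _ _ ((C + 1) * (e / (C + 1)))); last first.
  by rewrite mulrCA divff ?mulr1// gt_eqF.
by rewrite ler_pM// ?NP// lerDl.
Qed.

Definition csub_val V (X : closed_subspace V) (x : csub X) : V :=
  val (x : closed_subspace_type X).

Lemma csub_val_linear V (X : closed_subspace V) : linear (@csub_val V X : csub X -> V).
Proof. by move=> c x y; exact: linearP. Qed.

HB.instance Definition _ V (X : closed_subspace V) :=
  GRing.isLinear.Build R (csub X) V *:%R (@csub_val V X : csub X -> V) (@csub_val_linear V X).

Lemma csub_valB V (X : closed_subspace V) (x y : csub X) :
  csub_val (x - y) = csub_val x - csub_val y.
Proof. exact: linearB. Qed.

Lemma csub_val_comb V (X : closed_subspace V) c (x y : csub X) :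
  csub_val (c *: x + y) = c *: csub_val x + csub_val y.
Proof. exact: linearP. Qed.

Lemma csub_val_norm V (X : closed_subspace V) (x : csub X) : `|csub_val x| = `|x|.
Proof. by []. Qed.

Lemma csub_val_inj V (X : closed_subspace V) : injective (@csub_val V X).
Proof. exact: val_inj. Qed.

Lemma csub_valP V (X : closed_subspace V) (x : csub X) : (X : set V) (csub_val x).
Proof. exact: set_mem (valP (x : closed_subspace_type X)). Qed.

Lemma csub_val_surj V (X : closed_subspace V) (v : V) : (X : set V) v ->
  exists x : csub X, csub_val x = v.
Proof.
move=> Xv; have v_in : v \in closed_subspace_pred X by exact: mem_set Xv.
by exists (exist _ v v_in : closed_subspace_type X).
Qed.

Lemma csub_complete V (X : closed_subspace V) : seq_complete V -> seq_complete (csub X).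
Proof.
move=> Vc u uC; have [|l ul] := Vc (fun n => csub_val (u n)).
  by move=> e e0; have [N NP] := uC _ e0; exists N => m n Nm Nn; rewrite -linearB; exact: NP.
have /csub_val_surj[x xl] : (X : set V) l.
  have sX := (seq_closedP (X : set V)).1 (@closed_subspace_isclosed R V X).
  by apply: (sX _ l _ ul) => n; exact: csub_valP.
exists x => e e0; have [N NP] := ul _ e0; exists N => n Nn.
by rewrite -csub_val_norm csub_valB xl; exact: NP.
Qed.

Lemma closed_subspace_of V (A : set V) : A 0 ->
  (forall c x y, A x -> A y -> A (c *: x + y)) ->
  (forall u l, (forall n, A (u n)) -> seq_lim u l -> A l) ->
  exists X : closed_subspace V, (X : set V) = A.
Proof.
move=> A0 Al Ac; have sA : submod_closed [pred x | x \in A].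
  split=> [|c x y]; first exact: mem_set A0.
  by move=> /set_mem Ax /set_mem Ay; exact: mem_set (Al _ _ _ Ax Ay).
by exists (ClosedSubspace sA ((seq_closedP A).2 Ac)).
Qed.

(** Completeness of the domain makes the range closed: preimages of a convergent sequence in the
    range form a Cauchy sequence. *)
Lemma bounded_below_range V W (T : {linear V -> W}) (c C : R) : 0 < c -> 0 <= C ->
  seq_complete V -> (forall x, c * `|x| <= `|T x|) ->
  (forall x, `|T x| <= C * `|x|) ->
  exists (W0 : closed_subspace W) (T' : {linear V -> csub W0}) (S : {linear csub W0 -> V}),
    [/\ (W0 : set W) = range T, forall x, csub_val (T' x) = T x, iso_pair T' S,
      (opnorm T' <= C%:E)%E & (opnorm S <= c^-1%:E)%E].
Proof.
move=> c0 C0 Vc Tc TC.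
have [||| W0 W0E] := @closed_subspace_of W (range T).
- by exists 0 => //; exact: linear0.
- by move=> t _ _ [x _ <-] [y _ <-]; exists (t *: x + y) => //; exact: linearP.
- move=> u l uT ul; have /choice[v vP] : forall n, exists x, T x = u n.
    by move=> n; have [x _ <-] := uT n; exists x.
  have [|x vx] := Vc v.
    apply: (@seq_cauchy_of_bounds _ _ v u c c0 _ (seq_lim_cauchy ul)) => m n.
    by rewrite -!vP -linearB; exact: Tc.
  exists x => //; apply: seq_lim_unique ul.
  have := seq_lim_linear C0 TC vx; congr (seq_lim _ _).
  by apply/funext => n; rewrite vP.
have /choice[t tE] : forall x, exists y : csub W0, csub_val y = T x.
  by move=> x; apply: csub_val_surj; rewrite W0E; exists x.
have /choice[s sE] : forall y : csub W0, exists x, T x = csub_val y.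
  by move=> y; have := csub_valP y; rewrite W0E => -[x _ <-]; exists x.
have Tinj x y : T x = T y -> x = y.
  move=> Txy; apply/eqP; rewrite -subr_eq0 -normr_le0 -(ler_pM2l c0) mulr0.
  by apply: le_trans (Tc _) _; rewrite linearB Txy subrr normr0.
have [|T' T'E] := @mk_linear R V (csub W0) t.
  by move=> a x y; apply: csub_val_inj; rewrite tE linearP -!tE -csub_val_comb.
have [|S SE] := @mk_linear R (csub W0) V s.
  by move=> a x y; apply: Tinj; rewrite linearP !sE csub_val_comb.
have T'C x : `|T' x| <= C * `|x| by rewrite T'E -csub_val_norm tE.
have SC y : `|S y| <= c^-1 * `|y|.
  by rewrite SE ler_pdivlMl// -csub_val_norm -sE; exact: Tc.
exists W0, T', S; split => //.
- by move=> x; rewrite T'E tE.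
- split; [exact: bounded_linear_cont T'C|exact: bounded_linear_cont SC| |].
    by move=> x; rewrite T'E SE; apply: Tinj; rewrite sE tE.
  by move=> y; rewrite SE T'E; apply: csub_val_inj; rewrite tE sE.
- exact: opnorm_le.
- by apply: opnorm_le => //; rewrite invr_ge0 ltW.
Qed.

(** [B] inverts 1 + N: the equation a + N a = b is solved by iterating the contraction a -> b - N a
    from 0. *)
Lemma neumann_inverse V (N : {linear V -> V}) : seq_complete V ->
  (forall x, `|N x| <= 2^-1 * `|x|) ->
  exists B : {linear V -> V}, [/\ forall x, B x + N (B x) = x,
    forall x, B (x + N x) = x & forall x, `|B x| <= 2 * `|x|].
Proof.
move=> Vc NC; pose it (b : V) n := iter n (fun a => b - N a) 0.
have step b n : `|it b n.+1 - it b n| <= (2^-1) ^+ n * `|b|.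
  elim: n => [|n IH]; first by rewrite /it /= linear0 !subr0 expr0 mul1r.
  have -> : it b n.+2 - it b n.+1 = - N (it b n.+1 - it b n).
    have -> : N (it b n.+1 - it b n) = N (it b n.+1) - N (it b n) by exact: linearB.
    transitivity ((b - N (it b n.+1)) - (b - N (it b n))); first by [].
    by rewrite -subr_pivot opprB.
  rewrite normrN exprS -mulrA; apply: le_trans (NC _) _.
  by rewrite ler_wpM2l// invr_ge0.
(* The factor 1 - 2^(-k) is that of a partial geometric sum; without it the induction on k would not
   close. *)
have far b n k : `|it b (n + k)%N - it b n| <= 2 * (2^-1) ^+ n * `|b| * (1 - (2^-1) ^+ k).
  elim: k => [|k IH]; first by rewrite addn0 subrr normr0 expr0 subrr mulr0.
  rewrite addnS -(subrKA (it b (n + k)%N)); apply: le_trans (ler_normD _ _) _.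
  have := step b (n + k)%N; move: IH; rewrite exprD exprS.
  move: (`|it b (n + k).+1 - _|) (`|it b (n + k)%N - _|) => u v.
  have -> : (2^-1 : R) * 2^-1 ^+ k = 2^-1 ^+ k / 2 by rewrite mulrC.
  by clear; lra.
have cau b : seq_cauchy (it b).
  move=> e e0; have q1 : `|2^-1 : R| < 1 by rewrite ger0_norm ?invr_ge0// invf_lt1// ltr1n.
  pose K := 4 * `|b| + 1; have K0 : 0 < K by rewrite ltr_wpDl// mulr_ge0.
  have /cvgrPdist_le/(_ _ (divr_gt0 e0 K0))[M _ MP] := cvg_expr q1.
  have := MP M (leqnn _); rewrite /= sub0r normrN ger0_norm ?exprn_ge0 ?invr_ge0// => hM.
  have far' n : (M <= n)%N -> `|it b n - it b M| <= e / 2.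
    move=> Mn; rewrite -(subnKC Mn); apply: le_trans (far b M _) _.
    have h1 : 0 <= (2^-1 : R) ^+ (n - M) by rewrite exprn_ge0 ?invr_ge0.
    apply: (@le_trans _ _ (2 * (2^-1) ^+ M * `|b|)).
      rewrite -[leRHS]mulr1 ler_wpM2l ?gerBl// !mulr_ge0 ?exprn_ge0 ?invr_ge0//.
    move: hM; rewrite ler_pdivlMr// /K; have := exprn_ge0 M (_ : 0 <= 2^-1 :> R).
    rewrite invr_ge0 ler0n => /(_ isT); clear.
    by move: (2^-1 ^+ M) (`|b|) => u v; nra.
  exists M => m n Mm Mn; rewrite -(subrKA (it b M)) [leRHS]splitr.
  apply: le_trans (ler_normD _ _) _; rewrite lerD ?far'//.
  by rewrite distrC far'.
have N0 : (0 : R) <= 2^-1 by rewrite invr_ge0.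
have Ninj a : a + N a = 0 -> a = 0.
  move=> /eqP; rewrite addr_eq0 => /eqP aN; have := NC a; rewrite -(normrN (N a)) -aN.
  move=> h; apply/eqP; rewrite -normr_le0; move: h (normr_ge0 a); clear.
  by move: (`|a|) => u; lra.
have /choice[B BP] : forall b, exists a, a + N a = b.
  move=> b; have [a aP] := Vc _ (cau b); exists a.
  have lN : seq_lim (fun n => it b n.+1) (b - N a).
    move=> e e0; have [M MP] := seq_lim_linear N0 NC aP e0; exists M => n Mn.
    by rewrite /it /= opprD addrACA subrr add0r opprK -normrN opprD opprK MP.
  have l1 : seq_lim (fun n => it b n.+1) a.
    move=> e e0; have [M MP] := aP _ e0; exists M => n Mn.
    by apply: MP; exact: leqW.
  by rewrite {1}(seq_lim_unique l1 lN) subrK.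
have Buniq a b : a + N a = b -> a = B b.
  move=> ab; apply/eqP; rewrite -subr_eq0; apply/eqP; apply: Ninj.
  by rewrite linearB addrACA -opprD BP ab subrr.
have [|B' B'E] := @mk_linear R V V B.
  move=> t x y; apply/esym; apply: Buniq.
  by rewrite linearP addrACA -scalerDr !BP.
exists B'; split=> [x|x|x]; rewrite B'E; [exact: BP|exact/esym/Buniq|].
have h1 : `|B x| <= `|x| + `|N (B x)|.
  by rewrite -{1}(addrK (N (B x)) (B x)) BP; exact: ler_normB.
have h2 := NC (B x); move: h1 h2; clear.
by move: (`|B x|) (`|x|) (`|N (B x)|) => u v w; lra.
Qed.

End bounded_operators.

Section ellp_summation.
Context (R : realType) (p : R) (p1 : (1 <= p%:E)%E) (I : choiceType).
Local Notation l := (lpsum p1 (fun _ : I => R^o : normedModType R)).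

Let p_ge1 : 1 <= p. Proof. by rewrite -lee_fin. Qed.
Let p_gt0 : 0 < p. Proof. exact: lt_le_trans p_ge1. Qed.

Let comb_widen (V : lmodType R) (x : I -> V) (c : I -> R) (s s' : seq I) :
  uniq s -> uniq s' -> {subset s <= s'} ->
  \sum_(g <- s) c g *: x g = \sum_(g <- s') (if g \in s then c g else 0) *: x g.
Proof.
move=> us us' ss'.
transitivity (\sum_(g <- s') (if g \in s then c g *: x g else 0)); last first.
  by apply: eq_bigr => g _; case: ifP => _ //; rewrite scale0r.
rewrite -big_mkcond -big_filter; apply: perm_big; apply: uniq_perm => //.
  exact: filter_uniq.
by move=> g; rewrite mem_filter; case: (boolP (g \in s)) => //= /ss' ->.
Qed.

(** The upper p-estimate is boundedness on finite combinations of unit vectors, which are dense. *)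
Lemma ellp_summation (V : normedModType R) (x : I -> V) (C : R) : 0 <= C ->
  seq_complete V ->
  (forall (s : seq I) (c : I -> R), uniq s ->
    `|\sum_(g <- s) c g *: x g| `^ p <= C `^ p * \sum_(g <- s) `|c g| `^ p) ->
  exists U : {linear l -> V}, (forall a, `|U a| <= C * `|a|) /\
    forall (s : seq I) (c : I -> R), uniq s ->
      U (\sum_(g <- s) c g *: ellp_basis p1 g) = \sum_(g <- s) c g *: x g.
Proof.
move=> C0 Vc xC.
pose G (v : V) (b : l) := exists (s : seq I) (c : I -> R),
  [/\ uniq s, v = \sum_(g <- s) c g *: x g & b = \sum_(g <- s) c g *: ellp_basis p1 g].
have [|||U [UC UG]] := @density_extension R l V G C C0 Vc.
- move=> t v b v' b' [s [c [us -> ->]]] [s' [c' [us' -> ->]]].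
  pose s2 := undup (s ++ s'); have us2 : uniq s2 by exact: undup_uniq.
  have ss2 : {subset s <= s2} by move=> g gs; rewrite mem_undup mem_cat gs.
  have ss2' : {subset s' <= s2} by move=> g gs; rewrite mem_undup mem_cat gs orbT.
  exists s2, (fun g => t * (if g \in s then c g else 0) + (if g \in s' then c' g else 0)).
  have comb (W : lmodType R) (y : I -> W) :
      t *: (\sum_(g <- s) c g *: y g) + \sum_(g <- s') c' g *: y g =
      \sum_(g <- s2) (t * (if g \in s then c g else 0) +
                      (if g \in s' then c' g else 0)) *: y g.
    rewrite (comb_widen y c us us2 ss2) (comb_widen y c' us' us2 ss2').
    rewrite scaler_sumr -big_split; apply: eq_bigr => g _ /=.
    by rewrite scalerDl scalerA.
  by split=> //; exact: comb.
- move=> v b [s [c [us -> ->]]].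
  apply: (@powR_le_cancel R p) => //; first by rewrite mulr_ge0.
  by rewrite powRM// ellp_comb_norm//; exact: xC.
- move=> a e e0; have [|s us h] := @lpsum_approx _ _ p1 _ _ a (e `^ p).
    exact: powR_gt0.
  exists (\sum_(g <- s) (a g : R) *: x g), (\sum_(g <- s) (a g : R) *: ellp_basis p1 g).
  split; first by exists s, a.
  by rewrite ellp_comb_proj//; apply: (powR_le_cancel p_gt0 _ (ltW e0) h).
exists U; split=> // s c us; apply: UG.
by exists s, c.
Qed.

End ellp_summation.

(** * Uniformly convex spaces *)

Lemma seq_lim_powR (R : realType) (p : R) (V : normedModType R) (u : nat -> V) l :
  0 < p -> seq_lim u l -> (fun n => `|u n| `^ p) @ \oo --> `|l| `^ p.
Proof.
move=> p0 /seq_limP ul.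
have c1 : (fun m => `|u m|) @ \oo --> `|l| by exact: cvg_norm.
have c2 := cvg_comp _ _ c1 (@powR_norm_continuous R p p0 `|l|).
rewrite normr_id in c2; apply: cvg_trans c2.
by apply: near_eq_cvg; apply: nearW => m /=; rewrite normr_id.
Qed.

Section uniform_convexity.
Context (R : realType) (p : R) (V : normedModType R).
Hypotheses (p_gt1 : 1 < p) (Vuc : unif_convex p V) (Vc : seq_complete V).

Let p_gt0 : 0 < p. Proof. exact: lt_trans p_gt1. Qed.

(** Two almost minimal vectors whose midpoint is not much shorter are close, with one [tau] for all
    levels a <= M. *)
Lemma unif_convex_close (M eta : R) : 0 <= M -> 0 < eta ->
  exists2 tau, 0 < tau <= 1 & forall (x y : V) (a : R), a <= M ->
    `|x| `^ p <= a + tau -> `|y| `^ p <= a + tau ->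
    a - tau <= `|2^-1 *: (x + y)| `^ p -> `|x - y| <= eta.
Proof.
move=> M0 eta0; have ep0 : 0 < eta `^ p by exact: powR_gt0.
set E := eta `^ p in ep0.
have M1 : 0 < 4 * (M + 1) by rewrite mulr_gt0// ltr_wpDl.
have [c c0 hc] := Vuc (divr_gt0 ep0 M1).
have c1 : 0 < 4 * (c + 1) by rewrite mulr_gt0// ltr_wpDl.
(* The factor 4 (M + 1) limits the sum of the p-th powers to a contribution of E / 2, and 4 (c + 1)
   does so for the gap. *)
pose tau := Num.min 1 (E / (4 * (c + 1))).
have t0 : 0 < tau by rewrite lt_min ltr01 divr_gt0.
have t1 : tau <= 1 by rewrite ge_min lexx.
have t2 : tau * (4 * (c + 1)) <= E.
  by rewrite -ler_pdivlMr// ge_min lexx orbT.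
exists tau; first by rewrite t0.
move=> x y a aM xa ya za; apply: (powR_le_cancel p_gt0 (normr_ge0 _) (ltW eta0)).
apply: le_trans (hc x y) _; rewrite -/E.
move: xa ya za (powR_ge0 `|x| p) (powR_ge0 `|y| p).
move: (`|x| `^ p) (`|y| `^ p) (`|2^-1 *: (x + y)| `^ p) => X Y Z Xa Ya Za X0 Y0.
have h1 : E / (4 * (M + 1)) * (X + Y) <= E / 2.
  rewrite mulrAC ler_pdivrMr//.
  have h : X + Y <= 2 * (M + 1) by lra.
  by have := ler_wpM2l (ltW ep0) h; lra.
have h2 : c * ((X + Y) / 2 - Z) <= E / 2.
  have h : (X + Y) / 2 - Z <= 2 * tau by lra.
  by have := ler_wpM2l c0 h; lra.
lra.
Qed.

(** [xt] is the shortest vector in the intersection of the closures of the sets in [CC], a downward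
    directed family of midpoint-convex sets: by uniform convexity, vectors of nearly minimal norm in
    small sets form a Cauchy sequence. *)
Lemma unif_convex_minimal (CC : set (set V)) (x0 : V) : CC !=set0 ->
  (forall A, CC A -> A x0) ->
  (forall A x y, CC A -> A x -> A y -> A (2^-1 *: (x + y))) ->
  (forall A B, CC A -> CC B -> exists2 C, CC C & C `<=` A `&` B) ->
  exists xt : V, (forall A e, CC A -> 0 < e -> exists2 y, A y & `|y - xt| <= e) /\
    forall tau, 0 < tau -> exists2 A, CC A & forall y, A y -> `|xt| `^ p - tau <= `|y| `^ p.
Proof.
move=> [A0 CA0] Ax0 Amid Adir.
pose m (A : set V) := inf [set `|y| `^ p | y in A].
have m_le A y : A y -> m A <= `|y| `^ p.
  move=> Ay; apply: ge_inf; last by exists y.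
  by exists 0 => _ [z _ <-]; exact: powR_ge0.
have m_adh A tau : CC A -> 0 < tau -> exists2 y, A y & `|y| `^ p <= m A + tau.
  move=> CA t0; have hA : has_inf [set `|y| `^ p | y in A].
    split; first by exists (`|x0| `^ p), x0 => //; exact: Ax0.
    by exists 0 => _ [z _ <-]; exact: powR_ge0.
  by have [_ [y Ay <-] /ltW h] := inf_adherent t0 hA; exists y.
(* The infima grow as the sets shrink; [x0], common to all sets, bounds them. *)
pose M := sup (m @` CC).
have hM : has_sup (m @` CC).
  split; first by exists (m A0), A0.
  by exists (`|x0| `^ p) => _ [A CA <-]; apply: m_le; exact: Ax0.
have mM A : CC A -> m A <= M.
  by move=> CA; apply: ub_le_sup; [exact: hM.2|exists A].
have M0 : 0 <= M.
  apply: le_trans (mM _ CA0); apply: lb_le_inf.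
    by exists (`|x0| `^ p), x0 => //; exact: Ax0.
  by move=> _ [z _ <-]; exact: powR_ge0.
have near A tau : CC A -> 0 < tau -> exists2 y, A y & `|y| `^ p <= M + tau.
  move=> CA t0; have [y Ay yt] := m_adh _ _ CA t0; exists y => //.
  by apply: le_trans yt _; rewrite lerD2r mM.
have low tau : 0 < tau -> exists2 A, CC A & forall y, A y -> M - tau <= `|y| `^ p.
  move=> t0; have [_ [A CA <-] /ltW h] := sup_adherent t0 hM.
  by exists A => // y Ay; exact: le_trans h (m_le _ _ Ay).
have inv0 n : 0 < n.+1%:R^-1 :> R by rewrite invr_gt0.
have /choice[Ay AyP] : forall n : nat, exists Ay : set V * V,
    [/\ CC Ay.1, forall y, Ay.1 y -> M - n.+1%:R^-1 <= `|y| `^ p, Ay.1 Ay.2 &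
      `|Ay.2| `^ p <= M + n.+1%:R^-1].
  move=> n; have [A CA lA] := low _ (inv0 n).
  by have [y yA yM] := near _ _ CA (inv0 n); exists (A, y).
pose A n := (Ay n).1; pose y n := (Ay n).2.
have close eta : 0 < eta -> exists N, exists2 tau, 0 < tau &
    forall n z, (N <= n)%N -> A n z -> `|z| `^ p <= M + tau -> `|y n - z| <= eta.
  move=> eta0; have [tau /andP[t0 t1] ht] := unif_convex_close M0 eta0.
  have [N NP] := archi_divS_le 1 t0; rewrite mul1r in NP.
  exists N, tau => // n z Nn Az zM; have [CA lA yA yM] := AyP n.
  have nt : n.+1%:R^-1 <= tau.
    by apply: le_trans NP; rewrite lef_pV2 ?posrE// ler_nat ltnS.
  apply: (ht (y n) z M (lexx M)) => //.
    by apply: le_trans yM _; rewrite lerD2l.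
  apply: (@le_trans _ _ (M - n.+1%:R^-1)); first by rewrite lerD2l lerN2.
  by apply: lA; exact: Amid.
have [|xt yxt] := Vc (u := y).
  move=> e e0; have e20 : 0 < e / 2 by rewrite divr_gt0.
  have [N [tau t0 hN]] := close _ e20; exists N => i j Ni Nj.
  have [CAi _ _ _] := AyP i; have [CAj _ _ _] := AyP j.
  have [C CC' CAB] := Adir _ _ CAi CAj; have [z Cz zM] := near _ _ CC' t0.
  have [zi zj] := CAB _ Cz.
  rewrite -(subrKA z) [leRHS]splitr; apply: le_trans (ler_normD _ _) _.
  by rewrite lerD ?(hN i)// distrC (hN j).
have xtM : `|xt| `^ p <= M.
  apply/ler_addgt0Pl => e e0; have [N NP] := archi_divS_le 1 e0; rewrite mul1r in NP.
  apply: (cvg_real_le (seq_lim_powR p_gt0 yxt) (N := N)) => n Nn.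
  have [_ _ _ yM] := AyP n; apply: le_trans yM _; rewrite addrC lerD2r.
  by apply: le_trans NP; rewrite lef_pV2 ?posrE// ler_nat ltnS.
exists xt; split=> [B e CB e0|tau t0].
  have e20 : 0 < e / 2 by rewrite divr_gt0.
  have [N [tau t0 hN]] := close _ e20; have [N' NP'] := yxt _ e20.
  pose n := maxn N N'; have [CAn _ _ _] := AyP n.
  have [C CC' CAB] := Adir _ _ CB CAn; have [z Cz zM] := near _ _ CC' t0.
  have [zB zA] := CAB _ Cz; exists z => //.
  rewrite -(subrKA (y n)) [leRHS]splitr; apply: le_trans (ler_normD _ _) _.
  rewrite lerD//; last by apply: NP'; exact: leq_maxr.
  by rewrite distrC; apply: hN => //; exact: leq_maxl.
have [B CB lB] := low _ t0; exists B => // z Bz; apply: le_trans (lB z Bz).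
by rewrite lerD2r.
Qed.

(* Let vt be the element of least norm in v + N, N the common kernel of the Phi k.
   By uniform convexity, vt is determined up to eta by finitely many of the Phi k
   and a bound on its norm; there are only |K| such data, so two elements v, v' of D share
   them, and z = (v - vt) - (v' - vt') works. *)
Lemma separated_pair (K : Type) (K0 : eqType) (Phi : K0 -> V -> R) (D : set V)
    (eta : R) :
  infinite_set [set: K] -> inj_into K0 K ->
  (forall k c x y, Phi k (c *: x + y) = c * Phi k x + Phi k y) ->
  (forall k x, `|Phi k x| <= `|x|) ->
  (forall v, D v -> `|v| <= 1) ->
  ~ inj_into {v | D v} K -> 0 < eta ->
  exists v v' z, [/\ D v, D v', v <> v', (forall k, Phi k z = 0) &
    `|v - v' - z| <= eta].
Proof.
move=> Kinf K0K PhiL PhiB D1 nD eta0.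
have Phi0 k : Phi k 0 = 0 by have := PhiL k 1 0 0; rewrite scale1r addr0; lra.
have PhiZ k c x : Phi k (c *: x) = c * Phi k x.
  by have := PhiL k c x 0; rewrite addr0 Phi0 addr0.
have PhiD k x y : Phi k (x + y) = Phi k x + Phi k y.
  by have := PhiL k 1 x y; rewrite scale1r mul1r.
have PhiBB k x y : Phi k (x - y) = Phi k x - Phi k y.
  by rewrite PhiD -scaleN1r PhiZ mulN1r.
(* A weak neighbourhood of [v]: the pair (k, n) imposes the tolerance 1 / (n + 1) on [Phi k]. *)
pose AA (v : V) (s : seq (K0 * nat)) : set V :=
  [set x | forall kn, kn \in s -> `|Phi kn.1 x - Phi kn.1 v| <= kn.2.+1%:R^-1].
have [tau /andP[t0 _] ht] := unif_convex_close ler01 eta0.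
have ex (v : {v | D v}) : exists xs : V * seq (K0 * nat),
    [/\ forall k, Phi k xs.1 = Phi k (sval v), `|xs.1| `^ p <= 1 &
      forall y, AA (sval v) xs.2 y -> `|xs.1| `^ p - tau / 2 <= `|y| `^ p].
  case: v => v Dv /=.
  have [||||xt [xt1 xt2]] := @unif_convex_minimal (range (AA v)) v.
  - by exists (AA v [::]), [::].
  - by move=> _ [s _ <-] kn _; rewrite subrr normr0 invr_ge0.
  - move=> _ x y [s _ <-] Ax Ay kn kns; rewrite PhiZ PhiD.
    have := Ax _ kns; have := Ay _ kns; rewrite !ler_norml; clear.
    move: (Phi kn.1 x) (Phi kn.1 y) (Phi kn.1 v) (kn.2.+1%:R^-1) => a b c d.
    by move=> /andP[h1 h2] /andP[h3 h4]; apply/andP; split; lra.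
  - move=> _ _ [s _ <-] [s' _ <-]; exists (AA v (s ++ s')); first by exists (s ++ s').
    by move=> x h; split=> kn kns; apply: h; rewrite mem_cat kns ?orbT.
  have t20 : 0 < tau / 2 by rewrite divr_gt0.
  have [_ [s _ <-] hs] := xt2 _ t20; exists (xt, s); split=> //=.
    move=> k; apply/eqP; rewrite -subr_eq0 -normr_le0; apply/ler_addgt0Pl => e e0.
    rewrite addr0; have e20 : 0 < e / 2 by rewrite divr_gt0.
    have [n nP] := archi_divS_le 1 e20; rewrite mul1r in nP.
    have [|y /(_ (k, n) (mem_head _ _)) /= h1 h2] := xt1 (AA v [:: (k, n)]) _ _ e20.
      by exists [:: (k, n)].
    rewrite -(subrKA (Phi k y)) [leRHS]splitr; apply: le_trans (ler_normD _ _) _.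
    rewrite lerD//; last exact: le_trans h1 nP.
    by rewrite -PhiBB; apply: le_trans (PhiB _ _) _; rewrite distrC.
  apply/ler_addgt0Pl => e e0; have [_ [s' _ <-] hs'] := xt2 _ e0.
  rewrite addrC -lerBlDr; apply: le_trans (hs' v _) _.
    by move=> kn _; rewrite subrr normr0 invr_ge0.
  have := D1 _ Dv => /(ge0_ler_powR (ltW p_gt0)); rewrite !nnegrE => /(_ _ _).
  by rewrite powR1; apply.
have [xs xsP] := choice ex.
pose fl (x : R) : int := Num.floor x.
have flP (x y : R) : fl x = fl y -> `|x - y| <= 1.
  move=> fxy; have := floor_itv x; have := floor_itv y.
  rewrite -/(fl x) -/(fl y) fxy intrD1 => /andP[h1 h2] /andP[h3 h4].
  by rewrite ler_norml; apply/andP; split; lra.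
(* Rounding: equal codes give equal lists of conditions, values of each listed [Phi k] that differ
   by at most its tolerance, and p-th powers of norms that differ by at most tau / 2. *)
pose code (v : {v | D v}) :=
  ([seq (kn, fl (kn.2.+1%:R * Phi kn.1 (sval v))) | kn <- (xs v).2],
   fl (`|(xs v).1| `^ p / (tau / 2))).
have [v [v' [vv' cvv']]] : exists v v', v <> v' /\ code v = code v'.
  apply: contrapT => nex; apply: nD.
  have cK : inj_into (seq (K0 * nat * int) * int) K.
    apply: inj_into_prod => //; last exact: inj_into_countable.
    apply: inj_into_seqW => //; apply: inj_into_prod => //; last exact: inj_into_countable.
    by apply: inj_into_prod => //; exact: inj_into_countable.
  apply: inj_into_trans cK; exists code => v v' cv; apply: contrapT => nvv.
  by apply: nex; exists v, v'.
case: cvv' => cs cn.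
have [e1 b1 l1] := xsP v; have [e2 b2 l2] := xsP v'.
have ss : (xs v).2 = (xs v').2.
  by have := congr1 (map fst) cs; rewrite -!map_comp !map_id_in.
exists (sval v), (sval v'), ((sval v - (xs v).1) - (sval v' - (xs v').1)); split.
- exact: svalP.
- exact: svalP.
- by move=> h; apply: vv'; exact: proj1_sig_inj.
- by move=> k; rewrite !PhiBB e1 e2 !subrr.
have -> : sval v - sval v' - (sval v - (xs v).1 - (sval v' - (xs v').1)) =
    (xs v).1 - (xs v').1.
  have -> : sval v - (xs v).1 - (sval v' - (xs v').1) =
      (sval v - sval v') - ((xs v).1 - (xs v').1).
    by rewrite !opprD !opprK addrACA.
  exact: subKr.
have t20 : 0 < tau / 2 by rewrite divr_gt0.
have hn : `| `|(xs v).1| `^ p - `|(xs v').1| `^ p| <= tau / 2.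
  have := flP _ _ cn; rewrite -mulrBl normrM normfV [ `|tau / 2|]ger0_norm ?(ltW t20)//.
  by rewrite ler_pdivrMr// mul1r.
(* The midpoint meets the conditions of [v], because its value under [Phi k] is the mean of those at
   [v] and [v']; it is therefore not much shorter. *)
have zl := l1 (2^-1 *: ((xs v).1 + (xs v').1)).
have {}zl : `|(xs v).1| `^ p - tau / 2 <= `|2^-1 *: ((xs v).1 + (xs v').1)| `^ p.
  apply: zl => kn kns; rewrite PhiZ PhiD e1 e2.
  have : fl (kn.2.+1%:R * Phi kn.1 (sval v)) = fl (kn.2.+1%:R * Phi kn.1 (sval v')).
    move: cs; rewrite -ss => /eq_in_map /(_ kn kns) [] //.
  move=> /flP; rewrite -mulrBr normrM [ `|_%:R|]ger0_norm// => h.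
  have n0 : 0 < kn.2.+1%:R :> R by [].
  have {}h : `|Phi kn.1 (sval v) - Phi kn.1 (sval v')| <= kn.2.+1%:R^-1.
    by rewrite -[leRHS]mulr1 ler_pdivlMl.
  rewrite -[X in _ <= X]mul1r.
  have -> : 2^-1 * (Phi kn.1 (sval v) + Phi kn.1 (sval v')) - Phi kn.1 (sval v) =
    - 2^-1 * (Phi kn.1 (sval v) - Phi kn.1 (sval v')) by lra.
  have h2 : `|2^-1 : R| <= 1 by rewrite ger0_norm ?invr_ge0// invf_le1// ler1n.
  by rewrite normrM normrN; exact: ler_pM.
move: hn; rewrite ler_norml => /andP[hn1 hn2].
apply: (ht _ _ (`|(xs v).1| `^ p)) => //.
- by rewrite lerDl ltW.
- rewrite addrC -lerBlDr; move: hn1; rewrite lerNl opprB => h.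
  by apply: le_trans h _; rewrite ler_pdivrMr// ler_peMr ?(ltW t0)// ler1n.
- by apply: le_trans zl; rewrite lerD2l lerN2 ler_pdivrMr// ler_peMr ?(ltW t0)// ler1n.
Qed.

End uniform_convexity.

(** * L_p(nu) inside an l_p-sum over finite measures *)

Section exhaustion.
Context d (T : measurableType d) (R : realType).
Variable mu : {measure set T -> \bar R}.
Local Open Scope ereal_scope.

(** Zorn's lemma. The clause [A <> E] keeps a set from being tested against itself, since a set of
    positive measure is not almost disjoint from itself. *)
Lemma maximal_almost_disjoint : exists F : set (set T),
  [/\ forall A, F A -> measurable A /\ mu A < +oo,
      forall A B, F A -> F B -> A <> B -> mu (A `&` B) = 0
    & forall E, measurable E -> mu E < +oo ->
        (forall A, F A -> A <> E -> mu (A `&` E) = 0) -> F E].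
Proof.
pose P := [set F : set (set T) |
  (forall A, F A -> measurable A /\ mu A < +oo) /\
  (forall A B, F A -> F B -> A <> B -> mu (A `&` B) = 0)].
have [F FP Ftot|F [[F1 F2] Fmax]] := @Zorn_bigcup (set T) P.
  split=> [A [X FX XA]|A B [X FX XA] [Y FY YB] AB]; first exact: (FP X FX).1.
  by have [XY|YX] := Ftot X Y FX FY;
    [apply: (FP Y FY).2 => //; exact: XY|apply: (FP X FX).2 => //; exact: YX].
exists F; split=> // E mE Eoo FE; apply: contrapT => nFE.
apply: (Fmax (F `|` [set E])).
  split; first by move=> ?; left.
  by move=> /(_ E) h; apply: nFE; apply: h; right.
split=> [A [/F1//|->//]|A B [FA|->] [FB|->] AB //]; first exact: F2.
  exact: FE.
by rewrite setIC; apply: FE => // BE; exact: AB.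
Qed.

Lemma integral_bigsetU_almost_disjoint (I : eqType) (A : I -> set T) (g : T -> R)
    (s : seq I) : (forall i, measurable (A i)) ->
  (forall i j, i != j -> mu (A i `&` A j) = 0) ->
  measurable_fun setT g -> (forall x, 0 <= g x)%R -> uniq s ->
  \sum_(i <- s) \int[mu]_(x in A i) (g x)%:E =
  \int[mu]_(x in \big[setU/set0]_(i <- s) A i) (g x)%:E.
Proof.
move=> mA A0 mg g0.
have mgE D : measurable_fun D (EFin \o g).
  by apply/measurable_EFinP; exact: measurable_funTS.
have mU r : measurable (\big[setU/set0]_(i <- r) A i).
  by elim/big_ind: _ => //; exact: measurableU.
elim: s => [|i s ih]; first by rewrite !big_nil integral_set0.
rewrite !big_cons => /andP[nis us]; rewrite ih//; set U := \big[_/_]_(_ <- _) _.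
have AU0 : mu (A i `&` U) = 0.
  rewrite /U; elim: s nis {us ih U} => [|j s ih].
    by rewrite big_nil setI0 measure0.
  rewrite inE negb_or big_cons setIUr => /andP[ij nis].
  by rewrite measureU0 ?A0 ?ih//; exact: measurableI.
have -> : A i `|` U = (A i `\` U) `|` U.
  apply/seteqP; split=> x /=; last by move=> [[]|]; [left|right].
  by have [Ux|nUx] := pselect (U x); [right|move=> [Ax|//]; left].
have splitU B C : measurable B -> measurable C -> (forall x, B x -> ~ C x) ->
    \int[mu]_(x in B `|` C) (g x)%:E =
    \int[mu]_(x in B) (g x)%:E + \int[mu]_(x in C) (g x)%:E.
  move=> mB mC BC; apply: ge0_integral_setU => //.
    by move=> x _; rewrite lee_fin.
  by apply/disj_setPS => x [/BC].
have mAU : measurable (A i `\` U) by apply: measurableD => //; exact: mU.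
rewrite (splitU _ _ mAU (mU s)); last by move=> x [].
congr (_ + _); have e : A i = (A i `\` U) `|` (A i `&` U).
  apply/seteqP; split=> x /=; last by move=> [[]|[]].
  by have [Ux|nUx] := pselect (U x) => Ax; [right|left].
have mAI : measurable (A i `&` U) by apply: measurableI => //; exact: mU.
rewrite [in LHS]e (splitU _ _ mAU mAI); last by move=> x [_ nU] [_ /nU].
rewrite [X in _ + X](_ : _ = 0) ?adde0//.
exact: null_set_integral.
Qed.

(** A form of Chebyshev's inequality, [c] being the inverse of a level that g reaches on [D]. *)
Lemma measure_le_integral (D : set T) (g : T -> R) (c : R) : measurable D ->
  measurable_fun setT g -> (forall x, 0 <= g x)%R -> (0 <= c)%R ->
  (forall x, D x -> 1 <= c * g x)%R -> mu D <= c%:E * \int[mu]_(x in D) (g x)%:E.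
Proof.
move=> mD mg g0 c0 cg.
have mgE : measurable_fun D (EFin \o g).
  by apply/measurable_EFinP; exact: measurable_funTS.
rewrite -ge0_integralZl_EFin//; last by move=> x _; rewrite lee_fin.
rewrite -[leLHS]mul1e -integral_cst//; apply: ge0_le_integral => //.
exact: measurable_funeM.
Qed.

(** The union U of the sets with index in [S] carries the whole integral. Outside U, a level set of
    g has finite measure and meets each [A i] in a null set, so maximality puts it into [F]; being
    one of the [A i], it is null itself. *)
Lemma integral_maximal_almost_disjoint (F : set (set T)) (I : choiceType)
    (A : I -> set T) (S : set I) (g : T -> R) (C : \bar R) :
  (forall B, F B <-> exists i, A i = B) ->
  (forall i, measurable (A i)) -> 
  (forall E, measurable E -> mu E < +oo ->
        (forall A, F A -> A <> E -> mu (A `&` E) = 0) -> F E) ->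
  measurable_fun setT g -> (forall x, 0 <= g x)%R ->
  \int[mu]_x (g x)%:E < +oo ->
  countable S -> (forall i, ~ S i -> \int[mu]_(x in A i) (g x)%:E = 0) ->
  (forall s, uniq s -> 
     \int[mu]_(x in \big[setU/set0]_(i <- s) A i) (g x)%:E <= C) ->
  \int[mu]_x (g x)%:E <= C.
Proof.
move=> FA mA Fmax mg g0 goo /countable_injP[f finj] S0 sC.
have mgE D : measurable_fun D (EFin \o g).
  by apply/measurable_EFinP; exact: measurable_funTS.
(* Partial inverse of the enumeration [f] of [S], with [None] off its range; its initial values list
   increasing finite subfamilies. *)
pose e n : option I := if pselect (exists i, S i /\ f i = n) is left h
  then Some (sval (cid h)) else None.
have eK n i : e n = Some i -> S i /\ f i = n.
  by rewrite /e; case: pselect => // h [<-]; case: cid.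
have eS i : S i -> e (f i) = Some i.
  move=> Si; rewrite /e; case: pselect => [h|]; last by case; exists i.
  by case: cid => j [Sj fji]; congr Some; apply: finj; rewrite ?inE.
pose s n := pmap e (iota 0 n).
have us n : uniq (s n).
  apply: (@pmap_uniq _ _ _ f); last exact: iota_uniq.
  move=> k; rewrite /oapp; case ek: (e k) => [i|//].
  by have [_ /= ->] := eK _ _ ek.
pose B n := \big[setU/set0]_(i <- s n) A i.
have BP n x : B n x <-> exists i, [/\ S i, (f i < n)%N & A i x].
  rewrite /B -bigcup_seq /bigcup /=; split.
    move=> [i]; rewrite mem_pmap => /mapP[k]; rewrite mem_iota/= add0n => kn.
    by move=> /esym/eK[Si fi] Aix; exists i; split=> //; rewrite fi.
  move=> [i [Si fin Aix]]; exists i => //; rewrite mem_pmap; apply/mapP.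
  by exists (f i); [rewrite mem_iota|rewrite eS].
have mB n : measurable (B n).
  by rewrite /B; elim/big_ind: _ => // ? ? ? ?; exact: measurableU.
set U := \bigcup_n B n.
have mU : measurable U by exact: bigcupT_measurable.
have AU i : S i -> A i `<=` U.
  by move=> Si x Aix; exists (f i).+1 => //; apply/BP; exists i.
have UC : \int[mu]_(x in U) (g x)%:E <= C.
  have BU : \int[mu]_(x in B n) (g x)%:E @[n --> \oo] --> \int[mu]_(x in U) (g x)%:E.
    apply: ge0_nondecreasing_set_cvg_integral => //.
    - move=> m n mn; apply/subsetPset => x /BP[i [Si fi Aix]].
      by apply/BP; exists i; split=> //; exact: leq_trans mn.
    - by move=> i x _; rewrite lee_fin.
  rewrite -(cvg_lim _ BU)//; apply: lime_le; first by apply/cvg_ex; eexists; exact: BU.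
  by apply: nearW => n; exact: sC.
have mE n : measurable (~` U `&` [set x | n.+1%:R^-1 <= g x]%R).
  apply: measurableI; first exact: measurableC.
  by rewrite -[X in measurable X]setTI; exact: measurable_fun_le.
have E0 n : mu (~` U `&` [set x | n.+1%:R^-1 <= g x]%R) = 0.
  set E := _ `&` _; have mEn : measurable E by exact: mE.
  have lev D : measurable D -> D `<=` E ->
      mu D <= n.+1%:R%:E * \int[mu]_(x in D) (g x)%:E.
    move=> mD DE; apply: measure_le_integral => // x /DE[_ /= ngx].
    by rewrite -ler_pdivrMl ?mulr1.
  have lev0 D : measurable D -> D `<=` E -> \int[mu]_(x in D) (g x)%:E = 0 ->
      mu D = 0.
    move=> mD DE D0; apply/eqP; rewrite eq_le measure_ge0 andbT.
    by have := lev _ mD DE; rewrite D0 mule0.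
  have levA i : ~ S i -> mu (A i `&` E) = 0.
    move=> nSi; apply: lev0; [by apply: measurableI|by move=> x []|].
    apply/eqP; rewrite eq_le integral_ge0 ?andbT; last by move=> x _; rewrite lee_fin.
    rewrite -(S0 i nSi); apply: ge0_subset_integral => //; first exact: measurableI.
      by move=> x _; rewrite lee_fin.
  have AE i : S i -> A i `&` E = set0.
    by move=> /AU AiU; rewrite -subset0 => x [/AiU Ux [nUx _]].
  have /FA[i Ei] : F E.
    apply: Fmax => //.
      apply: le_lt_trans (lev E mEn (@subset_refl _ _)) _.
      apply: lte_mul_pinfty; rewrite ?lee_fin//.
      apply: le_lt_trans goo; apply: ge0_subset_integral => //.
      by move=> x _; rewrite lee_fin.
    move=> _ /FA[i <-] _; have [/AE->|/levA//] := pselect (S i).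
    by rewrite measure0.
  have [/AE|/levA] := pselect (S i); rewrite Ei setIid// => ->.
  by rewrite measure0.
have -> : \int[mu]_x (g x)%:E = \int[mu]_(x in U) (g x)%:E.
  rewrite -(setUv U) ge0_integral_setU//; last 3 first.
  - exact: measurableC.
  - by move=> x _; rewrite lee_fin.
  - exact/disj_setPCl.
  rewrite [X in _ + X](_ : _ = 0) ?adde0//.
  rewrite (@ge0_ae_eq_integral _ _ _ _ _ _ (cst 0)) ?integral0//.
  - exact: measurableC.
  - by move=> x _; rewrite lee_fin.
  apply: negligibleS (negligible_bigcup (fun n => (negligibleP _ (mE n)).2 (E0 n))).
  move=> x /= /not_implyP[nUx gx0].
  have gx : (0 < g x)%R.
    rewrite lt_neqAle g0 andbT; apply/eqP => gx; apply: gx0.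
    by rewrite -gx.
  have [n] := archi_divS_le 1 gx; rewrite mul1r => nx.
  by exists n.
by [].
Qed.

End exhaustion.

Section Lspace_lpsum.
Context (R : realType) (p : R) (p1 : (1 <= p%:E)%E).
Context d (T : measurableType d) (nu : {measure set T -> \bar R}).

Lemma negligible_mfrestr (A : set T) (mA : measurable A) (Aoo : (nu A < +oo)%E)
    (N : set T) : nu.-negligible N -> (mfrestr mA Aoo).-negligible N.
Proof.
move=> [B [mB B0 NB]]; exists B; split => //.
rewrite /= /mfrestr /mrestr; apply/eqP; rewrite eq_le measure_ge0 andbT -B0.
by apply: le_measure; rewrite ?inE//; exact: measurableI.
Qed.

(** Equalities almost everywhere for [nu] remain so for [m], so representatives may be compared
    there. *)
Lemma Lspace_comb_dominated (m : {measure set T -> \bar R}) a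
    (f g : LspaceType nu p1) (hf hg h : LspaceType m p1) :
  (forall N, nu.-negligible N -> m.-negligible N) ->
  (hf : T -> R) = f %[ae m] -> (hg : T -> R) = g %[ae m] ->
  (h : T -> R) = (a *: f + g : LspaceType nu p1) %[ae m] -> h = a *: hf + hg.
Proof.
move=> num ef eg eh; apply: Lspace_ext.
have e1 : ((a *: f + g : LspaceType nu p1) : T -> R) =
    (fun x => a * f x + 1 * g x) %[ae m].
  by apply: num; have := Lspace_comb_ae a 1 f g; rewrite scale1r.
have e2 : ((a *: hf + hg : LspaceType m p1) : T -> R) =
    (fun x => a * hf x + 1 * hg x) %[ae m].
  by have := Lspace_comb_ae a 1 hf hg; rewrite scale1r.
have e3 : (h : T -> R) = (fun x => a * f x + 1 * g x) %[ae m].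
  by move: eh e1; apply: filterS2 => x /= h1 h2 xT; rewrite h1// h2.
have e4 : ((a *: hf + hg : LspaceType m p1) : T -> R) =
    (fun x => a * f x + 1 * g x) %[ae m].
  by move: ef eg e2; apply: filterS3 => x /= h1 h2 h3 xT; rewrite h3// h1// h2.
by move: e3 e4; apply: filterS2 => x /= h1 h2 xT; rewrite h1// h2.
Qed.

(** The coordinate at A is the class of f for [nu] restricted to A. Almost disjointness bounds the
    norm of the image by |f|; equality comes from maximality, applied to the countably many
    coordinates that do not vanish. *)
Lemma Lspace_lpsum_isometry : exists (I : choiceType)
    (mu : I -> {finite_measure set T -> \bar R})
    (J : {linear LspaceType nu p1 ->
       lpsum p1 (fun i => LspaceType (mu i) p1 : normedModType R)}),
  forall f, `|J f| = `|f|.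
Proof.
have [F [F1 F2 Fmax]] := maximal_almost_disjoint nu.
pose I : choiceType := {classic {A | F A}}.
pose A (i : I) : set T := sval (i : {A | F A}).
have mA i : measurable (A i) by exact: (F1 _ (svalP (i : {A | F A}))).1.
have Aoo i : (nu (A i) < +oo)%E by exact: (F1 _ (svalP (i : {A | F A}))).2.
pose mu (i : I) : {finite_measure set T -> \bar R} := mfrestr (mA i) (Aoo i).
have A0 (i j : I) : i != j -> nu (A i `&` A j) = 0%E.
  move=> /eqP ij; apply: F2; [exact: svalP (i : {A | F A})|
    exact: svalP (j : {A | F A})|].
  move=> Aij; apply: ij; case: i j Aij => [B FB] [C FC] /= BC.
  by case: _ / BC in FC *; congr exist; exact: Prop_irrelevance.
have mpow (f : LspaceType nu p1) : measurable_fun setT (fun x => `|f x| `^ p).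
  by apply: measurable_powR_norm; exact: Lspace_measurable.
have pow0 (f : LspaceType nu p1) x : 0 <= `|f x| `^ p by exact: powR_ge0.
have foo (f : LspaceType nu p1) : (\int[nu]_x (`|f x| `^ p)%:E < +oo)%E.
  by have e := Lspace_powR f; rewrite -e ltry.
have intA (f : LspaceType nu p1) i :
    (\int[mu i]_x (`|f x| `^ p)%:E = \int[nu]_(x in A i) (`|f x| `^ p)%:E)%E.
  exact: integral_mfrestr.
have subA (f : LspaceType nu p1) B : measurable B ->
    (\int[nu]_(x in B) (`|f x| `^ p)%:E <= \int[nu]_x (`|f x| `^ p)%:E)%E.
  move=> mB; apply: ge0_subset_integral => //; first exact/measurable_EFinP.
have ex (fi : LspaceType nu p1 * I) : exists h : LspaceType (mu fi.2) p1,
    (h : T -> R) = fi.1 %[ae mu fi.2].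
  apply: Lspace_of; first exact: Lspace_measurable.
  by rewrite intA; apply: le_lt_trans (subA _ _ (mA _)) (foo _).
pose j (f : LspaceType nu p1) i := sval (cid (ex (f, i))).
have jE f i : (j f i : T -> R) = f %[ae mu i] by exact: svalP (cid (ex (f, i))).
have jN f i : ((`|j f i| `^ p)%:E = \int[nu]_(x in A i) (`|f x| `^ p)%:E)%E.
  rewrite -intA; apply: Lspace_powR_ae; first exact: Lspace_measurable.
  exact: jE.
have mU (s : seq I) : measurable (\big[setU/set0]_(i <- s) A i).
  by elim/big_ind: _ => //; exact: measurableU.
have jsum f s : uniq s -> (\sum_(i <- s) (`|j f i| `^ p)%:E =
    \int[nu]_(x in \big[setU/set0]_(i <- s) A i) (`|f x| `^ p)%:E)%E.
  move=> us; rewrite -integral_bigsetU_almost_disjoint//.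
  by apply: eq_bigr => i _; exact: jN.
have ex2 f : exists x : lpsum p1 (fun i => LspaceType (mu i) p1 : normedModType R),
    (forall i, x i = j f i) /\ `|x| `^ p <= `|f| `^ p.
  have [s us|x xE xN] := @lpsum_of R p p1 I
    (fun i => LspaceType (mu i) p1 : normedModType R) (j f) (`|f| `^ p).
    rewrite -lee_fin -sumEFin jsum//; have e := Lspace_powR f; rewrite e.
    exact: subA.
  by exists x.
pose J0 f := sval (cid (ex2 f)).
have J0E f i : J0 f i = j f i by exact: (svalP (cid (ex2 f))).1.
have J0N f : `|J0 f| `^ p <= `|f| `^ p by exact: (svalP (cid (ex2 f))).2.
have J0lin : linear J0.
  move=> a f g; apply: lpsum_ext => i; rewrite lpsumD lpsumZ !J0E.
  apply: (Lspace_comb_dominated (a := a) (f := f) (g := g)); try exact: jE.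
  exact: negligible_mfrestr.
have [J JE] := mk_linear J0lin.
exists I, mu, J => f; rewrite JE.
have p0 : 0 < p by apply: lt_le_trans (_ : 1 <= p); rewrite // -lee_fin.
apply: (@powR_eq_cancel _ p) => //; apply/eqP; rewrite eq_le J0N/=.
rewrite -lee_fin; have e := Lspace_powR f; rewrite e.
apply: (@integral_maximal_almost_disjoint _ _ _ nu F I A (lsupp (J0 f))) => //.
- move=> B; split=> [FB|[i <-]]; first by exists (exist _ B FB).
  exact: svalP (i : {A | F A}).
- exact: lsupp_countable.
- move=> i; rewrite /lsupp /= => /negP; rewrite negbK => /eqP i0.
  have ji := jN f i; rewrite -ji -J0E i0 normr0 powR0//.
  by rewrite gt_eqF.
- move=> s us; rewrite -jsum// sumEFin lee_fin.
  have -> : \sum_(i <- s) `|j f i| `^ p = \sum_(i <- s) `|J0 f i| `^ p.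
    by apply: eq_bigr => i _; rewrite J0E.
  exact: lpsum_powR_sum.
Qed.

End Lspace_lpsum.

(** * Large l_p spaces do not embed into small l_p-sums *)

(** Otherwise every fibre would be finite and [Gamma] would inject into the product of [Q] and
    [nat]. *)
Lemma infinite_fibre (Gamma Q K : Type) (c : Gamma -> Q) :
  infinite_set [set: K] -> inj_into Q K -> ~ inj_into Gamma K ->
  exists q, infinite_set [set g | c g = q].
Proof.
move=> Koo QK GK; apply: contrapT => noq; apply: GK.
have fin q : finite_set [set g | c g = q].
  by apply: contrapT => qoo; apply: noq; exists q.
have ex q : exists f : Gamma -> nat, {in [set g | c g = q] &, injective f}.
  exact/countable_injP/finite_set_countable.
pose f q := sval (cid (ex q)).
have fP q : {in [set g | c g = q] &, injective (f q)} by exact: svalP (cid (ex q)).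
apply: inj_into_trans (inj_into_prod Koo QK (inj_into_countable nat Koo)).
exists (fun g => (c g, f (c g) g)) => g h /= -[cgh]; rewrite cgh.
by apply: (fP (c h)); rewrite inE.
Qed.

Lemma ler_sum2 (R : realDomainType) (I : Type) (F : seq I) (r : R) (a b u v : I -> R) :
  (forall i, a i + b i <= r * u i + r * v i) ->
  \sum_(i <- F) a i + \sum_(i <- F) b i <=
  r * \sum_(i <- F) u i + r * \sum_(i <- F) v i.
Proof.
by move=> h; rewrite !mulr_sumr -!big_split/=; apply: ler_sum => i _; exact: h.
Qed.

Lemma ler_sum_comb (R : realDomainType) (I : Type) (F : seq I) (r : R) (a u v : I -> R) :
  (forall i, a i <= r * u i + v i) ->
  \sum_(i <- F) a i <= r * \sum_(i <- F) u i + \sum_(i <- F) v i.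
Proof.
by move=> h; rewrite mulr_sumr -big_split/=; apply: ler_sum => i _; exact: h.
Qed.

Lemma subrACA (V : zmodType) (x y u v : V) : (x - y) - (u - v) = (x - u) - (y - v).
Proof. by rewrite (opprD u) addrACA -(opprD y). Qed.

Lemma addr_type_le (R : realDomainType) (r a b u v a' b' u' v' : R) :
  a + b <= r * u + r * v -> a' + b' <= r * u' + r * v' ->
  (a + a') + (b + b') <= r * (u + u') + r * (v + v').
Proof. by move=> h h'; rewrite !mulrDr addrACA [leRHS]addrACA lerD. Qed.

Lemma sum_mem_le (R : realDomainType) (I : eqType) (s F : seq I) (a : I -> R) :
  uniq s -> uniq F -> (forall i, 0 <= a i) ->
  \sum_(i <- s) (if i \in F then a i else 0) <= \sum_(i <- F) a i.
Proof.
move=> us uF a0; rewrite -big_mkcond/= -big_filter.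
rewrite [leRHS](bigID (mem s))/= -[X in _ <= X + _]big_filter.
rewrite (perm_big [seq i <- F | i \in s]); last first.
  by apply: uniq_perm; rewrite ?filter_uniq// => i; rewrite !mem_filter andbC.
by rewrite lerDl sumr_ge0.
Qed.

Lemma sign_step (R : realFieldType) (a b c u k e n : R) :
  a + b <= 2 * c + 2 * u -> u <= e -> c <= e * n + k ->
  a <= e * (n + 1) + k \/ b <= e * (n + 1) + k.
Proof.
by move=> h1 h2 h3; have [|h4] := leP a (e * (n + 1) + k); [left|right; lra].
Qed.

Lemma sign_count (R : realFieldType) (M k e n : R) :
  M + k < e * n -> M + (e * n + k) < (e * 2) * n.
Proof. lra. Qed.

Section sign_sums.
Context (R : realType) (p : R) (p1 : (1 <= p%:E)%E) (p2 : p < 2).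
Context (I : choiceType) (d : I -> measure_display) (T : forall i, measurableType (d i)).
Variable mu : forall i, {finite_measure set (T i) -> \bar R}.
Local Notation Z := (lpsum p1 (fun i => LspaceType (mu i) p1 : normedModType R)).
Implicit Types x y z : Z.

Let p_gt0 : 0 < p.
Proof. by apply: lt_le_trans (_ : 1 <= p); rewrite // -lee_fin. Qed.

(* The part of |z|^p that is not controlled by the total mass of finitely many
   of the measures. *)
Let excess (F : seq I) (rho : R) z : R :=
  \sum_(i <- F) truncated_mass rho (z i) + `|z - lproj [set` F] z| `^ p.

(** Finitely many summands leave a small tail; on these summands the truncated masses tend to 0 as
    the height grows. *)
Let excess_small z (e : R) : 0 < e ->
  exists F N, uniq F /\ excess F N.+1%:R z <= e.
Proof.
move=> e0; have e20 : 0 < e / 2 by rewrite divr_gt0.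
have [F uF Fe] := lpsum_approx z e20; exists F.
suff h : forall e, 0 < e -> exists N : nat, forall n : nat, (N <= n)%N ->
    \sum_(i <- F) truncated_mass n.+1%:R (z i) <= e.
  have [N NP] := h _ e20; exists N; split=> //.
  by rewrite [leRHS](splitr e) lerD// NP.
elim: (F) => [|i G ih] {e e0 e20 Fe} e e0.
  by exists 0%N => n _; rewrite big_nil ltW.
have e20 : 0 < e / 2 by rewrite divr_gt0.
have [N1 N1P] := truncated_mass_cvg0 (z i) p2 e20; have [N2 N2P] := ih _ e20.
exists (maxn N1 N2) => n; rewrite geq_max => /andP[N1n N2n].
by rewrite big_cons [leRHS](splitr e) lerD ?N1P ?N2P.
Qed.

Let excess_type F rho x y :
  excess F rho (x + y) + excess F rho (x - y) <= 2 * excess F rho x + 2 * excess F rho y.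
Proof.
have tZ : has_type p (Z : normedModType R).
  by apply: lpsum_type => i; apply: Lspace_type; exact: ltW.
pose Q z := z - lproj [set` F] z.
have h1 : \sum_(i <- F) truncated_mass rho ((x + y) i) +
    \sum_(i <- F) truncated_mass rho ((x - y) i) <=
    2 * \sum_(i <- F) truncated_mass rho (x i) + 2 * \sum_(i <- F) truncated_mass rho (y i).
  apply: ler_sum2 => i; have e1 := lpsumD x y i; have e2 := lpsumB x y i.
  rewrite e1 e2; apply: truncated_mass_type; exact: ltW.
have h2 : `|Q (x + y)| `^ p + `|Q (x - y)| `^ p <= 2 * `|Q x| `^ p + 2 * `|Q y| `^ p.
  have -> : Q (x + y) = Q x + Q y by rewrite /Q linearD opprD addrACA.
  have -> : Q (x - y) = Q x - Q y by rewrite /Q linearB subrACA.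
  exact: tZ.
exact: (addr_type_le h1 h2).
Qed.

(** What the excess leaves out is at most rho^p times the mass of each of the finitely many
    measures, whatever z is. *)
Let le_excess F rho z : uniq F -> 0 < rho ->
  `|z| `^ p <= rho `^ p * \sum_(i <- F) fine (mu i setT) + excess F rho z.
Proof.
move=> uF rho0; have e := lpsum_powR_proj [set` F] z; rewrite e /excess addrA lerD2r.
apply/lpsum_powR_leP => s us.
apply: (@le_trans _ _ (\sum_(i <- F) `|z i| `^ p)); last first.
  apply: ler_sum_comb => i; rewrite -lee_fin.
  apply: le_trans (le_truncated_mass (z i) rho0 (ltW p2)) _.
  rewrite EFinD EFinM; apply: leeD; last exact: lexx.
  by rewrite fineK//; exact: fin_num_measure.
have -> : \sum_(i <- s) `|lproj [set` F] z i| `^ p =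
    \sum_(i <- s) if i \in F then `|z i| `^ p else 0.
  apply: eq_bigr => i _; case: ifPn => iF; first by rewrite lproj_in.
  by rewrite lproj_out ?normr0 ?powR0 ?gt_eqF//; exact/negP.
by apply: sum_mem_le => // i; exact: powR_ge0.
Qed.

(** Half of [C] pays for the growth of the excess, one vector at a time; the other half absorbs,
    once the sum is long enough, the constants [M] and [k]. *)
Lemma exists_small_sign_sum (Gamma : choiceType) (K : Type) (x : Gamma -> Z) (C : R) :
  infinite_set [set: K] -> inj_into I K -> ~ inj_into Gamma K -> 0 < C ->
  exists (s : seq Gamma) (eps : Gamma -> R), [/\ uniq s, forall g, `|eps g| = 1
    & `|\sum_(g <- s) eps g *: x g| `^ p < C * (size s)%:R].
Proof.
move=> Koo IK GK C0; pose e := C / 2; have e0 : 0 < e by rewrite divr_gt0.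
have ex g : exists c : seq I * nat, uniq c.1 /\ excess c.1 c.2.+1%:R (x g) <= e.
  by have [F [N FN]] := excess_small (x g) e0; exists (F, N).
pose c g := sval (cid (ex g)).
have cP g : uniq (c g).1 /\ excess (c g).1 (c g).2.+1%:R (x g) <= e.
  exact: svalP (cid (ex g)).
have [|[F N] qoo] := @infinite_fibre _ _ _ c Koo _ GK.
  by apply: inj_into_prod => //; [exact: inj_into_seqW|exact: inj_into_countable].
set M := N.+1%:R `^ p * \sum_(i <- F) fine (mu i setT).
(* The value at the empty sum, from which the induction starts. *)
pose k := excess F N.+1%:R 0.
have [B Bq MB] := infinite_set_fset (Num.trunc ((M + k) / e)).+1 qoo.
have Be g : g \in finmap.enum_fset B -> uniq F /\ excess F N.+1%:R (x g) <= e.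
  by move=> /Bq /= cg; have := cP g; rewrite cg.
have [eps [eps1 epsP]] : exists eps : Gamma -> R, (forall g, `|eps g| = 1) /\
   excess F N.+1%:R (\sum_(g <- finmap.enum_fset B) eps g *: x g) <=
   e * (size (finmap.enum_fset B))%:R + k.
  have uB : uniq (finmap.enum_fset B) by exact: fset_uniq.
  elim: (finmap.enum_fset B) uB Be => [_ _|g s ih /= /andP[gs us] se].
    exists (fun=> 1); split; first by move=> g; rewrite normr1.
    by rewrite big_nil mulr0 add0r.
  have [h hs|eps [eps1 epsP]] := ih us; first by apply: se; rewrite inE hs orbT.
  have sE (t : R) : \sum_(h <- s) (if h == g then t else eps h) *: x h =
      \sum_(h <- s) eps h *: x h.
    rewrite !big_seq; apply: eq_bigr => h hs; case: eqP hs => // ->.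
    by rewrite (negbTE gs).
  set z := \sum_(h <- s) eps h *: x h in epsP sE.
  (* One of the two signs does at least as well as their mean. *)
  have type := excess_type F N.+1%:R z (x g).
  have [_ xge] := se g (mem_head _ _).
  have [zp|zm] := sign_step type xge epsP.
    exists (fun h => if h == g then 1 else eps h); split.
      by move=> h; case: ifP; rewrite ?normr1.
    by rewrite big_cons eqxx sE scale1r (addrC (x g)) /= -[(size s).+1%:R]natr1.
  exists (fun h => if h == g then -1 else eps h); split.
    by move=> h; case: ifP; rewrite ?normrN1.
  by rewrite big_cons eqxx sE scaleN1r (addrC (- x g)) /= -[(size s).+1%:R]natr1.
have sB : (M + k) / e < (size (finmap.enum_fset B))%:R.
  by apply: lt_le_trans (truncnS_gt _) _; rewrite ler_nat.
have [g0 g0B] : exists g, g \in finmap.enum_fset B.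
  by case: (finmap.enum_fset B) MB => [//|g s _]; exists g; exact: mem_head.
have [uF _] := Be _ g0B.
exists (finmap.enum_fset B), eps; split=> //.
apply: le_lt_trans (le_excess _ uF (ltr0Sn _ _)) _.
apply: le_lt_trans (lerD (lexx M) epsP) _.
have -> : C = e * 2 by rewrite /e divfK.
by apply: sign_count; rewrite mulrC -ltr_pdivrMr.
Qed.

End sign_sums.

(** A signed sum of n unit vectors has norm n^(1/p), so a lower bound [c] contradicts the sign sums
    of the images, whose p-th powers can be made smaller than c^p n. *)
Lemma ellp_not_small (R : realType) (p : R) (p1 : (1 <= p%:E)%E) (p2 : p < 2)
    (K Gamma I : choiceType) (d : I -> measure_display)
    (T : forall i, measurableType (d i))
    (mu : forall i, {finite_measure set (T i) -> \bar R})
    (L : {linear ellp p1 Gamma ->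
       lpsum p1 (fun i => LspaceType (mu i) p1 : normedModType R)}) (c : R) :
  infinite_set [set: K] -> inj_into I K -> ~ inj_into Gamma K -> 0 < c ->
  ~ (forall a, c * `|a| <= `|L a|).
Proof.
move=> Koo IK GK c0 cL.
have [s [eps [us eps1]]] := exists_small_sign_sum p2
  (fun g => L (ellp_basis p1 g)) Koo IK GK (powR_gt0 p c0).
have p0 : 0 < p by apply: lt_le_trans (_ : 1 <= p); rewrite // -lee_fin.
have -> : \sum_(g <- s) eps g *: L (ellp_basis p1 g) =
    L (\sum_(g <- s) eps g *: ellp_basis p1 g).
  by rewrite linear_sum; apply: eq_bigr => g _; rewrite linearZ.
apply/negP; rewrite -leNgt.
have e := ellp_comb_norm p1 eps us.
have -> : (size s)%:R = `|\sum_(g <- s) eps g *: ellp_basis p1 g| `^ p.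
  rewrite e -sum1_size natr_sum; apply: eq_bigr => g _.
  by rewrite eps1 powR1.
rewrite -powRM ?(ltW c0)//; apply: ge0_ler_powR; rewrite ?nnegrE ?(ltW p0)//.
  by rewrite mulr_ge0// ltW.
exact: cL.
Qed.

(** * Almost disjoint vectors *)

Lemma le_of_type (R : realFieldType) (u v w t : R) :
  w <= v -> u + v <= 2 * w + 2 * t -> u <= w + 2 * t.
Proof. lra. Qed.

Section one_step_lemmas.
Context (R : realType).
Implicit Types (p : R) (V W : normedModType R).

(** Rational coefficients keep the number of combinations within any infinite cardinal that bounds
    [B]. *)
Lemma rational_comb_approx W (B : Type) (r : B -> W) (s : seq (B * R)) (e : R) :
  0 < e -> exists q : seq (B * rat),
  `|\sum_(bt <- s) bt.2 *: r bt.1 - \sum_(bt <- q) ratr bt.2 *: r bt.1| <= e.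
Proof.
elim: s e => [|[b c] s ih] e e0.
  by exists [::]; rewrite !big_nil subrr normr0 ltW.
have e20 : 0 < e / 2 by rewrite divr_gt0.
have [q qe] := ih _ e20; pose m := `|r b| + 1.
have m0 : 0 < m by rewrite ltr_wpDl.
have cm : c < c + e / 2 / m by rewrite ltrDl divr_gt0.
have [t] := rat_in_itvoo cm; rewrite in_itv/= => /andP[ct tc].
exists ((b, t) :: q); rewrite !big_cons/= opprD addrACA.
apply: le_trans (ler_normD _ _) _; rewrite [leRHS](splitr e); apply: lerD => //.
rewrite -scalerBl normrZ distrC ger0_norm ?subr_ge0 ?(ltW ct)//.
have tm : ratr t - c <= e / 2 / m by rewrite lerBlDl ltW.
have bm : `|r b| <= m by rewrite lerDl ler01.
have ct0 : 0 <= ratr t - c by rewrite subr_ge0 ltW.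
apply: le_trans (ler_pM ct0 (normr_ge0 _) tm bm) _.
by rewrite divfK// gt_eqF.
Qed.

(* As l norms f and kills rho, |f - a rho| >= |f|, and type p applies. *)
Lemma norm_add_ker p W (f rho : W) (l : W -> R) (a : R) : 0 < p -> has_type p W ->
  (forall c x y, l (c *: x + y) = c * l x + l y) -> (forall x, `|l x| <= `|x|) ->
  l f = `|f| -> l rho = 0 ->
  `|f + a *: rho| `^ p <= `|f| `^ p + 2 * (`|a| `^ p * `|rho| `^ p).
Proof.
move=> p0 tW lin l1 lf lrho.
have h : `|f| `^ p <= `|f - a *: rho| `^ p.
  apply: ge0_ler_powR; rewrite ?nnegrE ?(ltW p0)//.
  rewrite -{1}lf; apply: le_trans (ler_norm _) _; apply: le_trans _ (l1 _).
  by rewrite -scaleNr [f + _]addrC lin lrho mulr0 add0r.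
have := tW f (a *: rho); rewrite normrZ powRM//.
exact: le_of_type.
Qed.

(** Continuity of the norm: the estimate need only be checked for f in a dense set. *)
Lemma powR_norm_add_closed p W (f w : W) (M : R) : 0 < p ->
  (forall e, 0 < e -> exists g, `|f - g| <= e /\ `|g + w| `^ p <= `|g| `^ p + M) ->
  `|f + w| `^ p <= `|f| `^ p + M.
Proof.
move=> p0 h; have inv0 n : 0 < n.+1%:R^-1 :> R by rewrite invr_gt0.
pose g n := sval (cid (h _ (inv0 n))).
have gP n : `|f - g n| <= n.+1%:R^-1 /\ `|g n + w| `^ p <= `|g n| `^ p + M.
  exact: svalP (cid (h _ (inv0 n))).
have gf : seq_lim g f.
  move=> e e0; have [N NP] := archi_divS_le 1 e0; exists N => n Nn.
  rewrite distrC; apply: le_trans (gP n).1 (le_trans _ NP).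
  by rewrite mul1r lef_pV2 ?posrE// ler_nat ltnS.
have gwf : seq_lim (fun n => g n + w) (f + w).
  move=> e e0; have [N NP] := gf e e0; exists N => n Nn.
  by rewrite opprD addrACA subrr addr0 NP.
rewrite -lerBlDl.
apply: (cvg_real_le (N := 0%N) (cvgB (seq_lim_powR p0 gwf) (seq_lim_powR p0 gf))).
by move=> n _; rewrite lerBlDl; exact: (gP n).2.
Qed.

Lemma maximal_separated V (A : set V) (e : R) : exists D : set V, [/\ D `<=` A,
  (forall x y, D x -> D y -> x <> y -> e <= `|x - y|) &
  forall x, A x -> (forall y, D y -> e <= `|x - y|) -> D x].
Proof.
pose P (D : set V) := D `<=` A /\
  (forall x y, D x -> D y -> x <> y -> e <= `|x - y|).
have [F FP Ftot|D [[DA De] Dmax]] := @Zorn_bigcup V P.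
  split=> [x [X FX Xx]|x y [X FX Xx] [Y FY Yy] xy]; first exact: (FP X FX).1.
  by have [XY|YX] := Ftot X Y FX FY;
    [apply: (FP Y FY).2 => //; exact: XY|apply: (FP X FX).2 => //; exact: YX].
exists D; split=> // x Ax xD; apply: contrapT => nDx.
apply: (Dmax (D `|` [set x])).
  split; first by move=> ?; left.
  by move=> /(_ x) h; apply: nDx; apply: h; right.
split=> [y [/DA//|->//]|y z [Dy|->] [Dz|->] yz //]; first exact: De.
  by rewrite distrC; exact: xD.
exact: xD.
Qed.

End one_step_lemmas.

Lemma inj_into_bigcup_countable (I B K : Type) (F : B -> set I) :
  infinite_set [set: K] -> inj_into B K -> (forall b, countable (F b)) ->
  inj_into {i | exists b, F b i} K.
Proof.
move=> Koo BK cF.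
have ex b : exists f : I -> nat, {in F b &, injective f} by exact/countable_injP.
pose f b := sval (cid (ex b)).
have fP b : {in F b &, injective (f b)} by exact: svalP (cid (ex b)).
apply: inj_into_trans (inj_into_prod Koo BK (inj_into_countable nat Koo)).
pose g (i : {i | exists b, F b i}) := sval (cid (svalP i)).
have gP i : F (g i) (sval i) by exact: svalP (cid (svalP i)).
exists (fun i => (g i, f (g i) (sval i))) => i j [gij]; rewrite gij => fij.
by apply: proj1_sig_inj; apply: (fP (g j)) fij; rewrite inE// -gij.
Qed.

Lemma quarter_le (R : realFieldType) (t k : R) :
  2^-1 <= t + k -> k <= 16^-1 -> 4^-1 <= t.
Proof. lra. Qed.

Lemma triple_le (R : realFieldType) (k e : R) :
  0 <= k -> 16 * k <= e -> k + k + k <= e * 4^-1.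
Proof. lra. Qed.

Lemma norm_add_exponent1 (R : realType) (p : R) (W : normedModType R) (f w : W)
    (a e : R) : p = 1 -> 0 <= e -> `|w| <= e ->
  `|f + a *: w| `^ p <= `|f| `^ p + 2 * (`|a| `^ p * e `^ p).
Proof.
move=> -> e0 we; rewrite !powRr1//; apply: le_trans (ler_normD _ _) _.
rewrite lerD2l normrZ; apply: le_trans (ler_wpM2l _ we) _ => //.
by rewrite ler_peMl ?mulr_ge0// ler1n.
Qed.

Lemma inj_into_setU (I K : Type) (S U : set I) : infinite_set [set: K] ->
  inj_into {i | S i} K -> inj_into {i | U i} K -> inj_into {i | S i \/ U i} K.
Proof.
move=> Koo [f finj] [g ginj].
have SUK : inj_into ({i | S i} + {i | U i}) K.
  apply: inj_into_trans (inj_into_prod Koo (inj_into_countable bool Koo)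
    (ex_intro _ id (@inj_id K))).
  exists (fun s => match s with inl i => (true, f i) | inr i => (false, g i) end).
  by move=> [i|i] [j|j] //= [] => [/finj->|/ginj->].
apply: inj_into_trans SUK.
apply: (@surj_inj_into _ _ (fun s : {i | S i} + {i | U i} => match s with
  | inl i => exist _ (sval i) (or_introl (svalP i))
  | inr i => exist _ (sval i) (or_intror (svalP i)) end)).
move=> [i [Si|Ui]]; [exists (inl (exist _ i Si))|exists (inr (exist _ i Ui))];
  exact: proj1_sig_inj.
Qed.

Section almost_disjoint_step.
Context (R : realType) (p : R) (p1 : (1 <= p%:E)%E) (I : choiceType).
Context (E : I -> normedModType R) (V : normedModType R) (Gamma : Type).
Local Notation Z := (lpsum p1 E).
Variable J : {linear V -> Z}.
Hypothesis J_isometry : forall v, `|J v| = `|v|.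
Hypothesis E_type : forall i, has_type p (E i).
Hypothesis V_complete : seq_complete V.
Hypothesis V_convex : 1 < p -> unif_convex p V.

(* The form in which (4) is used: the restriction to few coordinates is never
   bounded below. *)
Hypothesis J_spread : forall (K : Type) (S : set I) (k : R),
  infinite_set [set: K] -> ~ inj_into Gamma K -> inj_into {i | S i} K -> 0 < k ->
  exists x : V, `|x| = 1 /\ `|lproj S (J x)| <= k.

Let p_ge1 : 1 <= p. Proof. by rewrite -lee_fin. Qed.
Let p_gt0 : 0 < p. Proof. exact: lt_le_trans p_ge1. Qed.

Let Phi_bound (l : Z -> R) (S : set I) (x : V) : (forall z, `|l z| <= `|z|) ->
  `|l (lproj S (J x))| <= `|x|.
Proof.
move=> l1; rewrite -J_isometry; apply: le_trans (l1 _) _; exact: ler_norm_lproj.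
Qed.

(* Adding the supports of a maximal separated set that is too small to S
   contradicts J_spread. *)
Let many_separated (K : Type) (S : set I) (k : R) :
  infinite_set [set: K] -> ~ inj_into Gamma K -> inj_into {i | S i} K -> 0 < k ->
  exists D : set V, [/\ forall x, D x -> `|x| = 1 /\ `|lproj S (J x)| <= k,
    forall x y, D x -> D y -> x <> y -> 2^-1 <= `|x - y| & ~ inj_into {x | D x} K].
Proof.
move=> Koo GK SK k0.
have [D [DA De Dmax]] := maximal_separated
  [set x : V | `|x| = 1 /\ `|lproj S (J x)| <= k] 2^-1.
exists D; split=> // DK.
pose S' : set I := [set i | S i \/ exists x : {x | D x}, lsupp (J (sval x)) i].
have S'K : inj_into {i | S' i} K.
  have UK : inj_into {i | exists x : {x | D x}, lsupp (J (sval x)) i} K.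
    by apply: inj_into_bigcup_countable => // x; exact: lsupp_countable.
  exact: inj_into_setU.
pose k' := Num.min k 2^-1.
have k'0 : 0 < k' by rewrite lt_min k0 invr_gt0 ltr0n.
have [x [x1 xk]] := J_spread Koo GK S'K k'0.
have SS' : S `<=` S' by move=> i; left.
have xS : `|lproj S (J x)| <= k.
  rewrite -(lproj_comp (J x) SS'); apply: le_trans (ler_norm_lproj _ _) _.
  by apply: le_trans xk _; rewrite ge_min lexx.
have xD y : D y -> 2^-1 <= `|x - y|.
  move=> Dy; rewrite -J_isometry.
  apply: le_trans _ (ler_norm_subproj S' _).
  have yS' : lproj S' (J y) = J y.
    by apply: lproj_lsupp => i yi; right; exists (exist _ y Dy).
  have -> : J (x - y) - lproj S' (J (x - y)) = J x - lproj S' (J x).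
    have e1 : J (x - y) = J x - J y by exact: linearB.
    have e2 : lproj S' (J x - J y) = lproj S' (J x) - J y.
      exact: (etrans (linearB _ _ _) (congr1 (fun t => lproj S' (J x) - t) yS')).
    by rewrite e1 e2 subrACA subrr subr0.
  apply: le_trans _ (lerB_dist _ _); rewrite J_isometry x1 lerBrDr.
  apply: (@le_trans _ _ (2^-1 + 2^-1)); last by rewrite [leRHS]splitr mul1r.
  by rewrite lerD2l; apply: le_trans xk _; rewrite ge_min lexx orbT.
have Dx := Dmax x (conj x1 xS) xD.
by have := xD x Dx; rewrite subrr normr0 leNgt invr_gt0 ltr0n.
Qed.

(** For p = 1 the triangle inequality suffices. For p > 1, y is the normalisation of a vector close
    to v - v', where v and v' lie in a large 1/2-separated set of unit vectors that are small on
    [S]. *)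
Lemma almost_disjoint_step (K : Type) (B : eqType) (x : B -> V) (r : B -> Z) (e : R) :
  infinite_set [set: K] -> ~ inj_into Gamma K -> inj_into B K -> 0 < e ->
  let S := [set i | exists b, lsupp (J (x b)) i] in
  exists y : V, [/\ `|y| = 1, `|lproj S (J y)| <= e &
    forall (s : seq (B * R)) (a : R),
      `|\sum_(bt <- s) bt.2 *: r bt.1 + a *: lproj S (J y)| `^ p <=
      `|\sum_(bt <- s) bt.2 *: r bt.1| `^ p + 2 * (`|a| `^ p * e `^ p)].
Proof.
move=> Koo GK BK e0 S.
have SK : inj_into {i | S i} K.
  by apply: inj_into_bigcup_countable => // b; exact: lsupp_countable.
have pow_le u : 0 <= u -> u <= e -> u `^ p <= e `^ p.
  by move=> u0 ue; apply: ge0_ler_powR; rewrite ?nnegrE ?(ltW p_gt0)// (ltW e0).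
have [p_1|p_neq1] := eqVneq p 1.
  have [y [y1 ye]] := J_spread Koo GK SK e0; exists y; split=> // s a.
  exact: norm_add_exponent1 (ltW e0) ye.
have {p_neq1} p_gt1 : 1 < p by rewrite lt_neqAle eq_sym p_neq1.
(* From k <= 1/16 follows |z| >= 1/2 - k >= 1/4, so normalising z costs a factor of at most 4, and
   16 k <= e keeps the three errors of size k below e / 4. *)
pose k := Num.min e 1 / 16.
have k0 : 0 < k by rewrite divr_gt0// lt_min e0 ltr01.
have [D [D1 De nDK]] := many_separated Koo GK SK k0.
pose f (q : seq (B * rat)) : Z := \sum_(bt <- q) ratr bt.2 *: r bt.1.
pose l q := sval (cid (norming_functional (f q))).
have [llin l1 lf] : [/\ forall q c u v, l q (c *: u + v) = c * l q u + l q v,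
    forall q u, `|l q u| <= `|u| & forall q, l q (f q) = `|f q|].
  by split=> q; rewrite /l; case: (cid _) => ? [].
have QK : inj_into (seq (B * rat)) K.
  by apply: inj_into_seqW => //; apply: inj_into_prod => //; exact: inj_into_countable.
(* Pulled back to [V] through the restriction to [S]: a zero of [Phi q] is a vector whose remainder
   is killed by [l q]. *)
pose Phi q (v : V) := l q (lproj S (J v)).
have Philin q c u v : Phi q (c *: u + v) = c * Phi q u + Phi q v.
  by rewrite /Phi !linearP llin.
have D_le1 v : D v -> `|v| <= 1 by move=> /D1[-> _].
have [v [v' [z [Dv Dv' vv' Phiz vz]]]] := separated_pair p_gt1 (V_convex p_gt1)
  V_complete Koo QK Philin (fun q v => Phi_bound S v (l1 q)) D_le1 nDK k0.
have k16 : k <= 16^-1 /\ 16 * k <= e.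
  rewrite /k mulrC; split; last by rewrite mulVKf// ge_min lexx.
  by rewrite ler_piMr// ge_min lexx orbT.
set w := v - v' - z in vz.
have z4 : 4^-1 <= `|z|.
  have vE : v - v' = z + w by rewrite /w addrCA subrr addr0.
  have h : 2^-1 <= `|z| + k.
    apply: le_trans (De _ _ Dv Dv' vv') _; rewrite vE.
    by apply: le_trans (ler_normD _ _) _; rewrite lerD2l.
  exact: quarter_le h k16.1.
have Sz : `|lproj S (J z)| <= k + k + k.
  have -> : z = v - v' - w by rewrite /w subKr.
  have LB u u' : `|lproj S (J (u - u'))| <= `|lproj S (J u)| + `|lproj S (J u')|.
    have -> : lproj S (J (u - u')) = lproj S (J u) - lproj S (J u').
      by apply: etrans (linearB _ _ _); congr (lproj S _); exact: linearB.
    exact: ler_normB.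
  apply: le_trans (LB _ _) _; apply: lerD.
    apply: le_trans (LB _ _) _.
    by apply: lerD; [exact: (D1 _ Dv).2|exact: (D1 _ Dv').2].
  by apply: le_trans (ler_norm_lproj _ _) _; rewrite J_isometry.
have z0 : 0 < `|z| by apply: lt_le_trans z4; rewrite invr_gt0 ltr0n.
pose y := `|z|^-1 *: z.
have Se : `|lproj S (J y)| <= e.
  rewrite /y !linearZ/= normrZ ger0_norm ?invr_ge0 ?(ltW z0)// mulrC ler_pdivrMr//.
  apply: le_trans Sz (le_trans _ (ler_wpM2l (ltW e0) z4)).
  exact: triple_le (ltW k0) k16.2.
exists y; split=> //.
  by rewrite normrZ ger0_norm ?mulVf ?gt_eqF// invr_ge0 ltW.
move=> s a; apply: powR_norm_add_closed => // t t0.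
have [q qt] := rational_comb_approx r s t0; exists (f q); split=> //.
have Zt : has_type p (Z : normedModType R) by exact: lpsum_type.
have lq0 : l q (lproj S (J y)) = 0.
  have := Philin q (`|z|^-1) z 0; rewrite addr0 Phiz mulr0 add0r => yE.
  apply: (etrans yE); apply/eqP; rewrite -normr_eq0 eq_le normr_ge0 andbT.
  by have := Phi_bound S 0 (l1 q); rewrite normr0.
apply: le_trans (norm_add_ker a p_gt0 Zt (llin q) (l1 q) (lf q) lq0) _.
rewrite lerD2l ler_wpM2l// ler_wpM2l ?powR_ge0//; exact: pow_le.
Qed.

End almost_disjoint_step.

(** * Transfinite recursion along a well-order *)

Lemma exists_well_founded_order (T : eqType) : exists lt : T -> T -> Prop,
  [/\ well_founded lt, forall x y z, lt x y -> lt y z -> lt x z,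
      forall x, ~ lt x x & forall x y, x <> y -> lt x y \/ lt y x].
Proof.
have [le wo] := well_ordering_principle T.
(* Least elements of sets of at most three elements yield reflexivity, totality, antisymmetry and
   transitivity. *)
have min3 x y z : exists m, [/\ m = x \/ m = y \/ m = z, le m x, le m y & le m z].
  have [|m [[/= mA mP] _]] := wo [pred t | [|| t == x, t == y | t == z]].
    by exists x; rewrite inE eqxx.
  exists m; split; try by apply: mP; rewrite !inE eqxx ?orbT.
  by move: mA; rewrite inE => /or3P[]/eqP->; [left|right; left|right; right].
have lexx x : le x x by have [m [[->|[->|->]]]] := min3 x x x.
have anti x y : le x y -> le y x -> x = y.
  move=> xy yx; have [|m [_ muniq]] := wo [pred t | (t == x) || (t == y)].
    by exists x; rewrite inE eqxx.
  rewrite -(muniq x) ?(muniq y)//; split; rewrite ?inE ?eqxx ?orbT// => t;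
    by rewrite inE => /orP[]/eqP->.
have trans x y z : le x y -> le y z -> le x z.
  move=> xy yz; have [m [[->|[->|->]] mx my mz]] := min3 x y z => //.
    by rewrite (anti _ _ xy mx).
  by rewrite -(anti _ _ yz my).
exists (fun x y => le x y /\ x <> y); split.
- move=> x; apply: contrapT => nx.
  have [|m [[/= mA mP] _]] := wo [pred t | `[< ~ Acc (fun x y => le x y /\ x <> y) t >]].
    by exists x; exact: (introT (asboolP _) nx).
  move: (elimT (asboolP _) mA); apply; constructor => y [ym nym].
  apply: contrapT => ny; apply: nym; apply: anti ym _.
  by apply: mP; exact: (introT (asboolP _) ny).
- move=> x y z [xy nxy] [yz nyz]; split; first exact: trans yz.
  by move=> xz; apply: nxy; apply: anti xy _; rewrite xz.
- by move=> x [].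
- move=> x y nxy; have [m [[->|[->|->]] mx my _]] := min3 x y y.
  + by left.
  + by right; split=> // yx; apply: nxy.
  + by right; split=> // yx; apply: nxy.
Qed.

(** The step is required for every history, admissible or not, so that plain recursion without an
    invariant defines f. *)
Lemma wf_recursive_choice (G A : Type) (lt : G -> G -> Prop) (a0 : A)
    (P : G -> (G -> A) -> Prop) : well_founded lt -> (forall x, ~ lt x x) ->
  (forall x f g, (forall y, lt y x \/ y = x -> f y = g y) -> P x f -> P x g) ->
  (forall x (f : G -> A), exists a, P x (fun y => if pselect (lt y x) then f y else a)) ->
  exists f, forall x, P x f.
Proof.
move=> wf irr ext step.
(* Off the segment below x the history is filled with the default [a0], which the step
   overwrites. *)
pose F x (rec : forall y, lt y x -> A) : A :=
  sval (cid (step x (fun y => if pselect (lt y x) is left h then rec y h else a0))).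
pose f := Fix wf (fun=> A) F.
have fE x : f x = F x (fun y _ => f y).
  rewrite /f Fix_eq// => y g h gh; congr (F y _).
  by apply: functional_extensionality_dep => z; apply: functional_extensionality_dep => zy.
exists f => x; have := svalP (cid (step x
  (fun y => if pselect (lt y x) is left h then f y else a0))).
apply: ext => y [yx|->].
  by case: (pselect (lt y x)).
have ifN (Q : Prop) (a b : A) : ~ Q -> (if pselect Q then a else b) = b.
  by case: (pselect Q).
by rewrite (ifN _ _ _ (irr x)) fE.
Qed.

Lemma exists_maximum (G : eqType) (lt : G -> G -> Prop) (s : seq G) :
  (forall x y z, lt x y -> lt y z -> lt x z) ->
  (forall x y, x <> y -> lt x y \/ lt y x) -> s != [::] ->
  exists2 m, m \in s & forall x, x \in s -> x != m -> lt x m.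
Proof.
move=> trans tot; elim: s => // x [_ _|y s /(_ isT)[m ms mP] _].
  by exists x; rewrite ?mem_head// => y; rewrite inE => ->.
have [xm|/eqP xm] := eqVneq x m.
  exists m; first by rewrite inE ms orbT.
  by move=> z; rewrite inE xm => /orP[->//|]; exact: mP.
have [lxm|lmx] := tot _ _ xm.
  exists m; first by rewrite inE ms orbT.
  by move=> z; rewrite inE => /orP[/eqP->//|]; exact: mP.
exists x; first exact: mem_head.
move=> z; rewrite inE => /orP[->//|zs] zx.
by have [->//|zm] := eqVneq z m; apply: trans lmx; exact: mP.
Qed.

(** Removing the largest index m from a combination costs M |c m|^p. *)
Lemma powR_norm_sum_le (R : realType) (p M : R) (W : normedModType R) (G : eqType)
    (lt : G -> G -> Prop) (r : G -> W) : 0 < p ->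
  (forall x y z, lt x y -> lt y z -> lt x z) ->
  (forall x y, x <> y -> lt x y \/ lt y x) ->
  (forall g (s : seq (G * R)) a, (forall bt, bt \in s -> lt bt.1 g) ->
    `|\sum_(bt <- s) bt.2 *: r bt.1 + a *: r g| `^ p <=
    `|\sum_(bt <- s) bt.2 *: r bt.1| `^ p + M * `|a| `^ p) ->
  forall (s : seq G) (c : G -> R), uniq s ->
    `|\sum_(g <- s) c g *: r g| `^ p <= M * \sum_(g <- s) `|c g| `^ p.
Proof.
move=> p0 trans tot h s c; elim: (size s) {-2}s (erefl (size s)) => {s} [|n ih] s.
  by move=> /size0nil-> _; rewrite !big_nil normr0 powR0 ?gt_eqF// mulr0.
move=> sn us; have [|m ms mP] := exists_maximum trans tot (s := s); first by case: s sn us.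
rewrite (perm_big _ (perm_to_rem ms)) [X in _ <= _ * X](perm_big _ (perm_to_rem ms)) !big_cons/=.
have := h m [seq (b, c b) | b <- rem m s] (c m); rewrite big_map/= addrC => h'.
apply: le_trans (h' _) _.
  move=> _ /mapP[b brem ->]/=; move: brem; rewrite mem_rem_uniq// inE => /andP[bm bs].
  exact: mP.
rewrite mulrDr addrC lerD2l; apply: ih; last exact: rem_uniq.
by rewrite size_rem// sn.
Qed.

(** If not all segments are small, take the least g whose segment is not. Its predecessors are all
    small. As [Gamma] is uncountable, the segment of g is infinite; not being small, it then
    receives an injection of [Gamma]. *)
Lemma uncountable_initial_segments (G : Type) (lt : G -> G -> Prop) :
  ~ inj_into G nat -> well_founded lt ->
  exists f : G -> G, injective f /\ forall g, exists K : Type,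
    [/\ infinite_set [set: K], ~ inj_into G K & inj_into {b | lt b (f g)} K].
Proof.
move=> Gnat wf; pose small g := exists K : Type,
  [/\ infinite_set [set: K], ~ inj_into G K & inj_into {b | lt b g} K].
suff [f finj] : inj_into G {g | small g}.
  exists (fun g => sval (f g)); split; last by move=> g; exact: svalP (f g).
  by move=> g h /proj1_sig_inj/finj.
have [all|/existsNP[g0 ng0]] := pselect (forall g, small g).
  by exists (fun g => exist _ g (all g)) => g h [].
have [g [ng gP]] : exists g, ~ small g /\ forall b, lt b g -> small b.
  elim/(well_founded_ind wf): g0 ng0 => g ih ng.
  have [all|/existsNP[b /not_implyP[bg nb]]] := pselect (forall b, lt b g -> small b).
    by exists g.
  exact: ih nb.
have big K : infinite_set [set: K] -> inj_into {b | lt b g} K -> inj_into G K.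
  by move=> Koo gK; apply: contrapT => GK; apply: ng; exists K.
have [fin|inf] := pselect (finite_set [set: {b | lt b g}]).
  exfalso; apply: Gnat; apply: big; first exact: infinite_nat.
  exact/inj_into_card/finite_set_countable.
apply: inj_into_trans (big _ inf (ex_intro _ id (@inj_id _))) _.
by exists (fun b => exist _ (sval b) (gP _ (svalP b))) => b c [/proj1_sig_inj].
Qed.

Lemma seq_pair_lift (A C : eqType) (Q : A -> Prop) (s : seq (A * C)) :
  (forall bt, bt \in s -> Q bt.1) ->
  exists t : seq ({a | Q a} * C), s = [seq (sval bt.1, bt.2) | bt <- t].
Proof.
elim: s => [_|[a c] s ih h]; first by exists [::].
have [|t ->] := ih; first by move=> bt bts; apply: h; rewrite inE bts orbT.
by exists ((exist _ a (h (a, c) (mem_head _ _)), c) :: t).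
Qed.

Section almost_disjoint_family.
Context (R : realType) (p : R) (p1 : (1 <= p%:E)%E) (I : choiceType).
Context (E : I -> normedModType R) (V : normedModType R) (Gamma : eqType).
Local Notation Z := (lpsum p1 E).
Variable J : {linear V -> Z}.
Hypothesis J_isometry : forall v, `|J v| = `|v|.
Hypothesis E_type : forall i, has_type p (E i).
Hypothesis V_complete : seq_complete V.
Hypothesis V_convex : 1 < p -> unif_convex p V.
Hypothesis J_spread : forall (K : Type) (S : set I) (k : R),
  infinite_set [set: K] -> ~ inj_into Gamma K -> inj_into {i | S i} K -> 0 < k ->
  exists x : V, `|x| = 1 /\ `|lproj S (J x)| <= k.
Hypothesis Gamma_uncountable : ~ inj_into Gamma nat.

Let p_gt0 : 0 < p.
Proof. by apply: lt_le_trans (_ : 1 <= p); rewrite // -lee_fin. Qed.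

(** The remainder [r g] is the restriction of [J (x g)] to the supports of all earlier vectors,
    which makes the differences disjoint; the p-estimates of the single steps add up along the
    well-order. *)
Lemma almost_disjoint_family (e : R) : 0 < e ->
  exists (x : Gamma -> V) (r : Gamma -> Z), [/\ forall g, `|x g| = 1,
    forall g, `|r g| <= e,
    forall g h, g <> h -> disjoint_coord (J (x g) - r g) (J (x h) - r h) &
    forall (s : seq Gamma) (c : Gamma -> R), uniq s ->
      `|\sum_(g <- s) c g *: r g| `^ p <= 2 * e `^ p * \sum_(g <- s) `|c g| `^ p].
Proof.
move=> e0; have [lt [wf trans irr tot]] := exists_well_founded_order Gamma.
pose S (f : Gamma -> V) g := [set i | exists b : {b | lt b g}, lsupp (J (f (sval b))) i].
(* [rest] and [comb] are known by their equations only, which keeps their bodies from unfolding. *)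
have [rest restE] : exists rest : (Gamma -> V) -> Gamma -> Z,
  forall f g, rest f g = lproj (S f g) (J (f g)) by eexists; move=> f g.
have [comb combE] : exists comb : (Gamma -> V) -> seq (Gamma * R) -> Z,
  forall f s, comb f s = \sum_(bt <- s) bt.2 *: rest f bt.1 by eexists; move=> f s.
pose small g := exists K : Type,
  [/\ infinite_set [set: K], ~ inj_into Gamma K & inj_into {b | lt b g} K].
pose good g (v : V) (w : Z) (F : seq (Gamma * R) -> Z) := [/\ `|v| = 1, `|w| <= e &
  forall s a, (forall bt, bt \in s -> lt bt.1 g) ->
    `|F s + a *: w| `^ p <= `|F s| `^ p + 2 * (`|a| `^ p * e `^ p)].
have good_ext g (v v' : V) (w w' : Z) F F' : v = v' -> w = w' ->
    (forall s, (forall bt, bt \in s -> lt bt.1 g) -> F s = F' s) ->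
    good g v w F -> good g v' w' F'.
  move=> <- <- FF' [v1 we Fe]; split; [exact: v1|exact: we|move=> s a sg; have es := FF' s sg].
  by case: _ / es; exact: Fe.
(* Nothing is asked at an index with a large initial segment, where (4) provides no vector. *)
pose P g f := small g -> good g (f g) (rest f g) (comb f).
have Sext g f f' : (forall y, lt y g -> f y = f' y) -> S f g = S f' g.
  move=> ff'; apply/seteqP; split=> i [b bi]; exists b; move: bi;
    by rewrite (ff' _ (svalP b)).
have rext g f f' : (forall y, lt y g -> f y = f' y) -> f g = f' g ->
    rest f g = rest f' g.
  by move=> ff' fg; rewrite !restE (Sext _ _ _ ff') fg.
have sext g f f' (s : seq (Gamma * R)) : (forall y, lt y g -> f y = f' y) ->
    (forall bt, bt \in s -> lt bt.1 g) ->
    comb f s = comb f' s.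
  move=> ff' sg; rewrite !combE; apply: eq_big_seq => bt /sg btg; congr (_ *: _).
  by apply: rext; [move=> y yb; apply: ff'; exact: trans btg|exact: ff'].
have [f fP] : exists f, forall g, P g f.
  apply: (wf_recursive_choice 0 wf irr) => [g f f' ff' Pf sg|g f].
    have fl y : lt y g -> f y = f' y by move=> yg; apply: ff'; left.
    have fg : f g = f' g by apply: ff'; right.
    apply: good_ext (Pf sg) => //; first exact: rext.
    by move=> s; exact: sext.
  have [[K [Koo GK gK]]|nsmall] := pselect (small g); last by exists 0 => /nsmall.
  pose B : eqType := {classic {b | lt b g}}.
  have [y [y1 y2 y3]] := almost_disjoint_step J_isometry E_type V_complete V_convex
    J_spread (B := B) (fun b => f (sval (b : {b | lt b g})))
    (fun b => rest f (sval (b : {b | lt b g}))) Koo GK gK e0.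
  exists y; set f' := fun z => _.
  have fl z : lt z g -> f z = f' z by rewrite /f'; case: (pselect (lt z g)).
  have fg : f' g = y by rewrite /f'; case: (pselect (lt g g)) => [h|//]; case: (irr _ h).
  have er : rest f' g = lproj (S f g) (J y) by rewrite restE fg (Sext g f f' fl).
  have ts s : (forall bt, bt \in s -> lt bt.1 g) -> exists t : seq (B * R),
      comb f' s = \sum_(bt <- t) bt.2 *: rest f (sval (bt.1 : {b | lt b g})).
    move=> sg; have [t st] := @seq_pair_lift _ _ (fun b => lt b g) s sg.
    by exists t; rewrite -(sext g f f' s fl sg) combE st big_map.
  move=> _; apply: (good_ext g y _ (lproj (S f g) (J y)) _ (comb f')) => //.
  split; [exact: y1|exact: y2|move=> s a sg; have [t es] := ts s sg].
  by case: _ / (esym es); exact: y3.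
(* Reindexing by [phi] retains only indices with small initial segments. *)
have [phi [phi_inj phi_small]] := uncountable_initial_segments Gamma_uncountable wf.
exists (fun g => f (phi g)), (fun g => rest f (phi g)); split.
- by move=> g; have [] := fP _ (phi_small g).
- by move=> g; have [] := fP _ (phi_small g).
- move=> g h gh.
  have main a b : lt a b -> disjoint_coord (J (f a) - rest f a) (J (f b) - rest f b).
    move=> ab i; have ea := lpsumB (J (f a)) (rest f a) i.
    have eb := lpsumB (J (f b)) (rest f b) i; rewrite ea eb.
    have [ai|ai] := eqVneq (J (f a) i) 0.
      by left; rewrite restE lprojE ai if_same subrr.
    (* A coordinate at which the earlier vector is nonzero belongs to the set to which the later one
       is restricted. *)
    right; rewrite restE lproj_in ?subrr//.
    by exists (exist _ a ab).
  have pgh : phi g <> phi h by move=> /phi_inj.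
  by have [/main//|/main dhg i] := tot _ _ pgh; have [|] := dhg i; [right|left].
- apply: (powR_norm_sum_le (lt := fun g h => lt (phi g) (phi h)) (r := fun g => rest f (phi g))) => //.
  + by move=> x y z; exact: trans.
  + by move=> x y xy; apply: tot => /phi_inj.
  move=> g s a sg; have [_ _ h] := fP _ (phi_small g).
  have := h [seq (phi bt.1, bt.2) | bt <- s] a; rewrite combE big_map/= => h'.
  by rewrite -mulrA [_ * `|a| `^ p]mulrC; apply: h' => _ /mapP[bt /sg btg ->].
Qed.

End almost_disjoint_family.

(** * Perturbations of disjoint vectors *)

Lemma ge0_powR_le (R : realType) (p : R) (p0 : 0 < p) (x y : R) : 0 <= x -> x <= y ->
  x `^ p <= y `^ p.
Proof.
move=> x0 xy; apply: ge0_ler_powR; rewrite ?nnegrE ?(ltW p0)//.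
exact: le_trans xy.
Qed.

Lemma lipschitz_norm (R : realType) (V W : normedModType R) (T : {linear V -> W})
    (C : R) (a b : V) : (forall x, `|T x| <= C * `|x|) ->
  `|T a| <= `|T b| + C * `|a - b|.
Proof.
move=> TC; have {1}-> : T a = T b + T (a - b) by rewrite -linearD addrC subrK.
by apply: le_trans (ler_normD _ _) _; rewrite lerD2l.
Qed.

Lemma lipschitz_scaled_norm (R : realType) (V : normedModType R) (k : R) (a b : V) :
  0 <= k -> k * `|a| <= k * `|b| + k * `|a - b|.
Proof.
move=> k0; rewrite -mulrDr; apply: ler_wpM2l => //.
by rewrite -[X in `|X| <= _](subrK b) addrC ler_normD.
Qed.

Section ellp_density.
Context (R : realType) (p : R) (p1 : (1 <= p%:E)%E) (I : choiceType).
Local Notation l := (lpsum p1 (fun _ : I => R^o : normedModType R)).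

Let p_ge1 : 1 <= p. Proof. by rewrite -lee_fin. Qed.
Let p_gt0 : 0 < p. Proof. exact: lt_le_trans p_ge1. Qed.

(** Both sides are Lipschitz, and finite combinations of unit vectors are dense. *)
Lemma ellp_dense_le (F G : l -> R) (CF CG : R) : 0 <= CF -> 0 <= CG ->
  (forall a b, F a <= F b + CF * `|a - b|) ->
  (forall a b, G b <= G a + CG * `|b - a|) ->
  (forall s (c : I -> R), uniq s ->
    F (\sum_(g <- s) c g *: ellp_basis p1 g) <= G (\sum_(g <- s) c g *: ellp_basis p1 g)) ->
  forall a, F a <= G a.
Proof.
move=> CF0 CG0 FC GC FG a; apply/ler_addgt0Pr => e e0.
pose C := CF + CG + 1; have C0 : 0 < C by rewrite ltr_wpDl// addr_ge0.
have t0 : 0 < e / C by rewrite divr_gt0.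
have [s us st] := lpsum_approx a (powR_gt0 p t0).
have at_ := powR_le_cancel p_gt0 (normr_ge0 _) (ltW t0) st.
have e1 := ellp_comb_proj a us; have h := FG s (fun i => a i) us; rewrite e1 in h.
have h1 := FC a (lproj [set` s] a); have h2 := GC a (lproj [set` s] a).
apply: le_trans h1 (le_trans (lerD h (le_refl _)) _).
rewrite distrC in h2; apply: le_trans (lerD h2 (le_refl _)) _.
rewrite -addrA lerD2l -mulrDl addrC.
apply: le_trans (ler_wpM2l (addr_ge0 CF0 CG0) at_) _.
by rewrite mulrA ler_pdivrMr// mulrC ler_wpM2l ?(ltW e0)// /C lerDl.
Qed.

End ellp_density.

Section perturbed_basis.
Context (R : realType) (p : R) (p1 : (1 <= p%:E)%E) (I Gamma : choiceType).
Context (E : I -> normedModType R) (V : normedModType R).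
Local Notation Z := (lpsum p1 E).
Local Notation l := (lpsum p1 (fun _ : Gamma => R^o : normedModType R)).
Variables (J : {linear V -> Z}) (x : Gamma -> V) (r : Gamma -> Z) (e : R).
Hypothesis J_isometry : forall v, `|J v| = `|v|.
Hypothesis V_complete : seq_complete V.
Hypotheses (e_gt0 : 0 < e) (e_lt1 : e < 1) (e_small : 3 * e <= 1).
Hypothesis x1 : forall g, `|x g| = 1.
Hypothesis r_le : forall g, `|r g| <= e.
Let d g := J (x g) - r g.
Hypothesis d_disjoint : forall g h, g <> h -> disjoint_coord (d g) (d h).
Hypothesis r_sum : forall (s : seq Gamma) (c : Gamma -> R), uniq s ->
  `|\sum_(g <- s) c g *: r g| `^ p <= 2 * e `^ p * \sum_(g <- s) `|c g| `^ p.
Local Notation comb s c := (\sum_(g <- s) c g *: ellp_basis p1 g).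

Let p_ge1 : 1 <= p. Proof. by rewrite -lee_fin. Qed.
Let p_gt0 : 0 < p. Proof. exact: lt_le_trans p_ge1. Qed.

Let d_le g : `|d g| <= 1 + e.
Proof.
by apply: le_trans (ler_normB _ _) _; rewrite J_isometry x1 lerD2l.
Qed.

Let d_ge g : 1 - e <= `|d g|.
Proof.
by apply: le_trans _ (lerB_dist _ _); rewrite J_isometry x1 lerB.
Qed.

Let comb_r s (c : Gamma -> R) : uniq s ->
  `|\sum_(g <- s) c g *: r g| <= 2 * e * `|comb s c|.
Proof.
move=> us; have e2 : 0 <= 2 * e by rewrite mulr_ge0// ltW.
apply: (powR_le_cancel p_gt0 (normr_ge0 _)); first by rewrite mulr_ge0.
apply: le_trans (r_sum c us) _; rewrite powRM// ?(ltW e_gt0)//.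
have ec := ellp_comb_norm p1 c us; rewrite ec.
apply: ler_wpM2r; first by apply: sumr_ge0 => g _; exact: powR_ge0.
rewrite powRM ?(ltW e_gt0)//; apply: ler_wpM2r; first exact: powR_ge0.
(* 2 <= 2^p, so the constant 2 e^p is at most (2 e)^p. *)
by rewrite -[leLHS](powRr1 (ler0n R 2)) ler_powR// ler1n.
Qed.

Let comb_d s (c : Gamma -> R) : uniq s ->
  `|\sum_(g <- s) c g *: d g| `^ p = \sum_(g <- s) `|c g| `^ p * `|d g| `^ p.
Proof.
move=> us; have dis : {in s &, forall g h, g != h ->
    disjoint_coord (c g *: d g) (c h *: d h)}.
  move=> g h _ _ /eqP gh i; have eg := lpsumZ (c g) (d g) i.
  have eh := lpsumZ (c h) (d h) i; rewrite eg eh.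
  by have [->|->] := d_disjoint gh i; rewrite scaler0; [left|right].
apply: (etrans (lpsum_powR_sum_disjoint us dis)).
by apply: eq_bigr => g _; rewrite normrZ powRM.
Qed.

Let comb_d_le s (c : Gamma -> R) : uniq s ->
  `|\sum_(g <- s) c g *: d g| <= (1 + e) * `|comb s c|.
Proof.
move=> us; have e1 : 0 <= 1 + e by rewrite addr_ge0// ltW.
apply: (powR_le_cancel p_gt0 (normr_ge0 _)); first by rewrite mulr_ge0.
rewrite powRM//; have ec := ellp_comb_norm p1 c us; have ed := comb_d c us.
rewrite ec ed mulr_sumr; apply: ler_sum => g _; rewrite mulrC.
by apply: ler_wpM2r; [exact: powR_ge0|exact: ge0_powR_le].
Qed.

Let comb_d_ge s (c : Gamma -> R) : uniq s ->
  (1 - e) * `|comb s c| <= `|\sum_(g <- s) c g *: d g|.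
Proof.
move=> us; have e1 : 0 <= 1 - e by rewrite subr_ge0 ltW.
apply: (powR_le_cancel p_gt0 _ (normr_ge0 _)); first by rewrite mulr_ge0.
rewrite powRM//; have ec := ellp_comb_norm p1 c us; have ed := comb_d c us.
rewrite ec ed mulr_sumr; apply: ler_sum => g _; rewrite mulrC.
by apply: ler_wpM2l; [exact: powR_ge0|exact: ge0_powR_le].
Qed.

Let comb_J s (c : Gamma -> R) :
  J (\sum_(g <- s) c g *: x g) = \sum_(g <- s) c g *: d g + \sum_(g <- s) c g *: r g.
Proof.
rewrite linear_sum -big_split/=; apply: eq_bigr => g _.
by rewrite linearZ -scalerDr subrK.
Qed.

Let comb_x_le s (c : Gamma -> R) : uniq s ->
  `|\sum_(g <- s) c g *: x g| <= (1 + 3 * e) * `|comb s c|.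
Proof.
move=> us; rewrite -J_isometry comb_J; apply: le_trans (ler_normD _ _) _.
apply: le_trans (lerD (comb_d_le c us) (comb_r c us)) _.
by rewrite -mulrDl ler_wpM2r//; lra.
Qed.

Let comb_x_ge s (c : Gamma -> R) : uniq s ->
  (1 - 3 * e) * `|comb s c| <= `|\sum_(g <- s) c g *: x g|.
Proof.
move=> us; rewrite -J_isometry comb_J.
have -> : 1 - 3 * e = (1 - e) - 2 * e by lra.
rewrite mulrBl lerBlDr.
apply: le_trans (comb_d_ge c us) _.
set u := \sum_(g <- s) _; set v := \sum_(g <- s) _.
have uE : u = (u + v) - v by rewrite addrK.
rewrite {1}uE; apply: le_trans (ler_normB _ _) _; rewrite lerD2l; exact: comb_r.
Qed.

(** The supports are disjoint: after one block is peeled off, the rest of z agrees with z on the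
    other blocks. *)
Let block_sum (z : Z) (s : seq Gamma) : uniq s ->
  \sum_(g <- s) `|lproj (lsupp (d g)) z| `^ p <= `|z| `^ p.
Proof.
elim: s z => [|g s ih] z; first by rewrite big_nil powR_ge0.
rewrite big_cons => /= /andP[gs us].
have ez := lpsum_powR_proj (lsupp (d g)) z; apply: (eq_ind_r (fun t => _ <= t) _ ez); apply: lerD; first exact: lexx.
pose z' := z - lproj (lsupp (d g)) z.
have eh h : h \in s -> `|lproj (lsupp (d h)) z'| `^ p = `|lproj (lsupp (d h)) z| `^ p.
  move=> hs; apply: (congr1 (fun w : Z => `|w| `^ p)).
  apply: lpsum_ext => i; rewrite !lprojE; case: asboolP => // hi.
  apply: (etrans (lpsumB _ _ i)); rewrite lproj_out ?subr0// => gi.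
  have gh : g <> h by move=> gh; move: gs; rewrite gh hs.
  have [e0|e0] := d_disjoint gh i.
    exact: (negP (gi : d g i != 0) (introT eqP e0)).
  exact: (negP (hi : d h i != 0) (introT eqP e0)).
exact: (eq_ind _ (fun t => t <= `|z'| `^ p) (ih z' us) _ (eq_big_seq _ eh)).
Qed.

(** [U] maps the unit vector at g to [x g], and [Q] maps [d g] back to that unit vector. Hence Q J U
    - 1 only sees the combination of the remainders, which [comb_r] bounds. *)
Lemma perturbed_basis_operators : exists (U : {linear l -> V}) (Q : {linear Z -> l}),
  [/\ forall a, `|U a| <= (1 + 3 * e) * `|a|,
      forall a, (1 - 3 * e) * `|a| <= `|U a|,
      forall z, `|Q z| <= (1 - e)^-1 * `|z| &
      forall a, `|Q (J (U a)) - a| <= (1 - e)^-1 * (2 * e) * `|a|].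
Proof.
have e3 : 0 <= 1 + 3 * e by rewrite addr_ge0// mulr_ge0// ltW.
have e1 : 0 < 1 - e by rewrite subr_gt0.
have [|U [UC Ucomb]] := @ellp_summation R p p1 Gamma V x (1 + 3 * e) e3 V_complete.
  move=> s c us; have ec := ellp_comb_norm p1 c us.
  rewrite -ec -powRM//; apply: ge0_powR_le => //; exact: comb_x_le.
pose psi g := sval (cid (norming_functional (d g))).
have [psi_lin psi_le psi_d] : [/\ forall g c u v, psi g (c *: u + v) = c * psi g u + psi g v,
    forall g u, `|psi g u| <= `|u| & forall g, psi g (d g) = `|d g|].
  by split=> g; rewrite /psi; case: (cid _) => ? [].
(* Coefficient of the projection onto the span of the disjoint vectors: a functional norming [d g],
   applied to the block of z on the support of [d g]. *)
pose q z g : R := `|d g|^-1 * psi g (lproj (lsupp (d g)) z).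
have dg0 g : 0 < `|d g| by apply: lt_le_trans (d_ge g).
have exq z : exists y : l, (forall g, y g = q z g) /\ `|y| <= (1 - e)^-1 * `|z|.
  have [s us|y yq yz] := @lpsum_of R p p1 Gamma (fun _ : Gamma => R^o : normedModType R)
      (q z) (((1 - e)^-1 * `|z|) `^ p).
    rewrite powRM ?invr_ge0 ?(ltW e1)//.
    apply: le_trans (ler_wpM2l (powR_ge0 _ _) (block_sum z us)).
    rewrite mulr_sumr; apply: ler_sum => g _.
    rewrite -powRM ?invr_ge0 ?(ltW e1)//; apply: ge0_powR_le => //.
    rewrite normrM normfV normr_id; apply: ler_pM => //.
    by rewrite lef_pV2 ?posrE.
  exists y; split=> //; apply: (powR_le_cancel p_gt0 (normr_ge0 _) _ yz).
  by rewrite mulr_ge0// invr_ge0 ltW.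
pose Q0 z := sval (cid (exq z)).
have Q0E z g : Q0 z g = q z g by exact: (svalP (cid (exq z))).1.
have Q0le z : `|Q0 z| <= (1 - e)^-1 * `|z| by exact: (svalP (cid (exq z))).2.
have qlin g c y z : q (c *: y + z) g = c * q y g + q z g.
  have el : lproj (lsupp (d g)) (c *: y + z) =
      c *: lproj (lsupp (d g)) y + lproj (lsupp (d g)) z by exact: linearP.
  apply: (etrans (congr1 (fun w => `|d g|^-1 * psi g w) el)).
  apply: (etrans (congr1 (fun t => `|d g|^-1 * t) (psi_lin g c _ _))).
  by rewrite mulrDr mulrCA.
have Q0lin : linear Q0.
  move=> c y z; apply: lpsum_ext => g; apply: (etrans (Q0E _ g)).
  apply: (etrans (qlin g c y z)); apply/esym; apply: (etrans (lpsumD _ _ g)).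
  exact: (f_equal2 (fun a b : R => a + b) (etrans (lpsumZ c (Q0 y) g)
    (congr1 (fun t : R => c * t) (Q0E y g))) (Q0E z g)).
have [Q QE] := mk_linear Q0lin.
have Qd g : Q (d g) = ellp_basis p1 g.
  rewrite QE; apply: lpsum_ext => h; rewrite Q0E ellp_basisE /q.
  have [->|/eqP hg] := eqVneq h g.
    by rewrite lproj_lsupp// psi_d mulVf// gt_eqF.
  rewrite (_ : lproj _ _ = 0).
    have psi0 : psi h 0 = 0.
      apply/eqP; rewrite -normr_eq0 eq_le normr_ge0 andbT.
      by apply: le_trans (psi_le h 0) _; rewrite normr0.
    by rewrite psi0 mulr0.
  apply: lpsum_ext => i; rewrite lprojE; case: asboolP => //.
  move=> hi; have [e0|//] := d_disjoint hg i.
  by case: (negP (hi : d h i != 0) (introT eqP e0)).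
have Qle z : `|Q z| <= (1 - e)^-1 * `|z| by rewrite QE.
have Nlin : linear (fun a => Q (J (U a)) - a).
  move=> c a b; have eU : U (c *: a + b) = c *: U a + U b by exact: linearP.
  have eJ : J (U (c *: a + b)) = c *: J (U a) + J (U b) by rewrite eU; exact: linearP.
  have eQ : Q (J (U (c *: a + b))) = c *: Q (J (U a)) + Q (J (U b)).
    by rewrite eJ; exact: linearP.
  by rewrite eQ opprD addrACA -scalerBr.
have [N NE] := mk_linear Nlin.
pose k := (1 - e)^-1 * (2 * e).
have k0 : 0 <= k by rewrite mulr_ge0 ?invr_ge0 ?(ltW e1)// mulr_ge0// ltW.
(* A crude Lipschitz constant for the density argument; the bound sought is [k]. *)
pose k' := (1 - e)^-1 * (1 + 3 * e) + 1.
have k'0 : 0 <= k' by rewrite addr_ge0// mulr_ge0// invr_ge0 ltW.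
have Nk' a : `|N a| <= k' * `|a|.
  rewrite NE; apply: le_trans (ler_normB _ _) _; rewrite mulrDl mul1r lerD2r.
  apply: le_trans (Qle _) _; rewrite -mulrA ler_wpM2l ?invr_ge0 ?(ltW e1)//.
  by rewrite J_isometry.
exists U, Q; split; [exact: UC| |exact: Qle|].
- have e13 : 0 <= 1 - 3 * e by rewrite subr_ge0.
  apply: (ellp_dense_le e13 e3 (fun a b => lipschitz_scaled_norm a b e13)
    (fun a b => lipschitz_norm b a UC)) => s c us.
  by rewrite Ucomb//; exact: comb_x_ge.
- move=> a; have eN := NE a; rewrite -eN -/k; move: a {eN}.
  apply: (ellp_dense_le k'0 k0 (fun a b => lipschitz_norm a b Nk')
    (fun a b => lipschitz_scaled_norm b a k0)) => s c us.
  rewrite NE Ucomb// comb_J linearD.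
  have -> : Q (\sum_(g <- s) c g *: d g) = comb s c.
    by rewrite linear_sum; apply: eq_bigr => g _; rewrite linearZ/= Qd.
  rewrite addrC addrA addNr add0r; apply: le_trans (Qle _) _.
  by rewrite /k -mulrA ler_wpM2l ?invr_ge0 ?(ltW e1)//; exact: comb_r.
Qed.

End perturbed_basis.

(** * Complemented subspaces and assembly *)

Section subspaces.
Context {R : realType}.
Implicit Types U V W L : normedModType R.
Local Notation csub := closed_subspace_normedModType.

Lemma linear_comp_exists (U V W : lmodType R) (A : {linear V -> W}) (B : {linear U -> V}) :
  exists C : {linear U -> W}, forall x, C x = A (B x).
Proof.
have lin : linear (fun x => A (B x)).
  move=> c x y; have e : B (c *: x + y) = c *: B x + B y by exact: linearP.
  by rewrite e; exact: linearP.
by have [C CE] := mk_linear lin; exists C.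
Qed.

Lemma unif_convex_isometry (p : R) V W (A : {linear V -> W}) :
  (forall x, `|A x| = `|x|) -> unif_convex p W -> unif_convex p V.
Proof.
move=> A1 Wc tau tau0; have [c c0 cP] := Wc tau tau0; exists c => // x y.
have := cP (A x) (A y).
have e1 : A x - A y = A (x - y) by exact/esym/linearB.
have e2 : 2^-1 *: (A x + A y) = A (2^-1 *: (x + y)).
  have e3 : A (x + y) = A x + A y by exact: linearD.
  by rewrite -e3; exact/esym/linearZ.
by rewrite e1 e2 !A1.
Qed.

Lemma isomorphic_sym V W : isomorphic V W -> isomorphic W V.
Proof. by move=> [A [B [Ac Bc AB BA]]]; exists B, A. Qed.

Lemma bounded_below_embeds V W (A : {linear V -> W}) (c C : R) : 0 < c -> 0 <= C ->
  seq_complete V -> (forall x, c * `|x| <= `|A x|) -> (forall x, `|A x| <= C * `|x|) ->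
  embeds V W.
Proof.
move=> c0 C0 Vc cA AC.
have [Y [A' [B [_ _ AB _ _]]]] := bounded_below_range c0 C0 Vc cA AC.
by exists Y, A', B.
Qed.

Lemma C_isomorphic_of_bounds V W (A : {linear V -> W}) (c C D : R) : 0 < c -> 0 <= C ->
  C <= D * c -> seq_complete V -> (forall x, c * `|x| <= `|A x|) ->
  (forall x, `|A x| <= C * `|x|) ->
  exists Y : closed_subspace W, C_isomorphic D V Y.
Proof.
move=> c0 C0 CD Vc cA AC.
have [Y [A' [B [_ _ AB A'C Bc]]]] := bounded_below_range c0 C0 Vc cA AC.
exists Y, A', B; split=> //.
apply: (@le_trans _ _ (C%:E * (c^-1)%:E)%E); last first.
  by rewrite -EFinM lee_fin ler_pdivrMr.
by apply: lee_pmul => //; exact: opnorm_ge0.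
Qed.

Lemma embeds_bounded_below V W : embeds V W -> exists (A : {linear V -> W}) (c C : R),
  [/\ 0 < c, 0 <= C, forall x, c * `|x| <= `|A x| & forall x, `|A x| <= C * `|x|].
Proof.
move=> [Y [A [B [Ac Bc AB BA]]]].
have [C C0 AC] := continuous_linear_bound Ac.
have [D D0 BD] := continuous_linear_bound Bc.
have [A' A'E] := linear_comp_exists (@csub_val R W Y : {linear csub Y -> W}) A.
exists A', D^-1, C; split; rewrite ?invr_gt0 ?(ltW C0)// => x; rewrite A'E csub_val_norm.
  by rewrite ler_pdivrMl//; rewrite -{1}(AB x).
exact: AC.
Qed.

(** The projection is A (Q A)^(-1) Q, where A is [U] followed by the inclusion of [X]. As Q A = 1 +
    N with N of norm at most 1/2, a Neumann series inverts it. *)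
Lemma complemented_of_almost_inverse L W (X : closed_subspace W)
    (U : {linear L -> csub X}) (Q : {linear W -> L}) (c C q : R) :
  0 < c -> 0 <= C -> seq_complete L ->
  (forall a, c * `|a| <= `|U a|) -> (forall a, `|U a| <= C * `|a|) ->
  0 <= q -> (forall w, `|Q w| <= q * `|w|) ->
  (forall a, `|Q (csub_val (U a)) - a| <= 2^-1 * `|a|) ->
  exists Y : closed_subspace W,
    [/\ (Y : set _) `<=` (X : set _), isomorphic Y L & complemented Y].
Proof.
move=> c0 C0 Lc cU UC q0 Qq Nle.
have [A AE] := linear_comp_exists (@csub_val R W X : {linear csub X -> W}) U.
have A1 a : `|A a| = `|U a| by rewrite AE csub_val_norm.
have cA a : c * `|a| <= `|A a| by rewrite A1.
have AC a : `|A a| <= C * `|a| by rewrite A1.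
have [Y [A' [B [YA A'E AB _ _]]]] := bounded_below_range c0 C0 Lc cA AC.
have Nlin : linear (fun a => Q (A a) - a).
  move=> k a b; have e1 : A (k *: a + b) = k *: A a + A b by exact: linearP.
  have e2 : Q (A (k *: a + b)) = k *: Q (A a) + Q (A b) by rewrite e1; exact: linearP.
  by rewrite e2 opprD addrACA -scalerBr.
have [N NE] := mk_linear Nlin.
have N2 a : `|N a| <= 2^-1 * `|a| by rewrite NE AE; exact: Nle.
have [D [D1 D2 D3]] := neumann_inverse Lc N2.
have QA a : a + N a = Q (A a) by rewrite NE addrC subrK.
have [DQ DQE] := linear_comp_exists D Q.
have [P PE] := linear_comp_exists A DQ.
have PA a : P (A a) = A a by rewrite PE DQE -QA D2.
exists Y; split.
- by rewrite YA => _ [a _ <-]; rewrite AE; exact: csub_valP.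
- by apply: isomorphic_sym; exists A', B.
exists P; split.
- apply: (@bounded_linear_cont _ _ _ _ (C * (2 * q))) => w; rewrite PE DQE.
  apply: le_trans (AC _) _; rewrite -!mulrA ler_wpM2l//.
  by apply: le_trans (D3 _) _; rewrite ler_wpM2l.
- by move=> w; rewrite [P w]PE PA.
rewrite YA; apply/seteqP; split=> [_ [w _ <-]|_ [a _ <-]].
  by rewrite PE; exists (DQ w).
by exists (A a).
Qed.

End subspaces.

(** If no unit vector had a restriction of norm at most [k], homogeneity would make the restriction
    bounded below, hence an embedding of [V] into the sum over [S]. *)
Lemma lproj_spread (R : realType) (p : R) (p1 : (1 <= p%:E)%E) (I : choiceType)
    (E : I -> normedModType R) (V : normedModType R) (Gamma : Type)
    (J : {linear V -> lpsum p1 E}) :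
  (forall v, `|J v| = `|v|) -> seq_complete V ->
  (forall (K : Type) (S : set I), infinite_set [set: K] -> ~ inj_into Gamma K ->
    inj_into {i | S i} K -> ~ embeds V (lpsum p1 (fun j : S => E (val j)))) ->
  forall (K : Type) (S : set I) (k : R),
    infinite_set [set: K] -> ~ inj_into Gamma K -> inj_into {i | S i} K -> 0 < k ->
    exists x : V, `|x| = 1 /\ `|lproj S (J x)| <= k.
Proof.
move=> J1 Vc nE K S k Koo GK SK k0; apply: contrapT => nx.
apply: (nE K S Koo GK SK); have [A A1] := lpsum_restrict p1 E S.
have [L LE] := linear_comp_exists A J.
have h2 x : `|L x| <= 1 * `|x|.
  by rewrite LE A1 mul1r -J1; exact: ler_norm_lproj.
suff h1 x : k * `|x| <= `|L x| by exact: (bounded_below_embeds k0 ler01 Vc h1 h2).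
rewrite LE A1; have [->|x0] := eqVneq x 0; first by rewrite normr0 mulr0.
have nx0 : 0 < `|x| by rewrite normr_gt0.
rewrite leNgt; apply/negP => xk; apply: nx; exists (`|x|^-1 *: x).
split; first by rewrite normrZ normfV normr_id mulVf// gt_eqF.
have e1 : J (`|x|^-1 *: x) = `|x|^-1 *: J x by exact: linearZ.
have e2 : lproj S (J (`|x|^-1 *: x)) = `|x|^-1 *: lproj S (J x).
  by rewrite e1; exact: linearZ.
by rewrite e2 normrZ normfV normr_id ler_pdivrMl// mulrC ltW.
Qed.

(** The constant 12 gives 6 e <= eps / 2 and 3 e eps <= eps / 4, together less than eps. *)
Lemma near_isometry_ratio (R : realFieldType) (e eps : R) : 0 < eps ->
  12 * e <= eps -> 12 * e <= 1 -> 1 + 3 * e <= (1 + eps) * (1 - 3 * e).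
Proof.
move=> eps0 ee e1.
have : 0 <= eps * (1 - 12 * e) by rewrite mulr_ge0 ?(ltW eps0)// subr_ge0.
by rewrite mulrBr mulr1 => h; rewrite mulrBr mulr1 !mulrDl mul1r; nra.
Qed.

(** * The implications between the four conditions *)

Section assembly.
Context (R : realType) (p : R) (p1 : (1 <= p%:E)%E) (p2 : p < 2).
Context (d : measure_display) (T : measurableType d).
Context (nu : {measure set T -> \bar R}).
Local Notation L := (LspaceType nu p1).
Variable X : closed_subspace L.
Variable Gamma : choiceType.
Hypothesis Gamma_uncountable : ~ countable [set: Gamma].
Local Notation csub := closed_subspace_normedModType.
Local Notation l := (lpsum p1 (fun _ : Gamma => R^o : normedModType R)).

Let no_small_embedding := forall (K : choiceType) (Y : normedModType R),
  infinite_set [set: K] -> card_lt K Gamma -> Lp_card_space p1 K Y -> ~ embeds X Y.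

Let p_ge1 : 1 <= p. Proof. by rewrite -lee_fin. Qed.

(** Common source of (1) and (2): [U] provides the almost isometric copy of l_p(Gamma), and [Q] is
    almost a left inverse of it, defined on all of L_p. *)
Lemma not_embeds_operators (e : R) : no_small_embedding -> 0 < e -> 3 * e <= 1 ->
  exists (U : {linear l -> csub X}) (Q : {linear L -> l}),
  [/\ forall a, `|U a| <= (1 + 3 * e) * `|a|,
      forall a, (1 - 3 * e) * `|a| <= `|U a|,
      forall v, `|Q v| <= (1 - e)^-1 * `|v| &
      forall a, `|Q (csub_val (U a)) - a| <= (1 - e)^-1 * (2 * e) * `|a|].
Proof.
move=> nE e0 e3; have e1 : e < 1 by lra.
have [I [mu [JL JL1]]] := Lspace_lpsum_isometry p1 nu.
pose E i : normedModType R := LspaceType (mu i) p1.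
have [J JE] := linear_comp_exists JL (@csub_val R L X : {linear csub X -> L}).
have J1 x : `|J x| = `|x| by rewrite JE JL1 csub_val_norm.
have E_type i : has_type p (E i) by apply: Lspace_type; exact: ltW.
have Xc : seq_complete (csub X) by apply: csub_complete; exact: Lspace_complete.
have Xconv : 1 < p -> unif_convex p (csub X).
  move=> p_gt1; apply: (@unif_convex_isometry _ _ _ _ (@csub_val R L X : {linear csub X -> L})).
    by move=> x; exact: csub_val_norm.
  exact: Lspace_unif_convex.
(* The sum over [S] is an L_p(aleph') space for the cardinal aleph' of [K], so (4) excludes it. *)
have nemb (K : Type) (S : set I) : infinite_set [set: K] -> ~ inj_into Gamma K ->
    inj_into {i | S i} K -> ~ embeds (csub X) (lpsum p1 (fun j : S => E (val j))).
  move=> Koo GK SK; apply: (nE {classic K}) => //.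
    split; first by apply/inj_into_card; have [/GK|] := inj_into_total Gamma K.
    by move=> /inj_into_card.
  exists S, (fun=> d), (fun=> T), (fun j => mu (val j)); split.
    apply/inj_into_card; apply: inj_into_trans SK.
    exists (fun j : S => exist S (val j) (set_mem (valP j))) => i j [ij].
    exact: val_inj.
  have [F FE] := @mk_linear R _ _ (@id (lpsum p1 (fun j : S => E (val j)))) (fun _ _ _ => erefl).
  exists F; split; last by move=> y; rewrite FE.
  by exists id => y; rewrite FE.
have Gnat : ~ inj_into Gamma nat.
  by move=> /inj_into_card Gc; exact: Gamma_uncountable.
have spread := lproj_spread J1 Xc nemb.
have [x [r [x1 re dis rsum]]] := almost_disjoint_family J1 E_type Xc Xconv spread Gnat e0.
have [U [Q [h1 h2 h3 h4]]] := perturbed_basis_operators J1 Xc e0 e1 e3 x1 re dis rsum.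
have [Q' Q'E] := linear_comp_exists Q JL.
exists U, Q'; split; [exact: h1|exact: h2| |].
  by move=> v; rewrite Q'E; apply: le_trans (h3 _) _; rewrite JL1.
by move=> a; rewrite Q'E -JE; exact: h4.
Qed.

Lemma not_embeds_near_isometry : no_small_embedding -> forall eps : R, 0 < eps ->
  exists Y : closed_subspace (csub X), C_isomorphic (1 + eps) (ellp p1 Gamma) Y.
Proof.
move=> nE eps eps0; pose e := Num.min eps 1 / 12.
have [e0 ee e12] : [/\ 0 < e, 12 * e <= eps & 12 * e <= 1].
  have e12 : 12 * e = Num.min eps 1 by rewrite /e mulrC divfK.
  by rewrite e12 /e divr_gt0 ?lt_min ?eps0 ?ltr01// !ge_min !lexx orbT.
have e3 : 3 * e <= 1 by lra.
have [U [Q [h1 h2 _ _]]] := not_embeds_operators nE e0 e3.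
apply: (C_isomorphic_of_bounds _ _ _ _ h2 h1).
- by lra.
- by lra.
- exact: near_isometry_ratio.
- exact: ellp_complete.
Qed.

Lemma not_embeds_complemented : no_small_embedding ->
  exists Y : closed_subspace L, [/\ (Y : set _) `<=` (X : set _),
    isomorphic Y (ellp p1 Gamma) & complemented Y].
Proof.
(* With e = 1/8 the defect 2 e / (1 - e) equals 2/7, below the 1/2 needed for the Neumann series. *)
move=> nE; pose e : R := 8^-1.
have [e0 e3 e1 eq] : [/\ 0 < e, 3 * e <= 1, 0 < 1 - e & 2 * e <= 2^-1 * (1 - e)].
  by split; rewrite /e; lra.
have [U [Q [h1 h2 h3 h4]]] := not_embeds_operators nE e0 e3.
have e13 : 0 < 1 - 3 * e by rewrite /e; lra.
have e13' : 0 <= 1 + 3 * e by rewrite addr_ge0// mulr_ge0// ltW.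
have q0 : 0 <= (1 - e)^-1 by rewrite invr_ge0 ltW.
have lc : seq_complete (l : normedModType R) by exact: ellp_complete.
apply: (complemented_of_almost_inverse e13 e13' lc h2 h1 q0 h3) => a.
apply: le_trans (h4 a) _; apply: ler_wpM2r => //.
by rewrite mulrC ler_pdivrMr.
Qed.

(** An embedding of [X] into a small l_p-sum would carry the copy of l_p(Gamma) along, and the
    composition would still be bounded below. *)
Lemma embeds_not_small : embeds (ellp p1 Gamma) (csub X) -> no_small_embedding.
Proof.
move=> lX K Y Koo [KG GK] [I [d' [T' [mu [IK [F [_ F1]]]]]]] XY.
have [A [a [_ [a0 _ aA _]]]] := embeds_bounded_below lX.
have [B [b [_ [b0 _ bB _]]]] := embeds_bounded_below XY.
have [BA BAE] := linear_comp_exists B A; have [FBA FBAE] := linear_comp_exists F BA.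
have ba0 : 0 < b * a by exact: mulr_gt0.
apply: (@ellp_not_small R p p1 p2 K Gamma I d' T' mu FBA (b * a) Koo) => //.
- exact/inj_into_card.
- by move=> /inj_into_card.
move=> x; rewrite FBAE F1 BAE -mulrA; apply: le_trans _ (bB _).
by rewrite ler_wpM2l// ltW.
Qed.

(** [Y] is given as a subspace of L_p, so its isomorphism with l_p(Gamma) is first corestricted to
    [X]. *)
Lemma complemented_embeds : (exists Y : closed_subspace L,
    [/\ (Y : set _) `<=` (X : set _), isomorphic Y (ellp p1 Gamma) & complemented Y]) ->
  embeds (ellp p1 Gamma) (csub X).
Proof.
move=> [Y [YX /isomorphic_sym lY _]].
have lL : embeds (ellp p1 Gamma) L by exists Y.
have [A [B [Ac Bc AB BA]]] := lY.
have [C C0 AC] := continuous_linear_bound Ac.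
have [D D0 BD] := continuous_linear_bound Bc.
have ex a : exists x : csub X, csub_val x = csub_val (A a).
  by apply: csub_val_surj; apply: YX; exact: csub_valP.
pose f a := sval (cid (ex a)).
have fE a : csub_val (f a) = csub_val (A a) by exact: svalP (cid (ex a)).
have flin : linear f.
  move=> c a b; apply: (@csub_val_inj R L X); apply: (etrans (fE _)).
  apply/esym; apply: (etrans (csub_val_comb c (f a) (f b))).
  apply: (etrans (f_equal2 (fun u v : L => c *: u + v) (fE a) (fE b))).
  apply: (etrans (esym (csub_val_comb c (A a) (A b)))).
  by congr csub_val; apply/esym; exact: linearP.
have [G GE] := mk_linear flin.
have GN a : `|G a| = `|A a|.
  by rewrite GE; exact: (congr1 (fun v : L => `|v|) (fE a)).
apply: (@bounded_below_embeds _ _ _ G D^-1 C); rewrite ?invr_gt0 ?(ltW C0)//.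
- exact: ellp_complete.
- by move=> a; rewrite GN ler_pdivrMl// -{1}(AB a).
- by move=> a; rewrite GN.
Qed.

End assembly.

Theorem theorem2 (R : realType) (p : R) (p1 : (1 <= p%:E)%E) (p2 : p < 2)
    (d : measure_display) (T : measurableType d)
    (nu : {measure set T -> \bar R})
    (X : closed_subspace (LspaceType nu p1))
    (Gamma : choiceType) (Gamma_uncountable : ~ countable [set: Gamma]) :
  [<-> forall eps : R, 0 < eps ->
         exists Y : closed_subspace X, C_isomorphic (1 + eps) (ellp p1 Gamma) Y;
       exists Y : closed_subspace (LspaceType nu p1),
         [/\ (Y : set _) `<=` (X : set _), isomorphic Y (ellp p1 Gamma)
           & complemented Y];
       embeds (ellp p1 Gamma) X;
       forall (K : choiceType) (Y : normedModType R),
         infinite_set [set: K] -> card_lt K Gamma ->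
         Lp_card_space p1 K Y -> ~ embeds X Y ].
Proof.
have h4 := not_embeds_near_isometry p2 Gamma_uncountable (X := X).
have h4' := not_embeds_complemented p2 Gamma_uncountable (X := X).
have h3 := @embeds_not_small R p p1 p2 d T nu X Gamma.
have h2 := @complemented_embeds R p p1 d T nu X Gamma.
have h1 : (forall eps : R, 0 < eps ->
    exists Y : closed_subspace X, C_isomorphic (1 + eps) (ellp p1 Gamma) Y) ->
    embeds (ellp p1 Gamma) X.
  by move=> /(_ 1 ltr01)[Y [A [B [AB _]]]]; exists Y, A, B.
(* (1) implies (2) by way of (3) and (4), so that both constructions start from (4). *)
tfae; [by move=> /h1/h3/h4'|exact: h2|exact: h3|exact: h4].
Qed.
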